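(* Let $R$ be a commutative domain of finite character and of Krull dimension $1$, with field of fractions $Q$. Assume that for every finitely generated torsion-free $R$-module $X$, every module in $\mathrm{Add}(X)$ is a direct sum of finitely generated modules. Then: (1) for every maximal ideal $\mathfrak m$ of $R$ and every ring $S$ with $R_\mathfrak m\subseteq S\subseteq \overline{R_\mathfrak m}$, every finitely generated indecomposable torsion-free $S$-module has local endomorphism ring; (2) there is at most one maximal ideal $\mathfrak m_0$ of $R$ such that, for every maximal ideal $\mathfrak m\neq\mathfrak m_0$, every finitely generated ideal of $R_\mathfrak m$ is generated by at most two elements; moreover $\overline{R_\mathfrak m}$ is a valuation domain for every maximal ideal $\mathfrak m\neq \mathfrak m_0$; (3) for each maximal ideal $\mathfrak m$ of $R$ there is a unique maximal ideal of $\overline R$ lying over $\mathfrak m$; in particular $\overline R$ has finite character. Furthermore, if every finitely generated ideal of $R_\mathfrak m$ is at most two-generated for every maximal ideal $\mathfrak m$ of $R$ (no exception), then $\overline{R}$ is a Prüfer domain of Krull dimension $1$ and every finitely generated ideal of $R$ is generated by at most two elements.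
   Context: A commutative domain has finite character if every non-zero element lies in only finitely many maximal ideals. $\overline{A}$ denotes the integral closure of a domain $A$ in its field of fractions. A module $M$ is torsion-free if $M\to M\otimes_R Q$ is injective. $\mathrm{Add}(X)$ is the class of modules isomorphic to direct summands of direct sums of copies of $X$. Statement (2) should be read: there exists a maximal ideal $\mathfrak m_0$ (possibly none is needed) such that the stated properties hold for all other maximal ideals. *)

(* Defs.v *)
From HB Require Import structures.
From mathcomp Require Import all_boot all_order all_algebra.
From Stdlib Require List.
Set Implicit Arguments. Unset Strict Implicit. Unset Printing Implicit Defensive.
Import Order.TTheory GRing.Theory Num.Theory.
Local Open Scope ring_scope.

(* Ideals of a subring A (given as a predicate) of a commutative ring T.
   For a ring R itself take A := fun _ => True.                        *)
Section SubringIdeals.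
Variables (T : comNzRingType) (A : T -> Prop).

Definition sr_ideal (I : T -> Prop) : Prop :=
  (forall x, I x -> A x) /\ I 0 /\
  (forall x y, I x -> I y -> I (x - y)) /\
  (forall a x, A a -> I x -> I (a * x)).

Definition sr_proper_ideal (I : T -> Prop) : Prop := sr_ideal I /\ ~ I 1.

Definition sr_prime_ideal (I : T -> Prop) : Prop :=
  sr_proper_ideal I /\ forall x y, A x -> A y -> I (x * y) -> I x \/ I y.

Definition sr_maximal_ideal (I : T -> Prop) : Prop :=
  sr_proper_ideal I /\
  forall J, sr_proper_ideal J -> (forall x, I x -> J x) -> forall x, J x -> I x.

Definition sr_finite_character : Prop :=
  forall x, A x -> x != 0 ->
    exists l : seq (T -> Prop), forall I, sr_maximal_ideal I -> I x ->
      exists J, List.In J l /\ forall y, I y <-> J y.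

Definition sr_prime_chain (c : nat -> T -> Prop) (n : nat) : Prop :=
  (forall i, (i <= n)%N -> sr_prime_ideal (c i)) /\
  (forall i, (i < n)%N ->
     (forall x, c i x -> c i.+1 x) /\ exists x, c i.+1 x /\ ~ c i x).

Definition sr_krull_dim (n : nat) : Prop :=
  (exists c, sr_prime_chain c n) /\ ~ (exists c, sr_prime_chain c n.+1).

Definition sr_span (xs : seq T) : T -> Prop := fun z =>
  exists cs : seq T, size cs = size xs /\ (forall c, c \in cs -> A c) /\
    z = \sum_(i < size xs) cs`_i * xs`_i.

Definition sr_fg_ideal (I : T -> Prop) : Prop :=
  sr_ideal I /\ exists xs : seq T, (forall x, x \in xs -> A x) /\
    forall z, I z <-> sr_span xs z.

Definition sr_fg_ideals_2gen : Prop :=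
  forall I, sr_fg_ideal I ->
    exists x y, A x /\ A y /\ forall z, I z <-> sr_span [:: x; y] z.

Definition integral_over (x : T) : Prop :=
  exists p : {poly T}, p \is monic /\ (forall i, A p`_i) /\ root p x.

(* A-submodules of T (fractional ideals when T is the fraction field) *)
Definition sr_submodule (J : T -> Prop) : Prop :=
  J 0 /\ (forall x y, J x -> J y -> J (x - y)) /\
  (forall a x, A a -> J x -> J (a * x)).

Definition ideal_prod (I J : T -> Prop) : T -> Prop := fun z =>
  exists us vs : seq T, size us = size vs /\
    (forall u, u \in us -> I u) /\ (forall v, v \in vs -> J v) /\
    z = \sum_(i < size us) us`_i * vs`_i.

Definition sr_invertible_ideal (I : T -> Prop) : Prop :=
  exists J, sr_submodule J /\ forall z, A z <-> ideal_prod I J z.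

(* Pruefer domain: every nonzero finitely generated ideal is invertible
   (A is a subring of a field T, which is its fraction field). *)
Definition sr_pruefer : Prop :=
  forall I, sr_fg_ideal I -> (exists x, I x /\ x != 0) -> sr_invertible_ideal I.

End SubringIdeals.

(* Valuation domain, for a subring A of a field F which is its fraction
   field: for every nonzero x of F, x or x^-1 lies in A. *)
Definition valuation_in (F : fieldType) (A : F -> Prop) : Prop :=
  forall x : F, x != 0 -> A x \/ A x^-1.

Definition is_subring (T : comNzRingType) (A : T -> Prop) : Prop :=
  A 0 /\ A 1 /\ (forall x y, A x -> A y -> A (x - y)) /\
  (forall x y, A x -> A y -> A (x * y)).

Section Modules.
Variables (K : comNzRingType).

Definition is_linmap (U V : lmodType K) (f : U -> V) : Prop :=
  forall (a : K) (x y : U), f (a *: x + y) = a *: f x + f y.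

Variable (M : lmodType K).

Definition submodule (N : M -> Prop) : Prop :=
  N 0 /\ (forall x y, N x -> N y -> N (x - y)) /\
  (forall (a : K) x, N x -> N (a *: x)).

Definition mod_span (xs : seq M) : M -> Prop := fun m =>
  exists cs : seq K, size cs = size xs /\
    m = \sum_(i < size xs) cs`_i *: xs`_i.

Definition fg_submodule (N : M -> Prop) : Prop :=
  submodule N /\ exists xs : seq M, (forall x, x \in xs -> N x) /\
    forall m, N m <-> mod_span xs m.

Definition fg_module : Prop := fg_submodule (fun _ => True).

Definition torsion_free : Prop :=
  forall (r : K) (m : M), r *: m = 0 -> r = 0 \/ m = 0.

Definition complement_in (N P C : M -> Prop) : Prop :=
  submodule P /\ submodule C /\ (forall m, P m -> C m -> m = 0) /\
  (forall m, N m <-> exists a b, P a /\ C b /\ m = a + b).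

Definition indecomposable : Prop :=
  (exists m : M, m != 0) /\
  forall N1 N2, complement_in (fun _ => True) N1 N2 ->
    (forall m, N1 m -> m = 0) \/ (forall m, N2 m -> m = 0).

(* endomorphisms (as linear functions) and locality of End(M):
   the non-invertible endomorphisms form a proper two-sided ideal *)
Definition endo (f : M -> M) : Prop := is_linmap f.

Definition endo_invertible (f : M -> M) : Prop :=
  exists g, endo g /\ (forall m, g (f m) = m) /\ (forall m, f (g m) = m).

Definition local_End : Prop :=
  ~ endo_invertible (fun _ => 0) /\
  (forall f g, endo f -> endo g -> ~ endo_invertible f -> ~ endo_invertible g ->
      ~ endo_invertible (fun m => f m + g m)) /\
  (forall f g, endo f -> endo g -> ~ endo_invertible f ->
      ~ endo_invertible (f \o g) /\ ~ endo_invertible (g \o f)).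

Definition internal_dsum (I : Type) (N : I -> M -> Prop) : Prop :=
  (forall i, submodule (N i)) /\
  (forall m, exists ps : seq (I * M), List.NoDup (map fst ps) /\
      (forall p, List.In p ps -> N p.1 p.2) /\ m = \sum_(p <- ps) p.2) /\
  (forall ps : seq (I * M), List.NoDup (map fst ps) ->
      (forall p, List.In p ps -> N p.1 p.2) -> \sum_(p <- ps) p.2 = 0 ->
      forall p, List.In p ps -> p.2 = 0).

Definition dsum_of_fg : Prop :=
  exists (I : Type) (N : I -> M -> Prop),
    internal_dsum N /\ forall i, fg_submodule (N i).

End Modules.

(* N is in Add(X): N is isomorphic to a direct summand of a direct sum of
   copies of X (the direct sum realized as an internal one inside some M) *)
Definition in_Add (K : comNzRingType) (X N : lmodType K) : Prop :=
  exists (M : lmodType K) (I : Type) (F : I -> M -> Prop),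
    internal_dsum F /\
    (forall i, exists e : X -> M, is_linmap e /\ injective e /\
        forall m, F i m <-> exists x, m = e x) /\
    exists (h : N -> M) (C : M -> Prop), is_linmap h /\ injective h /\
      complement_in (fun _ => True) (fun m => exists n, m = h n) C.

(* localization R_m as a subring of the fraction field Q *)
Definition loc (R : idomainType) (Q : fieldType) (f : R -> Q) (m : R -> Prop)
  : Q -> Prop := fun q => exists a s, ~ m s /\ q = f a / f s.

(* Main.v *)
Require Import Defs.
From HB Require Import structures.
From mathcomp Require Import all_boot all_order all_algebra.
From mathcomp Require Import fingroup perm boolp.
From mathcomp Require Import functions.
From mathcomp Require Import ring.
Import GRing.Theory.
Set Implicit Arguments. Unset Strict Implicit. Unset Printing Implicit Defensive.
Local Open Scope ring_scope.

(** If e is an endomorphism of X such that e - e^2 factors through copies of Z,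
  the maps X + Z^n -> X + Z^(n+1), (x, z) |-> (e x, z, a x), have a colimit in
  Add(X + Z).  Splitting it into finitely generated modules gives an honest
  idempotent of some X + Z^k whose X-corner is e.

  Let X be a finitely generated torsion-free module with an endomorphism G that
  is not invertible at m.  Finite character and dimension one give a polynomial
  e in G, with e - e^2 divisible by some r <> 0 and hence factoring through
  copies of R, that separates the maximal ideals of R[G]/(r) over m containing G
  from the others.  Peeling the copies of R off the lifted idempotent leaves an
  idempotent of X_m whose difference with e is in the radical, so G or 1 - G is
  invertible at m if X_m is indecomposable: this is (1), and modules of rank one
  give (3).

  If (1, b, c) needs three generators at m then Z = R^2 + R(b, c) is
  indecomposable at m.  If this happens at both m and n, the triples can be
  chosen equal, and there is w in n but not in m with w - w^2 divisible by some
  r <> 0.  An idempotent of R + Z^k with R-corner w has odd rank, by peeling at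
  m, and even rank, by peeling at n.  Where no such triple exists, 1, b, c always
  satisfy a relation with a unit coefficient; this gives (2).

  In the last part invertibility and two-generation are local, the generators
  being glued by the Chinese remainder theorem and Nakayama's lemma. *)

(** The hypothesis on [Add] enters only through the lifting of idempotents. A map that is idempotent
    merely modulo maps through copies of [Z] has no useful image; the telescope replaces it, and is
    a summand of a countable sum of copies of X + Z because its relations form an explicit
    complement. It need not be finitely generated, but finitely many of its finitely generated
    summands contain the image of X, and on their sum the identity differs from the passage through
    X by a map through finitely many copies of [Z]. All modules are lattices in some Q^k, with
    matrices acting on row vectors from the right, so that one idempotent matrix over [R] can be
    examined at several maximal ideals by changing the coefficient ring alone. Locality is gained in
    stages: R_m is local for elementary reasons, the rank one lattices R_m[t] over it then make
    every ring between R_m and its closure local, and only then can (1) be treated over such rings.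
    If a functional on X_m takes a unit value, maps through R_m need not be radical, but then an
    indecomposable X_m is free of rank one. *)

Notation ideal := (sr_ideal (fun _ => True)).
Notation maximal_ideal := (sr_maximal_ideal (fun _ => True)).
Notation prime_ideal := (sr_prime_ideal (fun _ => True)).

(** * Ideals, Zorn's lemma and comaximal families *)

Section Ideals.
Variable R : comNzRingType.
Implicit Types (I J m P : R -> Prop).

Lemma ideal0 I : ideal I -> I 0. Proof. by case=> _ []. Qed.

Lemma idealB I x y : ideal I -> I x -> I y -> I (x - y).
Proof. by case=> _ [_ [IB _]]; apply: IB. Qed.

Lemma idealN I x : ideal I -> I x -> I (- x).
Proof. by move=> iI Ix; rewrite -sub0r; apply: idealB => //; apply: ideal0. Qed.

Lemma idealD I x y : ideal I -> I x -> I y -> I (x + y).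
Proof. by move=> iI Ix Iy; rewrite -[y]opprK; apply: idealB => //; apply: idealN. Qed.

Lemma idealMl I x y : ideal I -> I y -> I (x * y).
Proof. by case=> _ [_ [_ IM]]; apply: IM. Qed.

Lemma idealMr I x y : ideal I -> I x -> I (x * y).
Proof. by move=> iI Ix; rewrite mulrC; apply: idealMl. Qed.

Lemma idealX I x n : (0 < n)%N -> ideal I -> I x -> I (x ^+ n).
Proof. by case: n => // n _ iI Ix; rewrite exprS; apply: idealMr. Qed.

Lemma ideal_sum I (T : Type) (s : seq T) (P : pred T) F :
  ideal I -> (forall i, P i -> I (F i)) -> I (\sum_(i <- s | P i) F i).
Proof.
move=> iI IF; apply: (big_ind I) => //; first exact: ideal0.
by move=> x y; apply: idealD.
Qed.

Definition add_principal I (a : R) : R -> Prop :=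
  fun z => exists x b, I x /\ z = x + b * a.

Lemma add_principal_ideal I a : ideal I -> ideal (add_principal I a).
Proof.
move=> iI; split=> //; split; first by exists 0, 0; split; [apply: ideal0 | ring].
split=> [_ _ [x [b [Ix ->]]] [y [c [Iy ->]]]|c _ _ [x [b [Ix ->]]]].
  by exists (x - y), (b - c); split; [apply: idealB | ring].
by exists (c * x), (c * b); split; [apply: idealMl | ring].
Qed.

Lemma add_principal_sub I a x : I x -> add_principal I a x.
Proof. by exists x, 0; split=> //; ring. Qed.

Lemma add_principal_mem I a : ideal I -> add_principal I a a.
Proof. by move=> iI; exists 0, 1; split; [apply: ideal0 | ring]. Qed.

Lemma maximal_is_ideal m : maximal_ideal m -> ideal m.
Proof. by case=> [[]]. Qed.

Lemma maximal_proper m : maximal_ideal m -> ~ m 1.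
Proof. by case=> [[]]. Qed.

Lemma maximal_inv m a : maximal_ideal m -> ~ m a -> exists b, m (1 - b * a).
Proof.
move=> mm nma; have im := maximal_is_ideal mm.
case: (pselect (add_principal m a 1)) => [[x [b [mx e]]]|h].
  by exists b; rewrite e addrK.
case: nma; case: mm => _ mmax; apply: (mmax (add_principal m a)).
- by split; [apply: add_principal_ideal|].
- by move=> x; apply: add_principal_sub.
- exact: add_principal_mem.
Qed.

Lemma maximal_prime m : maximal_ideal m -> prime_ideal m.
Proof.
move=> mm; have im := maximal_is_ideal mm.
split; first by split=> //; apply: maximal_proper.
move=> x y _ _ mxy; case: (pselect (m x)) => [|nx]; [by left | right].
have [b mb] := maximal_inv mm nx.
have -> : y = (1 - b * x) * y + b * (x * y) by ring.
by apply: idealD => //; [apply: idealMr | apply: idealMl].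
Qed.

Lemma prime_proper P : prime_ideal P -> ~ P 1. Proof. by case=> [[]]. Qed.

Lemma prime_is_ideal P : prime_ideal P -> ideal P. Proof. by case=> [[]]. Qed.

Lemma primeNM P x y : prime_ideal P -> ~ P x -> ~ P y -> ~ P (x * y).
Proof. by case=> _ hP nx ny /hP; case. Qed.

Lemma primeNX P x n : prime_ideal P -> ~ P x -> ~ P (x ^+ n).
Proof.
move=> hP nx; elim: n => [|n IH]; first by rewrite expr0; apply: prime_proper.
by rewrite exprS; apply: primeNM.
Qed.

(** One use of Zorn's lemma serves twice: maximal ideals come from [S := eq 1], primes from a
    multiplicatively closed [S]. *)
Lemma exists_maximal_avoiding I (S : R -> Prop) : ideal I ->
  (forall x, I x -> ~ S x) ->
  exists P, [/\ ideal P, forall x, I x -> P x, forall x, P x -> ~ S x &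
    forall J, ideal J -> (forall x, P x -> J x) -> (forall x, J x -> ~ S x) ->
      forall x, J x -> P x].
Proof.
move=> iI IS.
pose good (X : R -> Prop) :=
  [/\ ideal X, forall x, I x -> X x & forall x, X x -> ~ S x].
pose T := {X : R -> Prop | good X}.
have t0 : T by exists I.
pose le (X Y : T) := `[< forall x, sval X x -> sval Y x >].
have [||A tA|[X [iX IX XS]] Xmax] := @classical_sets.ZL_preorder T t0 le.
- by move=> X; apply/asboolP.
- by move=> X Y Z /asboolP a /asboolP b; apply/asboolP => x /a /b.
(* The empty chain has no useful union; it is bounded by [I] itself. *)
- case: (pselect (exists X, A X)) => [[X0 AX0]|nA]; last first.
    by exists t0 => s As; case: nA; exists s.
  pose U x := exists X : T, A X /\ sval X x.
  suff gU : good U by exists (exist _ U gU) => s As; apply/asboolP => x sx; exists s.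
  split.
  + split=> //; split; first by exists X0; split=> //; case: (svalP X0) => /ideal0.
    split=> [x y [X [AX Xx]] [Y [AY Yy]]|a x _ [X [AX Xx]]]; last first.
      by exists X; split=> //; case: (svalP X) => iX _ _; apply: idealMl.
    case: (tA _ _ AX AY) => /asboolP XY.
      by exists Y; split=> //; case: (svalP Y) => iY _ _; apply: idealB => //; apply: XY.
    by exists X; split=> //; case: (svalP X) => iY _ _; apply: idealB => //; apply: XY.
  + by move=> x Ix; exists X0; split=> //; case: (svalP X0) => _ + _; apply.
  + by move=> x [X [AX Xx]]; case: (svalP X) => _ _ /(_ x Xx).
- exists X; split=> // J iJ XJ JS.
  have gJ : good J by split=> // x /IX /XJ.
  have := Xmax (exist _ J gJ); rewrite /le /= => h.
  by apply/asboolP/h; apply/asboolP.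
Qed.

Lemma exists_maximal_ideal I : ideal I -> ~ I 1 ->
  exists m, maximal_ideal m /\ forall x, I x -> m x.
Proof.
move=> iI I1; have [|P [iP IP P1 Pmax]] := @exists_maximal_avoiding I (eq 1) iI.
  by move=> x Ix e; apply: I1; rewrite e.
exists P; split=> //; split; first by split=> // /P1.
by move=> J [iJ J1] PJ; apply: Pmax => // x Jx e; apply: J1; rewrite e.
Qed.

(** Local-global principle: with [I] the set of multipliers for which an assertion holds, finding
    one outside each maximal ideal gives the assertion for the multiplier 1. *)
Lemma ideal_unit I : ideal I -> (forall m, maximal_ideal m -> exists s, I s /\ ~ m s) ->
  I 1.
Proof.
move=> iI h; apply: contrapT => /(exists_maximal_ideal iI)[m [mm Im]].
by have [s [Is nms]] := h m mm; apply: nms; apply: Im.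
Qed.

Lemma exists_prime_avoiding I (S : R -> Prop) : ideal I -> S 1 ->
  (forall x y, S x -> S y -> S (x * y)) -> (forall x, I x -> ~ S x) ->
  exists P, [/\ prime_ideal P, forall x, I x -> P x & forall x, P x -> ~ S x].
Proof.
move=> iI S1 SM IS; have [P [iP IP PS Pmax]] := exists_maximal_avoiding iI IS.
exists P; split=> //; split; first by split=> // /PS.
move=> x y _ _ Pxy; apply: contrapT => /not_orP[nx ny].
(* By maximality, enlarging [P] by an element outside it meets [S]; the product of two such meeting
   points would lie in [P] and in [S]. *)
have key z : ~ P z -> exists b p, P p /\ S (p + b * z).
  move=> nz; apply: contrapT => h; apply: nz.
  apply: (Pmax (add_principal P z)); first exact: add_principal_ideal.
  - by move=> t; apply: add_principal_sub.
  - by move=> t [p [b [Pp ->]]] Sp; apply: h; exists b, p.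
  - exact: add_principal_mem.
have [b [p [Pp Sp]]] := key x nx; have [c [q [Pq Sq]]] := key y ny.
apply: (PS _ _ (SM _ _ Sp Sq)).
have -> : (p + b * x) * (q + c * y) = p * (q + c * y) + (b * x) * q + (b * c) * (x * y).
  by ring.
apply: idealD => //; last exact: idealMl.
by apply: idealD => //; [apply: idealMr | apply: idealMl].
Qed.

Lemma maximal_comaximal m n : maximal_ideal m -> maximal_ideal n -> m <> n ->
  exists u, n u /\ m (1 - u).
Proof.
move=> mm mn mDn.
have [u [nu nmu]] : exists u, n u /\ ~ m u.
  apply: contrapT => h; apply: mDn; apply: funext => x; apply: propext.
  have nm y : n y -> m y by move=> ny; apply: contrapT => nmy; apply: h; exists y.
  by split; [case: mn => _ nmax; apply: (nmax m) => //; case: mm | apply: nm].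
have [b mb] := maximal_inv mm nmu; exists (b * u); split=> //.
by apply: idealMl => //; apply: maximal_is_ideal.
Qed.

Lemma maximal_comaximal_list m (l : seq (R -> Prop)) : maximal_ideal m ->
  (forall n, List.In n l -> maximal_ideal n /\ n <> m) ->
  exists u, m (1 - u) /\ forall n, List.In n l -> n u.
Proof.
move=> mm; elim: l => [|n l IH] hl.
  by exists 1; split=> //; rewrite subrr; apply: ideal0; apply: maximal_is_ideal.
have [k kl|u [mu lu]] := IH; first by apply: hl; right.
have [mn nDm] := hl n (or_introl erefl).
have [v [nv mv]] := maximal_comaximal mm mn (nesym nDm).
have im := maximal_is_ideal mm.
exists (v * u); split.
  have -> : 1 - v * u = (1 - v) + v * (1 - u) by ring.
  by apply: idealD => //; apply: idealMl.
move=> k [<-|kl]; first by apply: idealMr => //; apply: maximal_is_ideal.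
have [mk _] := hl k (or_intror kl).
by apply: idealMl; [apply: maximal_is_ideal | apply: lu].
Qed.

End Ideals.

Definition principal (R : comNzRingType) (r : R) : R -> Prop := fun x => exists q, x = r * q.

Lemma principal_ideal (R : comNzRingType) (r : R) : ideal (principal r).
Proof.
split=> //; split; first by exists 0; rewrite mulr0.
split=> [_ _ [a ->] [b ->]|c _ _ [a ->]]; first by exists (a - b); rewrite mulrBr.
by exists (c * a); rewrite mulrCA.
Qed.

(** * Quotients by a nonzero element in dimension one *)

Section RadicalModulo.
Variables (R : comNzRingType) (T : comNzRingType) (g : {rmorphism R -> T}).
Variables (m : R -> Prop) (I : T -> Prop).
Hypotheses (pm : prime_ideal m) (iI : ideal I).

(** Nilpotency in the localization of T/I at the complement of [m], written without forming quotient
    or localization; [T] will be [R] or its polynomial ring. *)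
Definition locally_nilpotent : T -> Prop :=
  fun x => exists N s, ~ m s /\ I (g s * x ^+ N).

Lemma locally_nilpotentMl x y : locally_nilpotent y -> locally_nilpotent (x * y).
Proof.
case=> N [s [ms Iy]]; exists N, s; split=> //.
by rewrite exprMn mulrCA; apply: idealMl.
Qed.

Lemma locally_nilpotentD x y :
  locally_nilpotent x -> locally_nilpotent y -> locally_nilpotent (x + y).
Proof.
case=> N [s [ms Ix]] [M [t [mt Iy]]]; exists (N + M)%N, (s * t); split.
  exact: primeNM.
rewrite exprDn mulr_sumr; apply: ideal_sum => // i _.
rewrite rmorphM mulrnAr -mulr_natr; apply: idealMr => //.
case: (leqP i M) => iM.
  rewrite -addnBA // exprD.
  have -> : g s * g t * (x ^+ N * x ^+ (M - i) * y ^+ i) =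
    (g t * x ^+ (M - i) * y ^+ i) * (g s * x ^+ N) by ring.
  exact: idealMl.
rewrite -[X in y ^+ X](subnKC (ltnW iM)) exprD.
have -> : g s * g t * (x ^+ (N + M - i) * (y ^+ M * y ^+ (i - M))) =
    (g s * x ^+ (N + M - i) * y ^+ (i - M)) * (g t * y ^+ M) by ring.
exact: idealMl.
Qed.

Lemma locally_nilpotent0 : locally_nilpotent 0.
Proof.
exists 1%N, 1; split; first exact: prime_proper.
by rewrite expr1 mulr0; apply: ideal0.
Qed.

Lemma locally_nilpotent_sum (A : Type) (s : seq A) (P : pred A) F :
  (forall i, P i -> locally_nilpotent (F i)) ->
  locally_nilpotent (\sum_(i <- s | P i) F i).
Proof.
move=> h; apply: (big_ind locally_nilpotent) => //; first exact: locally_nilpotent0.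
by move=> x y; apply: locally_nilpotentD.
Qed.

End RadicalModulo.

Lemma subrXX_factor (R : comNzRingType) (x y : R) k : exists c, x ^+ k - y ^+ k = (x - y) * c.
Proof.
by rewrite subrXX; eexists.
Qed.

Lemma subr1X_factor (R : comNzRingType) (v : R) k : exists c, 1 - v ^+ k = (1 - v) * c.
Proof. by rewrite -{1}(expr1n R k); apply: subrXX_factor. Qed.

Section DimensionOne.
Variable R : idomainType.
Implicit Types (m n : R -> Prop) (r a : R).
Hypothesis Rfc : sr_finite_character (fun _ : R => True).
Hypothesis Rdim : ~ (exists c, sr_prime_chain (fun _ : R => True) c 2).

(** Otherwise a prime over [r] misses every [s * a ^+ N] with [s] outside [m]; it lies strictly
    between 0 and [m], which makes a chain of length 2. *)
Lemma maximal_locally_nilpotent m a r : maximal_ideal m -> m a -> r != 0 ->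
  @locally_nilpotent R R idfun m (principal r) a.
Proof.
move=> mm ma r0; apply: contrapT => h.
pose S x := exists N s, ~ m s /\ x = s * a ^+ N.
have pm := maximal_prime mm.
have [|||P [pP rP PS]] := @exists_prime_avoiding R (principal r) S (principal_ideal r).
- by exists 0%N, 1; split; [apply: maximal_proper | rewrite mulr1].
- move=> _ _ [N [s [ms ->]]] [M [t [mt ->]]]; exists (N + M)%N, (s * t).
  by split; [apply: primeNM | rewrite exprD; ring].
- by move=> x rx [N [s [ms e]]]; apply: h; exists N, s; rewrite -e.
apply: Rdim; exists (fun i => if i is i'.+1 then if i' is _.+1 then m else P
  else fun x => x = 0); split.
  case=> [|[|i]] _ //; split.
    split; last by move/eqP; rewrite oner_eq0.
    split=> //; split=> //; split=> [x y -> ->|b x _ ->]; first by rewrite subr0.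
    by rewrite mulr0.
  by move=> x y _ _ /eqP; rewrite mulf_eq0 => /orP[]/eqP; [left | right].
case=> [|[|i]] // _; split.
- by move=> x ->; apply: ideal0; case: pP => [[]].
- by exists r; split; [apply: rP; exists 1; rewrite mulr1 | apply/eqP].
- move=> x Px; apply: contrapT => nmx; apply: (PS x Px).
  by exists 0%N, x; rewrite mulr1.
- exists a; split=> // Pa; apply: (PS a Pa).
  by exists 1%N, 1; split; [apply: maximal_proper | rewrite mul1r].
Qed.

Lemma finitely_many_maximal_over r : r != 0 ->
  exists l : seq (R -> Prop), forall n, List.In n l <-> maximal_ideal n /\ n r.
Proof.
move=> r0; have [l hl] := Rfc I r0.
suff [l' hl'] : exists l' : seq (R -> Prop),
    forall n, List.In n l' <-> List.In n l /\ maximal_ideal n /\ n r.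
  exists l' => n; rewrite hl'; split=> [[]//|[mn nr]]; split=> //.
  have [J [Jl e]] := hl n mn nr.
  suff -> : n = J by [].
  by apply: funext => x; apply: propext.
elim: l {hl} => [|n l [l' hl']]; first by exists [::] => n; split=> [[]|[]].
case: (pselect (maximal_ideal n /\ n r)) => h.
  exists (n :: l') => k /=; rewrite hl'; split=> [[<-|[]]|[[<-|kl] [mk kr]]].
  - by split; [left|].
  - by move=> kl kh; split; [right|].
  - by left.
  - by right.
exists l' => k /=; rewrite hl'; split=> [[kl kh]|[[e|kl] kh]] //.
  by split; [right|].
by case: h; rewrite e.
Qed.

(* The finitely many maximal ideals over r are the only primes over r, so
   R/r is a finite product of local rings and w is the unit of the factor at m. *)
Lemma local_factor_idempotent m r : maximal_ideal m -> r != 0 ->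
  exists w, [/\ ~ m w, principal r (w * (1 - w)),
    forall n, maximal_ideal n -> n r -> n <> m -> n w &
    forall s, ~ m s -> exists t, principal r (s * t - w)].
Proof.
move=> mm r0; have im := maximal_is_ideal mm.
have [l hl] := finitely_many_maximal_over r0.
have [l' hl'] : exists l' : seq (R -> Prop),
    forall n, List.In n l' <-> [/\ maximal_ideal n, n r & n <> m].
  elim: l r0 {hl} (hl) => [|n l IH] r0 hl.
    by exists [::] => n; split=> // -[mn nr _]; apply/hl.
  have : forall l0 : seq (R -> Prop), exists l', forall n, List.In n l' <-> List.In n l0 /\ n <> m.
    elim=> [|k l0 [l1 h1]]; first by exists [::] => k; split=> [[]|[]].
    case: (pselect (k = m)) => km.
      exists l1 => j; rewrite h1 /=; split=> [[jl jm]|[[e|jl] jm]] //.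
        by split; [right|].
      by case: jm; rewrite -e.
    exists (k :: l1) => j /=; rewrite h1; split=> [[<-|[jl jm]]|[[e|jl] jm]].
    - by split; [left|].
    - by split; [right|].
    - by left.
    - by right.
  move=> /(_ (n :: l))[l' h']; exists l' => k; rewrite h' hl.
  by split=> [[[]]|[]].
have [|u [mu lu]] := @maximal_comaximal_list R m l' mm.
  by move=> n /hl'[].
(* [u] is 1 at [m] and 0 at the other maximal ideals over [r], so [u * (1 - u)] lies in all of them
   and is nilpotent modulo [r]; [A] collects the multipliers that witness this. *)
have [N [x hN]] : exists N x, (u * (1 - u)) ^+ N = r * x.
  pose A s := exists N, principal r (s * (u * (1 - u)) ^+ N).
  have iA : ideal A.
    split=> //; split; first by exists 0%N, 0; rewrite mul0r mulr0.
    split=> [x y [N [p xN]] [M [q yM]]|a x _ [N [p xN]]]; last first.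
      by exists N, (a * p); rewrite -mulrA xN mulrCA.
    exists (N + M)%N, ((u * (1 - u)) ^+ M * p - (u * (1 - u)) ^+ N * q).
    set z := u * (1 - u) in xN yM *.
    have -> : (x - y) * z ^+ (N + M) = z ^+ M * (x * z ^+ N) - z ^+ N * (y * z ^+ M).
      by rewrite exprD; ring.
    by rewrite xN yM; ring.
  have [|N [x e]] := ideal_unit iA; last by exists N, x; rewrite -e mul1r.
  move=> n mn; case: (pselect (n r)) => nr; last first.
    by exists r; split=> //; exists 0%N, 1; rewrite mulr1.
  have nu : n (u * (1 - u)).
    have inn := maximal_is_ideal mn.
    case: (pselect (n = m)) => [e|ne]; first by apply: idealMl => //; rewrite e.
    by apply: idealMr => //; apply: lu; apply/hl'.
  have [N [s [ns sN]]] := maximal_locally_nilpotent mn nu r0.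
  by exists s; split=> //; exists N.
(* The exponent [N.+1] keeps a factor [u] in [w] and [1 - u] in [1 - w] even when [N] is 0. *)
have [a [b hab]] : exists a b, a * u ^+ N.+1 + b * (1 - u) ^+ N.+1 = 1.
  have [c hc] := subr1X_factor (1 - u) N.+1; rewrite subKr in hc.
  have [d hd] := subr1X_factor (1 - (1 - u) ^+ N.+1) N.+1; rewrite subKr in hd.
  by exists (c ^+ N.+1), d; rewrite [c ^+ _ * _]mulrC -exprMn -hc [d * _]mulrC -hd addrC subrK.
pose w := a * u ^+ N.+1.
have w1 : 1 - w = b * (1 - u) ^+ N.+1 by rewrite -[X in X - _ = _]hab addrAC subrr add0r.
have mw1 : m (1 - w) by rewrite w1; apply: idealMl => //; apply: idealX.
have nmw : ~ m w.
  move=> mw; apply: (maximal_proper mm).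
  by rewrite -(subrK w 1); apply: idealD.
have rw : principal r (w * (1 - w)).
  exists (a * b * u * (1 - u) * x).
  rewrite w1 /w !exprS.
  have -> : a * (u * u ^+ N) * (b * ((1 - u) * (1 - u) ^+ N)) =
    a * b * u * (1 - u) * (u ^+ N * (1 - u) ^+ N) by ring.
  by rewrite -exprMn hN; ring.
have nw n : maximal_ideal n -> n r -> n <> m -> n w.
  move=> mn nr nm; have inn := maximal_is_ideal mn.
  by apply: idealMl => //; apply: idealX => //; apply: lu; apply/hl'.
exists w; split=> // s nms.
(* [s * w + (1 - w)] is [s] on the factor of [w] and 1 on the complementary one; it lies in no
   maximal ideal over [r], hence is invertible modulo [r]. *)
have iA := add_principal_ideal (s * w + (1 - w)) (principal_ideal r).
have [|_ [t [[q ->]]] e] := ideal_unit iA.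
  move=> n mn; have inn := maximal_is_ideal mn.
  case: (pselect (n r)) => nr; last first.
    by exists r; split=> //; apply: add_principal_sub; exists 1; rewrite mulr1.
  exists (s * w + (1 - w)); split; first by apply: add_principal_mem; apply: principal_ideal.
  case: (pselect (n = m)) => [->|nm] h.
    apply: (primeNM (maximal_prime mm) nms nmw).
    by rewrite -(addrK (1 - w) (s * w)); apply: idealB.
  apply: (maximal_proper mn).
  have -> : 1 = (s * w + (1 - w)) + (1 - s) * w by ring.
  by apply: idealD => //; apply: idealMl => //; apply: nw.
have [p hp] := rw; exists (w ^+ 2 * t); exists (- p * t - w * q).
have -> : s * (w ^+ 2 * t) - w =
    s * (w ^+ 2 * t) - w * (r * q + t * (s * w + (1 - w))) by rewrite -e mulr1.
have -> : s * (w ^+ 2 * t) - w * (r * q + t * (s * w + (1 - w))) =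
  - t * (w * (1 - w)) - r * (w * q) by ring.
by rewrite hp; ring.
Qed.

End DimensionOne.

(** * Idempotents modulo [r] and a monic polynomial *)

Section PolynomialIdempotent.
Variable R : idomainType.
Implicit Types (m : R -> Prop) (r a : R).
Hypothesis Rfc : sr_finite_character (fun _ : R => True).
Hypothesis Rdim : ~ (exists c, sr_prime_chain (fun _ : R => True) c 2).

(* For a root G of P modulo r, e(G) is the idempotent that separates the maximal
   ideals over m containing G from the other maximal ideals of R[G]/(r). *)
Lemma poly_local_idempotent m r (P : {poly R}) :
  maximal_ideal m -> r != 0 -> m r -> P \is monic -> m P`_0 ->
  exists e e1 e2 e3 e4 h k : {poly R}, exists M s0,
  [/\ e = 'X * e1, e - e * e = r%:P * h + P * k, ~ m s0 &
      s0%:P * 'X^M = e * e2 + r%:P * e3 + P * e4].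
Proof.
move=> mm r0 mr Pmon mP0; have pm := maximal_prime mm; have im := maximal_is_ideal mm.
(* [n] is the order of vanishing of [P] at 0 modulo [m]: in [P = A + 'X^n * q] the constant term of
   [q] is outside [m], and [A] has coefficients in [m], so it is nilpotent modulo [r] at [m]. *)
have exn : exists n, `[< ~ m P`_n >].
  exists (size P).-1; apply/asboolP; rewrite -lead_coefE (monicP Pmon).
  exact: maximal_proper.
have [n /asboolP nPn nmin] := ex_minnP exn.
have {}nmin i : (i < n)%N -> m P`_i.
  by move=> ltin; apply: contrapT => /asboolP /nmin; rewrite leqNgt ltin.
have n_gt0 : (0 < n)%N by case: (n) nPn => [/(_ mP0)|].
set A := take_poly n P; set q := drop_poly n P.
have Pq : 'X^n * q = P - A by rewrite -[in RHS](poly_take_drop n P) addrAC subrr add0r mulrC.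
have [N [s [nms [h0 hA]]]] : locally_nilpotent polyC m (principal r%:P) A.
  rewrite /A /take_poly poly_def; apply: locally_nilpotent_sum => [//||i _].
    exact: principal_ideal.
  rewrite -mul_polyC mulrC; apply: locally_nilpotentMl; first exact: principal_ideal.
  have [N [s [nms [x hx]]]] := maximal_locally_nilpotent Rdim mm (nmin i (ltn_ord i)) r0.
  by exists N, s; split=> //; exists x%:P; rewrite /= -rmorphXn -!polyCM -hx.
have {}hA : s%:P * A ^+ N.+1 = r%:P * (A * h0) by rewrite exprS mulrCA hA mulrCA.
(* Modulo [P] the product ['X^n * q] is [- A], so its power [N.+1], multiplied by [s], vanishes
   modulo [r] and [P]. *)
have [k0 hk0] := subrXX_factor (P - A) (- A) N.+1.
rewrite opprK subrK in hk0.
set Q := q ^+ N.+1; set K := (n * N.+1)%N.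
have hQ : 'X^K * Q = P * k0 + (- A) ^+ N.+1 by rewrite -hk0 subrK -Pq exprMn -exprM.
have {}hQ : s%:P * ('X^K * Q) = P * (s%:P * k0) + r%:P * ((-1) ^+ N.+1 * (A * h0)).
  rewrite hQ (_ : (- A) ^+ N.+1 = (-1) ^+ N.+1 * A ^+ N.+1); last exact: exprNn.
  set a := A ^+ N.+1 in hA *; set b := (-1) ^+ N.+1.
  have -> : s%:P * (P * k0 + b * a) = P * (s%:P * k0) + b * (s%:P * a) by ring.
  by rewrite hA; ring.
pose c0 := Q`_0.
have nmc0 : ~ m c0.
  rewrite /c0 /Q -horner_coef0 horner_exp horner_coef0 /q coef_drop_poly add0n.
  exact: primeNX.
have [w hw] : exists w, Q = c0%:P + 'X * w.
  exists (drop_poly 1 Q); rewrite -[LHS](poly_take_drop 1 Q) expr1 [drop_poly 1 Q * _]mulrC.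
  by congr (_ + _); rewrite /take_poly poly_def big_ord_recl big_ord0 addr0 expr0 alg_polyC.
(* [Q] is the constant [c0] modulo ['X], so [c0 ^+ K], a unit at [m], is a combination of ['X^K] and
   [Q]: the two factors of the vanishing product are comaximal at [m]. *)
have [v hv] := subrXX_factor c0%:P (- ('X * w)) K.
rewrite opprK -hw in hv.
pose u := (- w) ^+ K; pose s' := c0 ^+ K.
have hs' : 'X^K * u + Q * v = s'%:P.
  by rewrite -hv -mulrN exprMn rmorphXn addrC subrK.
have nms' : ~ m s' by apply: primeNX.
have [o [nmo [x0 ho] _ inv]] := local_factor_idempotent Rfc Rdim mm r0.
have [t [c ht]] := inv _ (primeNM pm nms nms').
have nmt : ~ m t.
  move=> mt; apply: nmo; have -> : o = s * s' * t - (s * s' * t - o) by ring.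
  by rewrite ht; apply: idealB => //; [apply: idealMl | apply: idealMr].
move: ht ho => /(congr1 polyC) + /(congr1 polyC).
rewrite !(polyCB, polyCM) polyC1 => ht ho.
(* [o] is the idempotent of the factor of R/r at [m], and [t] inverts [s * s'] there. Modulo [r] and
   [P], [e] and [z * (Q * v)] have sum [o] and product 0, whence [e] is idempotent. *)
pose z := t%:P * s%:P * o%:P.
pose e := z * ('X^K * u).
have K_gt0 : (0 < K)%N by rewrite muln_gt0 n_gt0.
exists e, (z * 'X^(K.-1) * u), (s%:P * 'X^K), (z * v * ((-1) ^+ N.+1 * (A * h0))), (z * v * (s%:P * k0)).
exists (t%:P * s%:P * ('X^K * u) * x0%:P - e * (c%:P * o%:P - x0%:P) +
        t%:P * o%:P * z * u * v * ((-1) ^+ N.+1 * (A * h0))).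
exists (t%:P * o%:P * z * u * v * (s%:P * k0)).
exists K, (t * s * o * s * s'); split.
- by rewrite /e -[in LHS](prednK K_gt0) exprS; ring.
- have he' : e + z * (Q * v) = o%:P + r%:P * (c%:P * o%:P - x0%:P).
    rewrite /e -mulrDr hs' /z.
    have -> : t%:P * s%:P * o%:P * s'%:P = o%:P * (o%:P + (s%:P * s'%:P * t%:P - o%:P)) by ring.
    rewrite ht.
    have -> : o%:P * (o%:P + r%:P * c%:P) = o%:P - o%:P * (1 - o%:P) + r%:P * c%:P * o%:P by ring.
    by rewrite ho; ring.
  have hee' : e * (z * (Q * v)) = r%:P * (t%:P * o%:P * z * u * v * ((-1) ^+ N.+1 * (A * h0)))
      + P * (t%:P * o%:P * z * u * v * (s%:P * k0)).
    have -> : e * (z * (Q * v)) = t%:P * o%:P * z * u * v * (s%:P * ('X^K * Q)).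
      by rewrite /e {1}/z; ring.
    by rewrite hQ; ring.
  have -> : e - e * e = t%:P * s%:P * ('X^K * u) * (o%:P * (1 - o%:P))
      + e * (o%:P + r%:P * (c%:P * o%:P - x0%:P)) - r%:P * (e * (c%:P * o%:P - x0%:P)) - e * e.
    by rewrite /e /z; ring.
  by rewrite -he' ho [e * (e + _)]mulrDr hee'; ring.
- by do ![apply: (primeNM pm)].
- have -> : (t * s * o * s * s')%:P = z * s%:P * s'%:P by rewrite /z !polyCM.
  rewrite -hs'.
  have -> : z * s%:P * ('X^K * u + Q * v) * 'X^K =
     e * (s%:P * 'X^K) + z * v * (s%:P * ('X^K * Q)) by rewrite /e; ring.
  by rewrite hQ; ring.
Qed.

End PolynomialIdempotent.

(** * Submodules, linear maps and internal direct sums *)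

Section SubmoduleType.
Variables (K : comNzRingType) (V : lmodType K) (P : V -> Prop).

(** Passing through [asbool] makes a propositional submodule boolean, so that its subtype inherits
    an [lmodType] structure. *)
Definition submodule_pred (hP : submodule P) : pred V := fun v => `[< P v >].

Lemma submodule_pred_closed (hP : submodule P) : submod_closed (submodule_pred hP).
Proof.
have [P0 [PB PZ]] := hP; split; first exact/asboolP.
move=> a x y /asboolP Px /asboolP Py; apply/asboolP.
rewrite -[y]opprK; apply/PB; first exact: PZ.
by rewrite -sub0r; apply: PB.
Qed.

HB.instance Definition _ (hP : submodule P) :=
  GRing.isSubmodClosed.Build K V (submodule_pred hP) (submodule_pred_closed hP).

Definition submodule_type (hP : submodule P) := {v : V | submodule_pred hP v}.

HB.instance Definition _ (hP : submodule P) := SubChoice.on (submodule_type hP).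
HB.instance Definition _ (hP : submodule P) :=
  [SubChoice_isSubLmodule of submodule_type hP by <:].

Definition to_submodule (hP : submodule P) v (Pv : P v) : submodule_type hP :=
  exist _ v (introT (asboolP (P v)) Pv).

Lemma submodule_typeP (hP : submodule P) (v : submodule_type hP) : P (val v).
Proof. by apply/asboolP; apply: (valP v). Qed.

End SubmoduleType.

Section LinearMaps.
Variable K : comNzRingType.
Implicit Types U V W : lmodType K.

Lemma linmapD U V (g : U -> V) x y : is_linmap g -> g (x + y) = g x + g y.
Proof. by move=> lg; rewrite -[x]scale1r lg !scale1r. Qed.

Lemma linmap0 U V (g : U -> V) : is_linmap g -> g 0 = 0.
Proof. by move=> lg; apply: (addIr (g 0)); rewrite -linmapD // !add0r. Qed.

Lemma linmapZ U V (g : U -> V) a x : is_linmap g -> g (a *: x) = a *: g x.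
Proof. by move=> lg; rewrite -[a *: x]addr0 lg linmap0 // addr0. Qed.

Lemma linmapN U V (g : U -> V) x : is_linmap g -> g (- x) = - g x.
Proof. by move=> lg; rewrite -scaleN1r linmapZ // scaleN1r. Qed.

Lemma linmapB U V (g : U -> V) x y : is_linmap g -> g (x - y) = g x - g y.
Proof. by move=> lg; rewrite linmapD // linmapN. Qed.

Lemma linmap_sum U V (g : U -> V) (T : Type) (s : seq T) F : is_linmap g ->
  g (\sum_(i <- s) F i) = \sum_(i <- s) g (F i).
Proof.
move=> lg; elim: s => [|a s IH]; first by rewrite !big_nil linmap0.
by rewrite !big_cons linmapD // IH.
Qed.

Lemma linmap_comp U V W (g : V -> W) (h : U -> V) :
  is_linmap g -> is_linmap h -> is_linmap (g \o h).
Proof. by move=> lg lh a x y; rewrite /= lh lg. Qed.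

Lemma linmap_iter U (g : U -> U) n : is_linmap g -> is_linmap (iter n g).
Proof. by move=> lg; elim: n => [|n IH] // a x y /=; rewrite IH lg. Qed.

Lemma complement_projection V (Y C : V -> Prop) : complement_in (fun _ => True) Y C ->
  exists p : V -> V, [/\ is_linmap p, forall v, Y (p v) & forall y, Y y -> p y = y].
Proof.
case=> [[Y0 [YB YZ]] [[C0 [CB CZ]] [YC dec]]].
have ex v : exists y, Y y /\ C (v - y).
  have [/(_ I)[a [b [Ya [Cb ->]]]] _] := dec v.
  by exists a; rewrite addrC addKr.
pose p v := projT1 (cid (ex v)).
have pP v : Y (p v) /\ C (v - p v) by rewrite /p; case: cid.
have uniq v y : Y y -> C (v - y) -> p v = y.
  move=> Yy Cy; have [Yp Cp] := pP v; apply/eqP; rewrite -subr_eq0; apply/eqP.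
  apply: YC; first exact: YB.
  have -> : p v - y = (v - y) - (v - p v) by rewrite opprB [RHS]addrC addrA subrK.
  exact: CB.
have YD x y : Y x -> Y y -> Y (x + y).
  move=> Yx Yy; have -> : x + y = x - (0 - y) by rewrite sub0r opprK.
  by apply/YB => //; apply/YB.
have CD x y : C x -> C y -> C (x + y).
  move=> Yx Yy; have -> : x + y = x - (0 - y) by rewrite sub0r opprK.
  by apply/CB => //; apply/CB.
exists p; split=> [a x y|v|y Yy]; last by apply: uniq; rewrite // subrr.
  have [Yx Cx] := pP x; have [Yy Cy] := pP y.
  apply: uniq; first by apply: YD => //; apply: YZ.
  by rewrite opprD addrACA -scalerBr; apply: CD => //; apply: CZ.
by case: (pP v).
Qed.

Section InternalSum.
Variables (V : lmodType K) (T : Type) (N : T -> V -> Prop).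
Hypothesis Nsub : forall i, submodule (N i).

(** [internal_dsum] controls only lists with pairwise distinct indices, while concatenation repeats
    indices; equal indices are therefore collected first. *)
Lemma merge_summands (ps : seq (T * V)) : (forall p, List.In p ps -> N p.1 p.2) ->
  exists qs : seq (T * V), [/\ List.NoDup (map fst qs),
    forall q, List.In q qs -> N q.1 q.2,
    forall q, List.In q qs -> List.In q.1 (map fst ps) &
    \sum_(q <- qs) q.2 = \sum_(p <- ps) p.2].
Proof.
elim: ps => [|[i v] ps IH] hps.
  by exists [::]; split=> //; apply: List.NoDup_nil.
have [p pps|qs [nd hN hin hsum]] := IH; first by apply: hps; right.
case: (pselect (List.In i (map fst qs))) => [iqs|niqs]; last first.
  exists ((i, v) :: qs); split=> /=.
  - by apply: List.NoDup_cons.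
  - by move=> q [<-|/hN //]; apply: (hps (i, v)); left.
  - by move=> q [<-|/hin ?]; [left | right].
  - by rewrite !big_cons hsum.
suff [rs [e hN' hs]] : exists rs : seq (T * V), [/\ map fst rs = map fst qs,
    forall q, List.In q rs -> N q.1 q.2 & \sum_(q <- rs) q.2 = v + \sum_(q <- qs) q.2].
  exists rs; rewrite e; split=> //.
    move=> q qrs; right; have : List.In q.1 (map fst rs) by apply: List.in_map.
    by rewrite e => /List.in_map_iff[q' [<- /hin]].
  by rewrite hs hsum big_cons.
have Nv : N i v by apply: (hps (i, v)); left.
elim: qs iqs hN {nd hin hsum IH} => [|[j w] qs IH] //= iqs hN.
case: (pselect (j = i)) => ji.
  exists ((i, v + w) :: qs); rewrite !big_cons addrA /= ji; split=> //.
  move=> q [<-|qq]; last by apply: hN; right.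
  have Nw : N i w by rewrite -ji; apply: (hN (j, w)); left.
  have [N0 [NB _]] := Nsub i.
  by rewrite /= -[w]opprK; apply/NB => //; rewrite -sub0r; apply: NB.
have [||rs [e h1 h2]] := IH.
- by case: iqs => [/ji|].
- by move=> q qq; apply: hN; right.
exists ((j, w) :: rs); rewrite !big_cons h2 /= e addrCA; split=> // q [<-|/h1 //].
by apply: (hN (j, w)); left.
Qed.

(** Repeated indices are allowed, so that addition is plain concatenation. *)
Definition partial_sum (J : T -> Prop) : V -> Prop := fun v =>
  exists ps : seq (T * V), (forall p, List.In p ps -> N p.1 p.2 /\ J p.1) /\
    v = \sum_(p <- ps) p.2.

Lemma partial_sum_submodule J : submodule (partial_sum J).
Proof.
split; first by exists [::]; rewrite big_nil.
have sZ (a : K) v : partial_sum J v -> partial_sum J (a *: v).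
  case=> ps [h ->]; exists [seq (p.1, a *: p.2) | p <- ps]; split.
    move=> p /List.in_map_iff[q [<- /h[Nq Jq]]]; split=> //=.
    by have [_ [_ NZ]] := Nsub q.1; apply: NZ.
  by rewrite big_map scaler_sumr.
split=> // x y [ps [hp ->]] /(sZ (-1))[qs [hq]]; rewrite scaleN1r => ->.
exists (ps ++ qs); rewrite big_cat; split=> // p /List.in_app_iff[/hp|/hq] //.
Qed.

Hypothesis NT : internal_dsum N.

Lemma partial_sum_complement J :
  complement_in (fun _ => True) (partial_sum J) (partial_sum (fun i => ~ J i)).
Proof.
have [_ [span indep]] := NT.
split; first exact: partial_sum_submodule.
split; first exact: partial_sum_submodule.
(* An element of both sums, written over [J] and, negated, over the complement of [J], yields after
   merging a list with distinct indices and sum 0. *)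
split=> [_ [ps [hp ->]] /(partial_sum_submodule (fun i => ~ J i)).2.2|v].
  move=> /(_ (-1))[qs [hq]]; rewrite scaleN1r => hs.
  have [|ps' [nd1 N1 J1 s1]] := @merge_summands ps; first by move=> p /hp[].
  have [|qs' [nd2 N2 J2 s2]] := @merge_summands qs; first by move=> p /hq[].
  have /indep z : List.NoDup (map fst (ps' ++ qs')).
    rewrite map_cat; apply: List.NoDup_app => // i /List.in_map_iff[p [<- /J1 h]].
    move=> /List.in_map_iff[q [e /J2]]; rewrite e => /List.in_map_iff[r [er /hq[_ njr]]].
    apply: njr; rewrite er; move: h => /List.in_map_iff[r' [<- /hp[]]] //.
  rewrite -s1.
  have {}z p : List.In p (ps' ++ qs') -> p.2 = 0.
    apply: z; last by rewrite big_cat /= s1 s2 -hs subrr.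
    by move=> q /List.in_app_iff[/N1|/N2].
  have inl p : List.In p ps' -> p.2 = 0 by move=> pp; apply: z; apply: List.in_or_app; left.
  elim: ps' inl {nd1 N1 J1 s1 z} => [|p ps' IH] inl; first by rewrite big_nil.
  rewrite big_cons (inl p); last by left.
  by rewrite IH ?add0r // => q qp; apply: inl; right.
split=> // _; have [ps [_ [hp ->]]] := span v.
elim: ps hp => [|p ps IH] hp.
  by exists 0, 0; rewrite big_nil addr0; split; [|split=> //]; exists [::]; rewrite big_nil.
have [q qp|a [b [Ja [Jb e]]]] := IH; first by apply: hp; right.
have Np : N p.1 p.2 by apply: hp; left.
have sg (A : T -> Prop) w : A p.1 -> partial_sum A w -> partial_sum A (p.2 + w).
  move=> Ap [qs [hq ->]]; exists (p :: qs); rewrite big_cons; split=> // q [<-|/hq] //.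
rewrite big_cons e; case: (pselect (J p.1)) => Jp.
  by exists (p.2 + a), b; rewrite addrA; split=> //; apply: sg.
by exists a, (p.2 + b); rewrite addrCA; split=> //; split=> //; apply: sg.
Qed.

End InternalSum.
End LinearMaps.

(** * Splitting idempotents modulo maps that factor through sums of Z *)

Section Factoring.
Variables (K : comNzRingType) (Z : lmodType K).
Implicit Types U V W : lmodType K.

(** The ideal of maps through finite sums of copies of [Z]. In the colimit the number of copies
    depends on the stage at which elements stabilise, hence the restriction to a subset [Y]. *)
Definition factors_on (U V : lmodType K) (Y : U -> Prop) (g : U -> V) : Prop :=
  exists s : seq ((Z -> V) * (U -> Z)),
    (forall p, List.In p s -> is_linmap p.1 /\ is_linmap p.2) /\
    forall y, Y y -> g y = \sum_(p <- s) p.1 (p.2 y).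

Lemma factors_on0 U V (Y : U -> Prop) : factors_on Y (fun _ => 0 : V).
Proof. by exists [::]; split=> // y _; rewrite big_nil. Qed.

Lemma factors_on1 U V (Y : U -> Prop) (a : Z -> V) (b : U -> Z) :
  is_linmap a -> is_linmap b -> factors_on Y (fun y => a (b y)).
Proof.
move=> la lb; exists [:: (a, b)]; split; first by move=> p [<-|[]].
by move=> y _; rewrite big_seq1.
Qed.

Lemma factors_onD U V (Y : U -> Prop) (g h : U -> V) :
  factors_on Y g -> factors_on Y h -> factors_on Y (fun y => g y + h y).
Proof.
case=> s [ls es] [t [lt et]]; exists (s ++ t); split=> [p|y Yy].
  by move/List.in_app_iff => [/ls|/lt].
by rewrite big_cat es // et.
Qed.

Lemma factors_onN U V (Y : U -> Prop) (g : U -> V) :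
  factors_on Y g -> factors_on Y (fun y => - g y).
Proof.
case=> s [ls es]; exists [seq (fun z => - p.1 z, p.2) | p <- s]; split=> [p|y Yy].
  move/List.in_map_iff => [q [<- /ls[l1 l2]]]; split=> //= a x y.
  by rewrite l1 opprD scalerN.
by rewrite big_map es // sumrN.
Qed.

Lemma factors_onB U V (Y : U -> Prop) (g h : U -> V) :
  factors_on Y g -> factors_on Y h -> factors_on Y (fun y => g y - h y).
Proof. by move=> fg fh; apply: factors_onD => //; apply: factors_onN. Qed.

Lemma factors_on_compl U V W (Y : U -> Prop) (g : U -> V) (h : V -> W) :
  is_linmap h -> factors_on Y g -> factors_on Y (fun y => h (g y)).
Proof.
move=> lh [s [ls es]]; exists [seq (fun z => h (p.1 z), p.2) | p <- s]; split=> [p|y Yy].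
  move/List.in_map_iff => [q [<- /ls[l1 l2]]]; split=> //=.
  exact: (linmap_comp lh l1).
by rewrite big_map es // linmap_sum.
Qed.

Lemma factors_on_compr U V W (Y : U -> Prop) (Y' : V -> Prop) (g : U -> V) (h : V -> W) :
  is_linmap g -> (forall y, Y y -> Y' (g y)) ->
  factors_on Y' h -> factors_on Y (fun y => h (g y)).
Proof.
move=> lg gY [s [ls es]]; exists [seq (p.1, fun z => p.2 (g z)) | p <- s]; split=> [p|y Yy].
  move/List.in_map_iff => [q [<- /ls[l1 l2]]]; split=> //=.
  exact: (linmap_comp l2 lg).
by rewrite big_map es //; apply: gY.
Qed.

Lemma eq_factors_on U V (Y : U -> Prop) (g h : U -> V) :
  (forall y, Y y -> g y = h y) -> factors_on Y g -> factors_on Y h.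
Proof. by move=> gh [s [ls es]]; exists s; split=> // y Yy; rewrite -gh ?es. Qed.

Lemma factors_on_sum U V (Y : U -> Prop) n (g : nat -> U -> V) :
  (forall i, factors_on Y (g i)) -> factors_on Y (fun y => \sum_(i < n) g i y).
Proof.
move=> hg; elim: n => [|n IH].
  by apply: eq_factors_on (factors_on0 V Y) => y _; rewrite big_ord0.
apply: eq_factors_on (factors_onD IH (hg n)) => y _.
by rewrite big_ord_recr.
Qed.

End Factoring.

(* Colimit of X + Z^n -> X + Z^(n+1), (x, z) |-> (e x, z, a x), where
   e - e e = b a. An element is recorded by its images under the partial
   inverses (x, z, z') |-> (e x + b z' + b z_last, z) of these maps. *)
Section Colimit.
Variables (K : comNzRingType) (X Z : lmodType K).
Variables (e : X -> X) (a : X -> Z) (b : Z -> X).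
Hypotheses (le : is_linmap e) (la : is_linmap a) (lb : is_linmap b).
Hypothesis hab : forall x, e x - e (e x) = b (a x).

Notation seqs := (nat -> (X * Z)%type).
Implicit Types (s t : seqs).

Definition colim_back s : Prop :=
  forall j, (s j).1 = e (s j.+1).1 + b (s j.+1).2 + b (s j).2.

Definition colim_fwd n s : Prop :=
  forall j, (n <= j)%N -> (s j.+1).1 = e (s j).1 /\ (s j.+1).2 = a (s j).1.

(** Recorded in this way the colimit is a submodule of a function space in place of a quotient. *)
Definition colim s : Prop := colim_back s /\ exists n, colim_fwd n s.

Lemma seqs0 j : (0 : seqs) j = (0, 0). Proof. by []. Qed.

Lemma seqsB s t j : (s - t) j = ((s j).1 - (t j).1, (s j).2 - (t j).2).
Proof. by []. Qed.

Lemma seqsZ (c : K) s j : (c *: s) j = (c *: (s j).1, c *: (s j).2).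
Proof. by []. Qed.

Lemma colim_submodule : submodule (colim : seqs -> Prop).
Proof.
split; first split=> [j|].
- by rewrite !seqs0 /= !(linmap0 lb) !(linmap0 le) !addr0.
- by exists 0%N => j _; rewrite !seqs0 /= (linmap0 la) (linmap0 le).
split=> [s t [bs [n fs]] [bt [m ft]]|c s [bs [n fs]]]; split.
- move=> j; rewrite !seqsB /= bs bt !(linmapB _ _ le) !(linmapB _ _ lb) !opprD.
  by rewrite addrACA; congr (_ + _); apply: addrACA.
- exists (maxn n m) => j; rewrite geq_max => /andP[nj mj].
  have [h1 h2] := fs j nj; have [h3 h4] := ft j mj.
  by rewrite !seqsB /= h1 h2 h3 h4 !(linmapB _ _ le) !(linmapB _ _ la).
- by move=> j; rewrite !seqsZ /= bs !(linmapZ _ _ le) !(linmapZ _ _ lb) !scalerDr.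
- exists n => j nj; have [h1 h2] := fs j nj.
  by rewrite !seqsZ /= h1 h2 !(linmapZ _ _ le) !(linmapZ _ _ la).
Qed.

(** The class of [x] at stage [i] plus [z] in the [i]-th copy of [Z]. Entry [i] carries [e x + b z]
    because the partial inverse has been applied; earlier entries follow from [colim_back], later
    ones from the transition maps started at [x]. *)
Definition colim_in i (x : X) (z : Z) : seqs := fun j =>
  if (j < i)%N then (iter (i - j.+1) e (e (e x + b z) + b z), 0)
  else if j == i then (e x + b z, z)
  else (iter (j - i) e x, a (iter (j - i.+1) e x)).

Lemma colim_in_lt i x z j : (j < i)%N ->
  colim_in i x z j = (iter (i - j.+1) e (e (e x + b z) + b z), 0).
Proof. by rewrite /colim_in => ->. Qed.

Lemma colim_in_eq i x z : colim_in i x z i = (e x + b z, z).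
Proof. by rewrite /colim_in ltnn eqxx. Qed.

Lemma colim_in_gt i x z j :
  colim_in i x z (i + j.+1)%N = (iter j.+1 e x, a (iter j e x)).
Proof.
rewrite /colim_in ltnNge leq_addr /= -{2}[i]addn0 eqn_add2l /= addKn.
by rewrite addnS -addSn addKn.
Qed.

Lemma colim_in_back i x z : colim_back (colim_in i x z).
Proof.
move=> j; case: (ltngtP j i) => [ji|ij|->].
- rewrite colim_in_lt //= (linmap0 lb) addr0.
  case: (ltngtP j.+1 i) => [j1i|ij|e1].
  + by rewrite colim_in_lt //= (linmap0 lb) addr0 -iterS -subSn.
  + by move: ij; rewrite ltnS leqNgt ji.
  + by rewrite e1 colim_in_eq subnn.
- rewrite -(subnKC ij) addSnnS -addnS !colim_in_gt /= -!hab.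
  by rewrite [e (e (e _)) + _]addrC subrK addrC subrK.
- by rewrite -addn1 colim_in_gt colim_in_eq /= -hab [e (e x) + _]addrC subrK.
Qed.

Lemma colim_in_fwd i x z : colim_fwd i.+1 (colim_in i x z).
Proof.
move=> j ij; rewrite -(subnKC ij) addSnnS -addnS !colim_in_gt //=.
Qed.

Lemma colim_inP i x z : colim (colim_in i x z).
Proof. by split; [apply: colim_in_back | exists i.+1; apply: colim_in_fwd]. Qed.

(** The backward equation recovers every earlier X-component from the one at [n] and the
    Z-components. *)
Lemma colim_ext n s t : colim_back s -> colim_back t ->
  (forall j, (j <= n)%N -> (s j).2 = (t j).2) -> (s n).1 = (t n).1 ->
  (forall j, (n <= j)%N -> s j = t j) -> s = t.
Proof.
move=> bs bt h2 h1 hgt; apply: funext => j.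
case: (leqP n j) => [/hgt //|jn].
suff h k : (k <= n)%N -> (s (n - k)%N).1 = (t (n - k)%N).1.
  have := h _ (leq_subr j n); rewrite subKn ?(ltnW jn) // => e1.
  by rewrite [s j]surjective_pairing [t j]surjective_pairing e1 h2 // ltnW.
elim: k => [|k IH] kn; first by rewrite subn0.
rewrite bs bt -subSn // subSS IH; last exact: ltnW.
by rewrite !h2 // leq_subr.
Qed.


Lemma colim_in_linear i (c : K) x x' z z' :
  colim_in i (c *: x + x') (c *: z + z') = c *: colim_in i x z + colim_in i x' z'.
Proof.
have li n := linmap_iter n le.
apply: funext => j; rewrite [RHS](_ : _ =
  (c *: (colim_in i x z j).1 + (colim_in i x' z' j).1,
   c *: (colim_in i x z j).2 + (colim_in i x' z' j).2)) //.
have E : e (c *: x + x') + b (c *: z + z') = c *: (e x + b z) + (e x' + b z').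
  by rewrite le lb scalerDr addrACA.
rewrite /colim_in; case: ifP => _ /=.
  rewrite scaler0 addr0 -li; congr (iter _ _ _, _).
  by rewrite E le lb scalerDr addrACA.
case: ifP => _ /=; first by rewrite E.
by rewrite !li la.
Qed.

Lemma colim_in_snd0 k z j : (colim_in k 0 z j).2 = if j == k then z else 0.
Proof.
case: (ltngtP j k) => [jk|kj|->]; first by rewrite colim_in_lt.
  rewrite -(subnKC kj) addSnnS colim_in_gt /=.
  by rewrite (linmap0 (linmap_iter _ le)) (linmap0 la).
by rewrite colim_in_eq.
Qed.

Lemma colim_in_fst0 k z j : (k <= j)%N -> (colim_in k 0 z j).1 = if j == k then b z else 0.
Proof.
case: (ltngtP j k) => [//|kj|->] _; last by rewrite colim_in_eq /= (linmap0 le) add0r.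
rewrite -(subnKC kj) addSnnS colim_in_gt /=.
by rewrite (linmap0 (linmap_iter _ le)) (linmap0 le).
Qed.

Definition colim_type := submodule_type colim_submodule.
Implicit Types y : colim_type.

Definition colim_inj i (x : X) (z : Z) : colim_type :=
  to_submodule colim_submodule (colim_inP i x z).
Definition colim_fst j y : X := (val y j).1.
Definition colim_snd j y : Z := (val y j).2.

Lemma colim_fst_linear j : is_linmap (colim_fst j). Proof. by []. Qed.
Lemma colim_snd_linear j : is_linmap (colim_snd j). Proof. by []. Qed.

Lemma colim_fst_inj i x z : colim_fst i (colim_inj i x z) = e x + b z.
Proof. by rewrite /colim_fst /= colim_in_eq. Qed.

Lemma colim_injl_linear i : is_linmap (fun x => colim_inj i x 0).
Proof.
by move=> c x y; apply: val_inj; rewrite /= -colim_in_linear scaler0 addr0.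
Qed.

Lemma colim_injr_linear i : is_linmap (colim_inj i 0).
Proof.
by move=> c x y; apply: val_inj; rewrite /= -colim_in_linear scaler0 addr0.
Qed.

Lemma colim_type_back y : colim_back (val y).
Proof. by case: (submodule_typeP y). Qed.

Lemma colim_type_ext n y y' :
  (forall j, (j <= n)%N -> colim_snd j y = colim_snd j y') ->
  (forall j, (n <= j)%N -> colim_fst j y = colim_fst j y' /\ colim_snd j y = colim_snd j y') ->
  y = y'.
Proof.
move=> h2 h1; apply: val_inj; apply: (@colim_ext n); [exact: colim_type_back..| | |] => //.
  by case: (h1 n).
by move=> j /h1[]; rewrite /colim_fst /colim_snd; case: (val y j) (val y' j) => ? ? [? ?] /= -> ->.
Qed.

(** This is the identification made by the transition map from one stage to the next. *)
Lemma colim_inj_step i x :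
  colim_inj i x 0 = colim_inj i.+1 (e x) 0 + colim_inj i.+1 0 (a x).
Proof.
apply: (@colim_type_ext i.+1) => j.
  rewrite (linmapD _ _ (colim_snd_linear j)) /colim_snd /= colim_in_snd0.
  rewrite leq_eqVlt => /orP[/eqP->|ji].
    by rewrite eqxx colim_in_eq add0r -addn1 colim_in_gt.
  rewrite (ltn_eqF ji) addr0 [colim_in i.+1 _ _ _]colim_in_lt // [RHS]/=.
  move: ji; rewrite ltnS leq_eqVlt => /orP[/eqP->|ji]; first by rewrite colim_in_eq.
  by rewrite colim_in_lt.
rewrite (linmapD _ _ (colim_snd_linear j)) (linmapD _ _ (colim_fst_linear j)).
rewrite /colim_snd /colim_fst /= colim_in_snd0 => ij; rewrite colim_in_fst0 //.
move: ij; rewrite leq_eqVlt => /orP[/eqP<-|ij].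
  rewrite eqxx colim_in_eq add0r -addn1 colim_in_gt /= (linmap0 lb) addr0.
  by split=> //; rewrite -hab addrC subrK.
rewrite (gtn_eqF ij) !addr0 -(subnKC ij) addSnnS [colim_in i.+1 _ _ _]colim_in_gt.
by rewrite addSnnS colim_in_gt -!iterSr.
Qed.

Lemma colim_decomp n y : colim_fwd n (val y) ->
  y = colim_inj n (colim_fst n y) 0 + \sum_(k < n.+1) colim_inj k 0 (colim_snd k y).
Proof.
move=> fy; have by_ := colim_type_back y.
(* The backward and forward equations at [n], combined by [hab], say that the X-component at [n] is
   fixed by the partial inverse. *)
have en : colim_fst n y = e (colim_fst n y) + b (colim_snd n y).
  rewrite {1}/colim_fst by_; have [-> ->] := fy n (leqnn n).
  by rewrite -hab [e (e _) + _]addrC subrK.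
have snd_in j (x : X) : (j <= n)%N -> colim_snd j (colim_inj n x 0) = 0.
  rewrite /colim_snd /= leq_eqVlt => /orP[/eqP->|jn]; first by rewrite colim_in_eq.
  by rewrite colim_in_lt.
have sum_snd j : \sum_(k < n.+1) colim_snd j (colim_inj k 0 (colim_snd k y)) =
    if (j <= n)%N then colim_snd j y else 0.
  rewrite /colim_snd /=; under eq_bigr do rewrite colim_in_snd0.
  case: leqP => jn; last first.
    by rewrite big1 // => k _; case: eqP => // jk; rewrite jk leqNgt ltn_ord in jn.
  rewrite (bigD1 (Ordinal (jn : (j < n.+1)%N))) //= eqxx big1 ?addr0 // => k.
  by rewrite -val_eqE eq_sym /= => /negbTE ->.
apply: (@colim_type_ext n) => j jn.
  rewrite (linmapD _ _ (colim_snd_linear j)) (linmap_sum _ _ (colim_snd_linear j)) sum_snd jn.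
  by rewrite snd_in // add0r.
rewrite (linmapD _ _ (colim_snd_linear j)) (linmap_sum _ _ (colim_snd_linear j)) sum_snd.
rewrite (linmapD _ _ (colim_fst_linear j)) (linmap_sum _ _ (colim_fst_linear j)).
have -> : \sum_(k < n.+1) colim_fst j (colim_inj k 0 (colim_snd k y)) =
    if j == n then b (colim_snd n y) else 0.
  rewrite big_ord_recr /= {2}/colim_fst /= colim_in_fst0 // big1 ?add0r // => k _.
  rewrite /colim_fst /= colim_in_fst0; last exact: leq_trans (ltnW (ltn_ord k)) jn.
  by rewrite gtn_eqF //; apply: leq_trans jn.
move: jn; rewrite leq_eqVlt => /orP[/eqP<-|jn].
  rewrite leqnn eqxx snd_in // add0r; split=> //.
  by rewrite {2}/colim_fst /= colim_in_eq /= (linmap0 lb) addr0.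
rewrite leqNgt jn (gtn_eqF jn) !addr0 -(subnKC jn) addSnnS.
rewrite /colim_fst /colim_snd /= colim_in_gt /=.
elim: (j - n.+1)%N => [|k [IH1 IH2]].
  by rewrite addn1; apply: fy.
rewrite addnS; have [-> ->] := fy (n + k.+1)%N (leq_addr _ _).
by rewrite IH1.
Qed.

(** Write x_j for the X-component of [y] at [j] and in_j for the insertion of X at stage [j]. Modulo
    maps through copies of [Z], [y] is in_n(x_n) ([h1]), x_n is e^(2n) x_n ([h2]), x_0 is e^n x_n
    ([h3]) and in_0(x_0) is in_n(e^n x_0) ([h4]); together these join [y] to in_0(x_0). *)
Lemma colim_factors (Y : colim_type -> Prop) n : (forall y, Y y -> colim_fwd n (val y)) ->
  factors_on Z Y (fun y => y - colim_inj 0 (colim_fst 0 y) 0).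
Proof.
move=> hY.
have lin i := colim_injl_linear i; have lir i := colim_injr_linear i.
have lfst := colim_fst_linear; have lsnd := colim_snd_linear.
have lit k := linmap_iter k le.
have h1 : factors_on Z Y (fun y => y - colim_inj n (colim_fst n y) 0).
  apply: eq_factors_on (factors_on_sum n.+1 (fun k => factors_on1 Y (lir k) (lsnd k))) => y Yy.
  by apply/esym/eqP; rewrite subr_eq addrC; apply/eqP; apply: colim_decomp (hY y Yy).
have h2 k : factors_on Z Y (fun y => colim_fst n y - iter k e (colim_fst n y)).
  elim: k => [|k IH].
    by apply: eq_factors_on (factors_on0 _ X Y) => y _; rewrite subrr.
  have hk : factors_on Z Y (fun y => iter k e (b (colim_snd n y))).
    exact: factors_on_compl (lit k) (factors_on1 Y lb (lsnd n)).
  apply: eq_factors_on (factors_onD IH hk) => y Yy.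
  rewrite -[RHS](subrKA (iter k e (colim_fst n y))); congr (_ + _).
  rewrite iterSr -(linmapB _ _ (lit k)); congr (iter _ _ _).
  apply/esym/eqP; rewrite subr_eq addrC; apply/eqP.
  rewrite {1}/colim_fst (colim_type_back y); have [-> ->] := hY y Yy n (leqnn n).
  by rewrite -hab [e (e _) + _]addrC subrK.
have h3 k : factors_on Z Y (fun y => colim_fst 0 y - iter k e (colim_fst k y)).
  elim: k => [|k IH].
    by apply: eq_factors_on (factors_on0 _ X Y) => y _; rewrite subrr.
  have hk : factors_on Z Y (fun y => iter k e (b (colim_snd k.+1 y) + b (colim_snd k y))).
    apply: (factors_on_compl (lit k)).
    exact: factors_onD (factors_on1 Y lb (lsnd _)) (factors_on1 Y lb (lsnd _)).
  apply: eq_factors_on (factors_onD IH hk) => y Yy.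
  rewrite -[RHS](subrKA (iter k e (colim_fst k y))); congr (_ + _).
  rewrite iterSr -(linmapB _ _ (lit k)); congr (iter _ _ _).
  by rewrite {1}/colim_fst (colim_type_back y) -[e _ + _ + _]addrA addrAC subrr add0r.
have h4 k : factors_on Z Y (fun y => colim_inj 0 (colim_fst 0 y) 0 -
    colim_inj k (iter k e (colim_fst 0 y)) 0).
  elim: k => [|k IH].
    by apply: eq_factors_on (factors_on0 _ _ Y) => y _; rewrite subrr.
  have hk : factors_on Z Y (fun y => colim_inj k.+1 0 (a (iter k e (colim_fst 0 y)))).
    apply: factors_on1 (lir _) _.
    exact: linmap_comp la (linmap_comp (lit k) (lfst 0%N)).
  apply: eq_factors_on (factors_onD IH hk) => y Yy.
  rewrite -[RHS](subrKA (colim_inj k (iter k e (colim_fst 0 y)) 0)); congr (_ + _).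
  by rewrite [in RHS]colim_inj_step [RHS]addrC addKr.
have h5 : factors_on Z Y (fun y => colim_inj n (colim_fst n y - iter (n + n) e (colim_fst n y)) 0).
  exact: factors_on_compl (lin n) (h2 _).
have h6 : factors_on Z Y (fun y => colim_inj n (iter n e (colim_fst 0 y - iter n e (colim_fst n y))) 0).
  exact: factors_on_compl (linmap_comp (lin n) (lit n)) (h3 _).
apply: eq_factors_on (factors_onB (factors_onB (factors_onD h1 h5) h6) (h4 n)) => y _.
have linB x x' : colim_inj n (x - x') 0 = colim_inj n x 0 - colim_inj n x' 0.
  exact: linmapB (lin n).
rewrite !(linmapB _ _ (lit n)) !linB -iterD.
set A := colim_inj n (colim_fst n y) 0; set B := colim_inj n (iter (n + n) _ _) 0.
set C := colim_inj n (iter n e (colim_fst 0 y)) 0; set D := colim_inj 0 _ _.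
by rewrite subrKA !opprB subrKA subrKA.
Qed.

End Colimit.

(** * The colimit as a summand of a countable direct sum *)

Section FiniteSupport.
Variables (K : comNzRingType) (W : lmodType K).

Definition finite_support (s : nat -> W) : Prop := exists n, forall j, (n <= j)%N -> s j = 0.

Lemma finite_support_submodule : submodule (finite_support : (nat -> W) -> Prop).
Proof.
split; first by exists 0%N.
split=> [s t [n hs] [m ht]|c s [n hs]].
  exists (maxn n m) => j; rewrite geq_max => /andP[nj mj].
  by rewrite [LHS](_ : _ = s j - t j) // hs // ht // subrr.
by exists n => j nj; rewrite [LHS](_ : _ = c *: s j) // hs // scaler0.
Qed.

Definition finite_sequences := submodule_type finite_support_submodule.
Implicit Types s : finite_sequences.

Definition coordinate j s : W := val s j.

Lemma coordinate_linear j : is_linmap (coordinate j). Proof. by []. Qed.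

Lemma single_finite_support i w : finite_support (fun j => if j == i then w else 0 : W).
Proof. by exists i.+1 => j; case: eqP => // ->; rewrite ltnn. Qed.

Definition single i (w : W) : finite_sequences :=
  to_submodule finite_support_submodule (single_finite_support i w).

Lemma coordinate_single j i w : coordinate j (single i w) = if j == i then w else 0.
Proof. by []. Qed.

Lemma finite_sequences_ext s s' : (forall j, coordinate j s = coordinate j s') -> s = s'.
Proof. by move=> h; apply: val_inj; apply: funext. Qed.

Lemma single_linear i : is_linmap (single i).
Proof.
move=> c x y; apply: finite_sequences_ext => j; rewrite coordinate_linear !coordinate_single.
by case: eqP; rewrite // scaler0 addr0.
Qed.

Lemma sum_single s n : (forall j, (n <= j)%N -> coordinate j s = 0) ->
  s = \sum_(i < n) single i (coordinate i s).
Proof.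
move=> hs; apply: finite_sequences_ext => j.
rewrite (linmap_sum _ _ (coordinate_linear j)).
under eq_bigr do rewrite coordinate_single.
case: (ltnP j n) => jn.
  rewrite (bigD1 (Ordinal jn)) //= eqxx big1 ?addr0 // => k.
  by rewrite -val_eqE eq_sym /= => /negbTE ->.
by rewrite hs // big1 // => k _; case: eqP => // jk; rewrite jk leqNgt ltn_ord in jn.
Qed.

Definition coordinate_line i : finite_sequences -> Prop :=
  fun s => forall j, j <> i -> coordinate j s = 0.

Lemma coordinate_lineE i s : coordinate_line i s -> s = single i (coordinate i s).
Proof.
move=> h; apply: finite_sequences_ext => j; rewrite coordinate_single.
by case: eqP => [->|/h].
Qed.

Lemma single_line i w : coordinate_line i (single i w).
Proof. by move=> j /eqP /negbTE ji; rewrite coordinate_single ji. Qed.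

Lemma coordinate_lines_dsum : internal_dsum coordinate_line.
Proof.
split; [|split].
- move=> i; split=> //; split=> [s t hs ht|c s hs] j ji.
    by rewrite (linmapB _ _ (coordinate_linear j)) hs // ht // subrr.
  by rewrite (linmapZ _ _ (coordinate_linear j)) hs // scaler0.
- move=> s; have [n hn] := submodule_typeP s.
  exists [seq (i, single i (coordinate i s)) | i <- iota 0 n]; split; [|split].
  + rewrite -map_comp map_id; elim: n 0%N {hn} => [|n IH] k /=; first exact: List.NoDup_nil.
    apply: List.NoDup_cons; last exact: IH.
    have h (l : seq nat) x : List.In x l -> x \in l.
      by elim: l => [//|y l IHl] /= [->|/IHl xl]; rewrite inE ?eqxx ?xl ?orbT.
    by move=> /h; rewrite mem_iota ltnn.
  + by move=> p /List.in_map_iff[i [<- _]]; apply: single_line.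
  + by rewrite big_map -[n]subn0 big_mkord; apply: sum_single.
- move=> ps nd hps hs p pps.
  have hp := hps p pps.
  rewrite (coordinate_lineE hp); suff -> : coordinate p.1 p.2 = 0.
    by rewrite (linmap0 (single_linear _)).
  have <- : coordinate p.1 (\sum_(q <- ps) q.2) = coordinate p.1 p.2; last first.
    by rewrite hs (linmap0 (coordinate_linear _)).
  rewrite (linmap_sum _ _ (coordinate_linear _)).
  elim: ps nd hps pps {hs hp} => [|q ps IH] //= nd hps pps.
  rewrite big_cons; case/List.NoDup_cons_iff: nd => nq nd.
  case: pps => [<-|pps].
    suff -> : \sum_(j <- ps) coordinate q.1 j.2 = 0 by rewrite addr0.
    elim: ps {IH nd} nq hps => [|r ps IH] nq hps; first by rewrite big_nil.
    rewrite big_cons IH ?addr0.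
    - by apply: hps; [right; left | move=> e; apply: nq; left].
    - by move=> h; apply: nq; right.
    - by move=> t [<-|tt]; apply: hps; [left | right; right].
  rewrite IH //; last by move=> r rr; apply: hps; right.
  have hq : coordinate_line q.1 q.2 by apply: hps; left.
  by rewrite hq ?add0r // => e; apply: nq; rewrite -e; apply: List.in_map.
Qed.

End FiniteSupport.

Section LiftIdempotent.
Variables (K : comNzRingType) (X Z : lmodType K).
Variables (e : X -> X) (a : X -> Z) (b : Z -> X).
Hypotheses (le : is_linmap e) (la : is_linmap a) (lb : is_linmap b).
Hypothesis hab : forall x, e x - e (e x) = b (a x).

Notation T := (colim_type le la lb).
Notation W := (X * Z)%type.
Notation P := (finite_sequences W).

(** The defects of a record from the forward recursion. They vanish eventually by [colim_fwd], and
    the record is recovered from them entry by entry, whence the injectivity of the embedding. *)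
Definition colim_differences (s : nat -> W) : nat -> W := fun j =>
  if j is j'.+1 then ((s j).1 - e (s j').1, (s j).2 - a (s j').1) else s 0%N.

Lemma colim_differencesP (y : T) : finite_support (colim_differences (val y)).
Proof.
have [_ [n fy]] := submodule_typeP y; exists n.+1 => -[//|j] jn.
by have [h1 h2] := fy j jn; rewrite /= h1 h2 !subrr.
Qed.

Definition colim_embedding (y : T) : P :=
  to_submodule (finite_support_submodule W) (colim_differencesP y).

Lemma colim_embedding_linear : is_linmap colim_embedding.
Proof.
move=> c x y; apply: finite_sequences_ext => -[|j].
  by [].
rewrite (linmapD _ _ (coordinate_linear _)) (linmapZ _ _ (coordinate_linear _)).
rewrite /coordinate /=.
rewrite [LHS](_ : _ = (c *: (val x j.+1).1 + (val y j.+1).1 - e (c *: (val x j).1 + (val y j).1),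
  c *: (val x j.+1).2 + (val y j.+1).2 - a (c *: (val x j).1 + (val y j).1))) //.
rewrite [RHS](_ : _ = (c *: ((val x j.+1).1 - e (val x j).1) + ((val y j.+1).1 - e (val y j).1),
  c *: ((val x j.+1).2 - a (val x j).1) + ((val y j.+1).2 - a (val y j).1))) //.
by congr (_, _); rewrite ?le ?la opprD scalerBr [LHS]addrACA.
Qed.

Lemma colim_embedding_inj : injective colim_embedding.
Proof.
move=> x y exy; apply: val_inj; apply: funext.
have h j : coordinate j (colim_embedding x) = coordinate j (colim_embedding y) by rewrite exy.
elim=> [|j IH]; first exact: (h 0%N).
have := h j.+1; rewrite /coordinate /= IH => -[/addIr h1 /addIr h2].
by rewrite [LHS]surjective_pairing [RHS]surjective_pairing h1 h2.
Qed.

Definition colim_relation (y : nat -> X) : nat -> W := fun j =>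
  if j is j'.+1 then (y j - e (y j'), - a (y j')) else (y 0%N, 0).

(** The relations that the colimit imposes on the direct sum: [y j] at index [j] is identified with
    [(e (y j), a (y j))] at the next index. They form the complement of the embedded colimit. *)
Definition colim_relations (s : P) : Prop :=
  exists y : nat -> X, (exists n, forall j, (n <= j)%N -> y j = 0) /\
    forall j, coordinate j s = colim_relation y j.

Lemma colim_relations_submodule : submodule colim_relations.
Proof.
split; first exists (fun=> 0).
  by split=> [|[|j]]; [exists 0%N | | rewrite /= (linmap0 le) (linmap0 la) subr0 oppr0].
split=> [s t [y [[n hy] ys]] [z [[m hz] zt]]|c s [y [[n hy] ys]]].
  exists (fun j => y j - z j); split.
    exists (maxn n m) => j; rewrite geq_max => /andP[nj mj].
    by rewrite hy // hz // subrr.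
  move=> j; rewrite (linmapB _ _ (coordinate_linear j)) ys zt; case: j => [|j].
    by rewrite /= [LHS](_ : _ = (y 0%N - z 0%N, 0 - 0)) // subrr.
  rewrite [LHS](_ : _ = ((y j.+1 - e (y j)) - (z j.+1 - e (z j)), - a (y j) - - a (z j))) //=.
  by rewrite (linmapB _ _ le) (linmapB _ _ la) !opprD addrACA !opprK.
exists (fun j => c *: y j); split; first by exists n => j jn; rewrite hy // scaler0.
move=> j; rewrite (linmapZ _ _ (coordinate_linear j)) ys; case: j => [|j].
  by rewrite /= [LHS](_ : _ = (c *: y 0%N, c *: 0)) // scaler0.
rewrite [LHS](_ : _ = (c *: (y j.+1 - e (y j)), c *: - a (y j))) //=.
by rewrite (linmapZ _ _ le) (linmapZ _ _ la) scalerBr scalerN.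
Qed.

Lemma colim_span i x z : exists (y : T) (r : P), colim_relations r /\
  single i (x, z) = colim_embedding y + r.
Proof.
pose t := colim_inj le la lb hab i x z.
(* [u] is the forward orbit of [x] started at index [i]. Its difference with the X-components of the
   record [t] vanishes beyond [i] and is the required family of relations. *)
pose u j := if (j < i)%N then 0 else iter (j - i) e x.
have u0 : u 0%N = if 0%N == i then x else 0 by rewrite /u; case: (i).
have uS j : u j.+1 - e (u j) = if j.+1 == i then x else 0.
  rewrite /u; case: (ltngtP j.+1 i) => [ji|ij|e1].
  - by rewrite (linmap0 le) subrr.
  - by rewrite subSn // subrr.
  - by rewrite -e1 subnn (linmap0 le) subr0.
have z0 : colim_snd 0 t = if 0%N == i then z else 0.
  rewrite /colim_snd /=; case: (posnP i) => [->|i0]; first by rewrite colim_in_eq.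
  by rewrite colim_in_lt // ltn_eqF.
have zS j : colim_snd j.+1 t = (if j.+1 == i then z else 0) + a (u j).
  rewrite /colim_snd /= /u; case: (ltngtP j.+1 i) => [ji|ij|e1].
  - by rewrite colim_in_lt // (linmap0 la) addr0.
  - rewrite add0r -{1}(subnKC (ij : (i < j.+1)%N)) addSnnS colim_in_gt /=.
    by rewrite subSS.
  - by rewrite -e1 colim_in_eq (linmap0 la) addr0.
pose y j := u j - colim_fst j t.
have ygt j : (i < j)%N -> y j = 0.
  move=> ij; rewrite /y /u ltnNge ltnW //= /colim_fst /= -(subnKC ij) addSnnS colim_in_gt addKn.
  by rewrite subrr.
exists t, (single i (x, z) - colim_embedding t); split; last by rewrite addrC subrK.
exists y; split; first by exists i.+1.
move=> j; rewrite (linmapB _ _ (coordinate_linear j)) coordinate_single.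
case: j => [|j].
  rewrite [LHS](_ : _ = ((if 0%N == i then (x, z) else 0).1 - colim_fst 0 t,
                         (if 0%N == i then (x, z) else 0).2 - colim_snd 0 t)) //.
  rewrite /= /y u0 z0; by case: eqP => _ /=; rewrite subrr.
rewrite [LHS](_ : _ =
  ((if j.+1 == i then (x, z) else 0).1 - (colim_fst j.+1 t - e (colim_fst j t)),
   (if j.+1 == i then (x, z) else 0).2 - (colim_snd j.+1 t - a (colim_fst j t)))) //.
rewrite /= /y zS (linmapB _ _ le) (linmapB _ _ la) -(subrK (e (u j)) (u j.+1)) uS.
have aux (V : zmodType) (v w p q : V) : v - (p - q) = v + w - p - (w - q).
  by rewrite !opprB [v + w - p]addrAC addrACA subrr addr0 [q - p]addrC addrA.
congr (_, _); case: eqP => _ /=; try exact: aux.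
- by rewrite -[z + _ - _]addrA opprD addrA subrr sub0r.
- by rewrite !add0r.
Qed.

Lemma colim_in_Add : in_Add W T.
Proof.
exists P, nat, (@coordinate_line K W); split; first exact: coordinate_lines_dsum.
split.
  move=> i; exists (single i); split; [exact: single_linear | split].
    move=> w w' /(congr1 (coordinate i)); by rewrite !coordinate_single eqxx.
  move=> s; split=> [h|[w ->]]; last exact: single_line.
  by exists (coordinate i s); apply: coordinate_lineE.
exists colim_embedding, colim_relations; split; first exact: colim_embedding_linear.
split; first exact: colim_embedding_inj.
have lE := colim_embedding_linear.
have sE : submodule (fun m => exists n, m = colim_embedding n).
  split; first by exists 0; rewrite (linmap0 lE).
  split=> [_ _ [x ->] [y ->]|c _ [x ->]].
    by exists (x - y); rewrite (linmapB _ _ lE).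
  by exists (c *: x); rewrite (linmapZ _ _ lE).
split=> //; split; first exact: colim_relations_submodule.
split=> [_ [y ->] [r [[n hr] hy]]|m].
  have h1 k : (colim_differences (val y) k).1 = (colim_relation r k).1 by rewrite -hy.
  have h2 k : (colim_differences (val y) k).2 = (colim_relation r k).2 by rewrite -hy.
  have e1 j : colim_fst j y = r j.
    elim: j => [|j IH]; first exact: (h1 0%N).
    have : colim_fst j.+1 y - e (colim_fst j y) = r j.+1 - e (r j) := h1 j.+1.
    by rewrite IH => /addIr.
  have e2 j : colim_snd j y = 0.
    case: j => [|j]; first exact: (h2 0%N).
    have : colim_snd j.+1 y - a (colim_fst j y) = - a (r j) := h2 j.+1.
    by rewrite e1 -[RHS]add0r => /addIr.
  (* The X-components equal [r], hence vanish from [n] on; as the Z-components are 0, the backward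
     equation carries this zero down to index 0. *)
  have e3 k j : (n <= j + k)%N -> colim_fst j y = 0.
    elim: k j => [|k IH] j; first by rewrite addn0 e1; apply: hr.
    rewrite addnS -addSn => /IH h; rewrite /colim_fst (colim_type_back y).
    by rewrite -/(colim_fst _ y) -!/(colim_snd _ y) h !e2 (linmap0 le) (linmap0 lb) !addr0.
  rewrite (_ : y = 0) ?(linmap0 lE) //; apply: val_inj; apply: funext => j.
  rewrite [LHS]surjective_pairing -/(colim_fst j y) -/(colim_snd j y) e2 (e3 n) //.
  exact: leq_addl.
split=> // _; have [n hn] := submodule_typeP m.
rewrite (sum_single hn).
have [R0 [RB RZ]] := colim_relations_submodule.
elim: n {hn} => [|n [x [r [[y ->] [Rr E]]]]].
  by exists 0, 0; rewrite big_ord0 addr0; split; [exists 0; rewrite (linmap0 lE) | split].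
rewrite big_ord_recr /= E [coordinate n m]surjective_pairing.
have [y' [r' [Rr' ->]]] := colim_span n (coordinate n m).1 (coordinate n m).2.
exists (colim_embedding (y + y')), (r - (0 - r')); split; first by exists (y + y').
split; first by apply/RB => //; apply/RB.
by rewrite (linmapD _ _ lE) sub0r opprK addrACA.
Qed.

End LiftIdempotent.

(** Finite generation is used twice: finitely many summands contain the image of [c], and all
    elements of their sum [Y] obey the forward recursion from one common stage, as [colim_factors]
    requires. [p] is the projection onto [Y]. *)
Theorem lift_idempotent (K : comNzRingType) (X Z : lmodType K) (e : X -> X) (a : X -> Z) (b : Z -> X) :
  fg_module X ->
  (forall N : lmodType K, in_Add (X * Z)%type N -> dsum_of_fg N) ->
  is_linmap e -> is_linmap a -> is_linmap b ->
  (forall x, e x - e (e x) = b (a x)) ->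
  exists (T : lmodType K) (Y : T -> Prop) (c : X -> T) (d : T -> X) (p : T -> T),
  [/\ is_linmap c /\ is_linmap d, forall x, Y (c x) /\ d (c x) = e x,
      is_linmap p, forall y, Y (p y) /\ (Y y -> p y = y) &
      factors_on Z Y (fun y => y - c (d y))].
Proof.
move=> [_ [xs [_ hxs]]] Hadd le la lb hab.
set T := (colim_type le la lb).
have [J [N [NT fgN]]] := Hadd _ (colim_in_Add le la lb hab).
have Nsub i : submodule (N i) by case: NT.
have bounded i : exists n, forall y, N i y -> colim_fwd e a n (val y).
  have [[N0 [NB NZ]] [ys [ysN hys]]] := fgN i.
  have [n hn] : exists n, forall y, y \in ys -> colim_fwd e a n (val y).
    elim: ys {ysN hys} => [|y ys [n IH]]; first by exists 0%N.
    have [_ [m hm]] := submodule_typeP y; exists (maxn n m) => y'.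
    rewrite inE => /orP[/eqP->|/IH h] j; rewrite geq_max => /andP[nj mj].
      exact: hm.
    exact: h.
  exists n => y /hys[cs [_ ->]] j nj.
  have lf j' : is_linmap (fun y : T => (val y j').1) := colim_fst_linear j'.
  have ls j' : is_linmap (fun y : T => (val y j').2) := colim_snd_linear j'.
  rewrite (linmap_sum _ _ (lf _)) (linmap_sum _ _ (ls _)) (linmap_sum _ _ (lf _)).
  rewrite (linmap_sum _ _ le) (linmap_sum _ _ la); split.
    apply: eq_bigr => k _; rewrite (linmapZ _ _ (lf _)) (linmapZ _ _ (lf _)) (linmapZ _ _ le).
    by have [->] := hn ys`_k (mem_nth _ (ltn_ord k)) j nj.
  apply: eq_bigr => k _; rewrite (linmapZ _ _ (ls _)) (linmapZ _ _ (lf _)) (linmapZ _ _ la).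
  by have [_ ->] := hn ys`_k (mem_nth _ (ltn_ord k)) j nj.
have lc := colim_injl_linear le la lb hab 0.
set c := fun x => colim_inj le la lb hab 0 x 0 in lc.
have [l hl] : exists l : seq J, forall x, x \in xs -> partial_sum N (fun i => List.In i l) (c x).
  elim: xs {hxs} => [|x xs [l IH]]; first by exists [::].
  have [_ [/(_ (c x))[ps [_ [hps eps]]] _]] := NT.
  exists (map fst ps ++ l) => x'; rewrite inE => /orP[/eqP->|/IH[qs [hqs eqs]]].
    exists ps; split=> // q qq; split; first exact: hps.
    by apply: List.in_or_app; left; apply: List.in_map.
  exists qs; split=> // q /hqs[Nq ql]; split=> //.
  by apply: List.in_or_app; right.
set Y := partial_sum N (fun i => List.In i l) in hl.
have sY : submodule Y := partial_sum_submodule Nsub _.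
have Yc x : Y (c x).
  have [cs [_ ->]] := (hxs x).1 I.
  have [Y0 [YB YZ]] := sY.
  rewrite (linmap_sum _ _ lc).
  elim/big_ind: _ => // [y z Yy Yz|i _].
    by rewrite -[z]opprK -[- z]sub0r; apply/YB => //; apply/YB.
  by rewrite (linmapZ _ _ lc); apply/YZ/hl/mem_nth.
have [p [lp pY pid]] := complement_projection (partial_sum_complement Nsub NT (fun i => List.In i l)).
have [n hn] : exists n, forall y, Y y -> colim_fwd e a n (val y).
  have [n hn] : exists n, forall i, List.In i l -> forall y, N i y -> colim_fwd e a n (val y).
    elim: (l) => [|i l' [n IH]]; first by exists 0%N.
    have [m hm] := bounded i; exists (maxn n m) => i' /= [<-|il] y Ny j; rewrite geq_max => /andP[nj mj].
      exact: (hm y).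
    exact: (IH i').
  exists n => y [ps [hps ->]] j nj.
  have lf j' : is_linmap (fun y : T => (val y j').1) := colim_fst_linear j'.
  have ls j' : is_linmap (fun y : T => (val y j').2) := colim_snd_linear j'.
  rewrite (linmap_sum _ _ (lf _)) (linmap_sum _ _ (ls _)) (linmap_sum _ _ (lf _)).
  rewrite (linmap_sum _ _ le) (linmap_sum _ _ la).
  elim: ps hps => [|q ps IH] hps; first by rewrite !big_nil.
  have [r rr|IH1 IH2] := IH; first by apply: hps; right.
  have [Nq ql] := hps q (or_introl erefl).
  have [h1 h2] := hn _ ql _ Nq j nj.
  by rewrite !big_cons IH1 IH2 h1 h2.
exists T, Y, c, (@colim_fst _ _ _ _ _ _ le la lb 0), p; split=> //.
- move=> x; split=> //; have -> : e x = e x + b 0 by rewrite (linmap0 lb) addr0.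
  exact: colim_fst_inj.
- by move=> y; split; [apply: pY | apply: pid].
- exact: colim_factors hn.
Qed.

(** * Lattices and their endomorphisms *)

Section Subrings.
Variable T : comNzRingType.
Implicit Types A : T -> Prop.

Lemma subring0 A : is_subring A -> A 0. Proof. by case. Qed.
Lemma subring1 A : is_subring A -> A 1. Proof. by case=> _ []. Qed.
Lemma subringB A x y : is_subring A -> A x -> A y -> A (x - y).
Proof. by case=> _ [_ [AB _]]; apply: AB. Qed.
Lemma subringM A x y : is_subring A -> A x -> A y -> A (x * y).
Proof. by case=> _ [_ [_ AM]]; apply: AM. Qed.
Lemma subringN A x : is_subring A -> A x -> A (- x).
Proof. by move=> sA Ax; rewrite -sub0r; apply: subringB => //; apply: subring0. Qed.
Lemma subringD A x y : is_subring A -> A x -> A y -> A (x + y).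
Proof. by move=> sA Ax Ay; rewrite -[y]opprK; apply: subringB => //; apply: subringN. Qed.
Lemma subringX A x n : is_subring A -> A x -> A (x ^+ n).
Proof.
move=> sA Ax; elim: n => [|n IH]; first by rewrite expr0; apply: subring1.
by rewrite exprS; apply: subringM.
Qed.
Lemma subring_sum A (I : Type) (s : seq I) (P : pred I) F :
  is_subring A -> (forall i, P i -> A (F i)) -> A (\sum_(i <- s | P i) F i).
Proof.
move=> sA h; elim/big_ind: _ => //; first exact: subring0.
by move=> x y; apply: subringD.
Qed.
Lemma subring_prod A (I : Type) (s : seq I) (P : pred I) F :
  is_subring A -> (forall i, P i -> A (F i)) -> A (\prod_(i <- s | P i) F i).
Proof.
move=> sA h; elim/big_ind: _ => //; first exact: subring1.
by move=> x y; apply: subringM.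
Qed.

Definition mx_over A m n (M : 'M[T]_(m, n)) : Prop := forall i j, A (M i j).

Lemma mx_over0 A m n : is_subring A -> mx_over A (0 : 'M_(m, n)).
Proof. by move=> sA i j; rewrite mxE; apply: subring0. Qed.
Lemma mx_overD A m n (M N : 'M_(m, n)) : is_subring A ->
  mx_over A M -> mx_over A N -> mx_over A (M + N).
Proof. by move=> sA hM hN i j; rewrite mxE; apply: subringD. Qed.
Lemma mx_overN A m n (M : 'M_(m, n)) : is_subring A -> mx_over A M -> mx_over A (- M).
Proof. by move=> sA hM i j; rewrite mxE; apply: subringN. Qed.
Lemma mx_overB A m n (M N : 'M_(m, n)) : is_subring A ->
  mx_over A M -> mx_over A N -> mx_over A (M - N).
Proof. by move=> sA hM hN; apply: mx_overD => //; apply: mx_overN. Qed.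
Lemma mx_overZ A m n a (M : 'M_(m, n)) : is_subring A -> A a ->
  mx_over A M -> mx_over A (a *: M).
Proof. by move=> sA Aa hM i j; rewrite mxE; apply: subringM. Qed.
Lemma mx_overM A m n p (M : 'M_(m, n)) (N : 'M_(n, p)) : is_subring A ->
  mx_over A M -> mx_over A N -> mx_over A (M *m N).
Proof. by move=> sA hM hN i j; rewrite mxE; apply: subring_sum => // k _; apply: subringM. Qed.
Lemma mx_over_scalar A n a : is_subring A -> A a -> mx_over A (a%:M : 'M_n).
Proof.
by move=> sA Aa i j; rewrite mxE; case: (i == j) => //; apply: subring0.
Qed.
Lemma mx_over_delta A m n i j : is_subring A -> mx_over A (delta_mx i j : 'M_(m, n)).
Proof.
move=> sA k l; rewrite mxE; case: (_ && _); [exact: subring1 | exact: subring0].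
Qed.
Lemma mx_over_det A n (M : 'M_n) : is_subring A -> mx_over A M -> A (\det M).
Proof.
move=> sA hM; apply: subring_sum => // s _; apply: subringM => //.
  by apply: subringX => //; apply: subringN => //; apply: subring1.
by apply: subring_prod.
Qed.
Lemma mx_over_adj A n (M : 'M_n) : is_subring A -> mx_over A M -> mx_over A (\adj M).
Proof.
move=> sA hM i j; rewrite mxE; apply: subringM => //.
  by apply: subringX => //; apply: subringN => //; apply: subring1.
by apply: mx_over_det => // k l; rewrite !mxE.
Qed.
Lemma mx_over_row_mx A m n1 n2 (M : 'M_(m, n1)) (N : 'M_(m, n2)) :
  mx_over A M -> mx_over A N -> mx_over A (row_mx M N).
Proof. by move=> hM hN i j; rewrite mxE; case: (fintype.split j) => x. Qed.
Lemma mx_over_lsub A m n1 n2 (M : 'M_(m, n1 + n2)) : mx_over A M -> mx_over A (lsubmx M).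
Proof. by move=> hM i j; rewrite mxE. Qed.
Lemma mx_over_rsub A m n1 n2 (M : 'M_(m, n1 + n2)) : mx_over A M -> mx_over A (rsubmx M).
Proof. by move=> hM i j; rewrite mxE. Qed.

End Subrings.

Section Lattices.
Variables (Q : fieldType) (A : Q -> Prop).
Hypothesis sA : is_subring A.

(** A finitely generated torsion-free module is encoded by the rows of a matrix over [Q] that span
    it. Changing [A] alone localizes or extends the module, with the same matrices as maps. *)
Definition lattice n k (B : 'M[Q]_(n, k)) : 'rV[Q]_k -> Prop :=
  fun v => exists c : 'rV[Q]_n, mx_over A c /\ v = c *m B.

Definition lattice_hom n k n' k' (B : 'M_(n, k)) (B' : 'M_(n', k')) (F : 'M[Q]_(k, k')) :=
  forall v, lattice B v -> lattice B' (v *m F).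

Lemma lattice0 n k (B : 'M_(n, k)) : lattice B 0.
Proof. by exists 0; rewrite mul0mx; split=> //; apply: mx_over0. Qed.

Lemma latticeD n k (B : 'M_(n, k)) v w : lattice B v -> lattice B w -> lattice B (v + w).
Proof.
move=> [c [Ac ->]] [d [Ad ->]]; exists (c + d); rewrite mulmxDl; split=> //.
exact: mx_overD.
Qed.

Lemma latticeZ n k (B : 'M_(n, k)) a v : A a -> lattice B v -> lattice B (a *: v).
Proof.
move=> Aa [c [Ac ->]]; exists (a *: c); rewrite scalemxAl; split=> //.
exact: mx_overZ.
Qed.

Lemma latticeN n k (B : 'M_(n, k)) v : lattice B v -> lattice B (- v).
Proof.
move=> Bv; rewrite -scaleN1r; apply: latticeZ => //.
by apply: subringN => //; apply: subring1.
Qed.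

Lemma latticeB n k (B : 'M_(n, k)) v w : lattice B v -> lattice B w -> lattice B (v - w).
Proof. by move=> Bv Bw; apply: latticeD => //; apply: latticeN. Qed.

Lemma lattice_row n k (B : 'M_(n, k)) i : lattice B (row i B).
Proof. by exists (delta_mx 0 i); rewrite rowE; split=> //; apply: mx_over_delta. Qed.

Lemma lattice_homP n k n' k' (B : 'M_(n, k)) (B' : 'M_(n', k')) F :
  lattice_hom B B' F <-> exists T, mx_over A T /\ B *m F = T *m B'.
Proof.
split=> [h|[T [AT e]] _ [c [Ac ->]]]; last first.
  by exists (c *m T); rewrite -mulmxA e mulmxA; split=> //; apply: mx_overM.
have ex i : {c : 'rV_n' | mx_over A c /\ row i B *m F = c *m B'}.
  by apply/cid/h/lattice_row.
exists (\matrix_i sval (ex i)); split.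
  by move=> i j; rewrite mxE; case: (svalP (ex i)).
apply/row_matrixP => i; rewrite !row_mul rowK.
by case: (svalP (ex i)).
Qed.

Lemma lattice_hom1 n k (B : 'M_(n, k)) : lattice_hom B B 1%:M.
Proof. by move=> v; rewrite mulmx1. Qed.

Lemma lattice_homM n k n' k' n'' k'' (B : 'M_(n, k)) (B' : 'M_(n', k'))
    (B'' : 'M_(n'', k'')) F G :
  lattice_hom B B' F -> lattice_hom B' B'' G -> lattice_hom B B'' (F *m G).
Proof. by move=> hF hG v Bv; rewrite mulmxA; apply/hG/hF. Qed.

Lemma lattice_homD n k n' k' (B : 'M_(n, k)) (B' : 'M_(n', k')) F G :
  lattice_hom B B' F -> lattice_hom B B' G -> lattice_hom B B' (F + G).
Proof. by move=> hF hG v Bv; rewrite mulmxDr; apply: latticeD; [apply: hF | apply: hG]. Qed.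

Lemma lattice_homN n k n' k' (B : 'M_(n, k)) (B' : 'M_(n', k')) F :
  lattice_hom B B' F -> lattice_hom B B' (- F).
Proof. by move=> hF v Bv; rewrite mulmxN; apply/latticeN/hF. Qed.

Lemma lattice_homB n k n' k' (B : 'M_(n, k)) (B' : 'M_(n', k')) F G :
  lattice_hom B B' F -> lattice_hom B B' G -> lattice_hom B B' (F - G).
Proof. by move=> hF hG; apply: lattice_homD => //; apply: lattice_homN. Qed.

Lemma lattice_homZ n k n' k' (B : 'M_(n, k)) (B' : 'M_(n', k')) a F :
  A a -> lattice_hom B B' F -> lattice_hom B B' (a *: F).
Proof. by move=> Aa hF v Bv; rewrite -scalemxAr; apply/latticeZ/hF. Qed.

Lemma lattice_hom0 n k n' k' (B : 'M_(n, k)) (B' : 'M_(n', k')) : lattice_hom B B' 0.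
Proof. by move=> v Bv; rewrite mulmx0; apply: lattice0. Qed.

Lemma lattice_block n k n' k' (B : 'M_(n, k)) (B' : 'M_(n', k')) v w :
  lattice B v -> lattice B' w -> lattice (block_mx B 0 0 B') (row_mx v w).
Proof.
move=> [c [Ac ->]] [d [Ad ->]]; exists (row_mx c d); split; first exact: mx_over_row_mx.
by rewrite mul_row_block !mulmx0 addr0 add0r.
Qed.

Lemma lattice_lsub n k n' k' (B : 'M_(n, k)) (B' : 'M_(n', k')) v :
  lattice (block_mx B 0 0 B') v -> lattice B (lsubmx v).
Proof.
move=> [c [Ac ->]]; exists (lsubmx c); split; first exact: mx_over_lsub.
by rewrite -{1}[c]hsubmxK mul_row_block mulmx0 addr0 row_mxKl.
Qed.

Lemma lattice_rsub n k n' k' (B : 'M_(n, k)) (B' : 'M_(n', k')) v :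
  lattice (block_mx B 0 0 B') v -> lattice B' (rsubmx v).
Proof.
move=> [c [Ac ->]]; exists (rsubmx c); split; first exact: mx_over_rsub.
by rewrite -{1}[c]hsubmxK mul_row_block !mulmx0 add0r row_mxKr.
Qed.

Lemma lattice_id_ext n k k' (B : 'M_(n, k)) (F G : 'M[Q]_(k, k')) : row_full B ->
  (forall v, lattice B v -> v *m F = v *m G) -> F = G.
Proof.
move=> /row_fullP[C CB] h; rewrite -[F]mul1mx -[G]mul1mx -CB -!mulmxA.
by congr (_ *m _); apply/row_matrixP => i; rewrite !row_mul; apply/h/lattice_row.
Qed.

End Lattices.

(** * Sums of one copy of X and several copies of Z *)

Section Towers.
Variable Q : fieldType.
Variables (n k n' l : nat) (BX : 'M[Q]_(n, k)) (BZ : 'M[Q]_(n', l)).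

Fixpoint tower_dim (x z b : nat) : nat := if b is b'.+1 then z + tower_dim x z b' else x.

(** Copies of [Z] are added in front, so that one 2 x 2 block decomposition strips the latest copy
    and leaves the same construction one step shorter. *)
Fixpoint tower b : 'M[Q]_(tower_dim n n' b, tower_dim k l b) :=
  if b is b'.+1 then block_mx BZ 0 0 (tower b') else BX.

Fixpoint tower_in b : 'M[Q]_(k, tower_dim k l b) :=
  if b is b'.+1 then row_mx 0 (tower_in b') else 1%:M.

Fixpoint tower_out b : 'M[Q]_(tower_dim k l b, k) :=
  if b is b'.+1 then col_mx 0 (tower_out b') else 1%:M.

Definition tower_corner b (e : 'M[Q]_(tower_dim k l b)) : 'M[Q]_k :=
  tower_in b *m e *m tower_out b.

Lemma tower_cornerS b (e : 'M[Q]_(tower_dim k l b.+1)) :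
  tower_corner e = tower_corner (drsubmx (e : 'M_(l + tower_dim k l b))).
Proof.
rewrite /tower_corner /= -[in LHS](@submxK _ l _ l _ e).
by rewrite mul_row_block !mul0mx !add0r mul_row_col mulmx0 add0r.
Qed.

Lemma tower_row_full b : row_full BX -> row_full BZ -> row_full (tower b).
Proof.
move=> /row_fullP[C CX] /row_fullP[D DZ]; elim: b => [|b /row_fullP[E EB]] /=.
  by apply/row_fullP; exists C.
apply/row_fullP; exists (block_mx D 0 0 E).
by rewrite mulmx_block !mulmx0 !mul0mx !addr0 !add0r DZ EB -scalar_mx_block.
Qed.

End Towers.

Section RestrictedScalars.
Variables (R : idomainType) (Q : fieldType) (f : {rmorphism R -> Q}).

(** An alias of the row space: ['rV[Q]_k] already carries its module structure over [Q], and the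
    alias receives the one over [R]. *)
Definition restricted (k : nat) : Type := 'rV[Q]_k.

HB.instance Definition _ k := GRing.Zmodule.on (restricted k).

Fact restricted_scaleA k (a b : R) (v : restricted k) :
  f a *: (f b *: (v : 'rV_k)) = f (a * b) *: (v : 'rV_k).
Proof. by rewrite scalerA rmorphM. Qed.
Fact restricted_scale1 k : left_id 1 (fun (a : R) (v : restricted k) => f a *: (v : 'rV_k)).
Proof. by move=> v; rewrite rmorph1 scale1r. Qed.
Fact restricted_scaleDr k :
  right_distributive (fun (a : R) (v : restricted k) => f a *: (v : 'rV_k) : restricted k) +%R.
Proof. by move=> a v w; apply: scalerDr. Qed.
Fact restricted_scaleDl k (v : restricted k) :
  {morph (fun a : R => f a *: (v : 'rV_k) : restricted k) : a b / a + b}.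
Proof. by move=> a b; rewrite rmorphD scalerDl. Qed.

HB.instance Definition _ k := @GRing.Zmodule_isLmodule.Build R (restricted k)
  (fun a v => f a *: (v : 'rV_k)) (@restricted_scaleA k) (@restricted_scale1 k)
  (@restricted_scaleDr k) (@restricted_scaleDl k).

Definition image : Q -> Prop := fun q => exists r, q = f r.

Lemma image_subring : is_subring image.
Proof.
split; first by exists 0; rewrite rmorph0.
split; first by exists 1; rewrite rmorph1.
split=> [_ _ [a ->] [b ->]|_ _ [a ->] [b ->]]; first by exists (a - b); rewrite rmorphB.
by exists (a * b); rewrite rmorphM.
Qed.

Lemma lattice_submodule n k (B : 'M_(n, k)) :
  submodule (lattice image B : restricted k -> Prop).
Proof.
have sI := image_subring; split; first exact: lattice0.
split=> [v w Bv Bw|a v Bv]; first exact: latticeB.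
by apply: latticeZ => //; exists a.
Qed.

Definition lattice_module n k (B : 'M[Q]_(n, k)) : lmodType R :=
  submodule_type (lattice_submodule B).

End RestrictedScalars.

Section Denominators.
Variables (R : idomainType) (Q : fieldType) (f : {rmorphism R -> Q}).
Hypothesis f_inj : injective f.
Hypothesis f_frac : forall q : Q, exists a b : R, f b != 0 /\ q = f a / f b.

Lemma frac_neq0 s : (f s != 0) = (s != 0).
Proof. by rewrite -(rmorph0 f) (inj_eq f_inj). Qed.

Lemma common_denominator (T : finType) (q : T -> Q) :
  exists s, s != 0 /\ forall i, image f (f s * q i).
Proof.
suff [s [s0 hs]] : exists s, s != 0 /\ forall i, i \in enum T -> image f (f s * q i).
  by exists s; split=> // i; apply: hs; rewrite mem_enum.
elim: (enum T) => [|i l [s [s0 hs]]]; first by exists 1; rewrite oner_neq0.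
have [a [b [fb e]]] := f_frac (q i).
exists (s * b); split; first by rewrite mulf_neq0 // -frac_neq0.
move=> j; rewrite inE => /orP[/eqP->|/hs[c hc]].
  by exists (s * a); rewrite e !rmorphM -mulrA [f a / _]mulrC mulVKf.
by exists (b * c); rewrite !rmorphM mulrAC hc mulrC.
Qed.

Lemma mx_denominator m n (M : 'M[Q]_(m, n)) :
  exists s, s != 0 /\ mx_over (image f) (f s *: M).
Proof.
have [s [s0 hs]] := common_denominator (fun p : 'I_m * 'I_n => M p.1 p.2).
by exists s; split=> // i j; rewrite mxE; apply: (hs (i, j)).
Qed.

(** Clearing denominators turns a relation over [Q] between the rows of [B] into one over [R], so
    the hypothesis yields the inclusion of left kernels over [Q]. *)
Lemma mx_factor n k k' (B : 'M[Q]_(n, k)) (Y : 'M[Q]_(n, k')) :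
  (forall c : 'rV_n, mx_over (image f) c -> c *m B = 0 -> c *m Y = 0) ->
  exists F, Y = B *m F.
Proof.
move=> h; suff /submxP[D e] : (Y^T <= B^T)%MS.
  by exists D^T; rewrite -[LHS]trmxK e trmx_mul trmxK.
rewrite submxE; apply/eqP/trmx_inj; rewrite trmx_mul trmxK trmx0.
apply/row_matrixP => i; rewrite row_mul row0.
have kB : row i (cokermx B^T)^T *m B = 0.
  rewrite -row_mul; apply/rowP => j.
  have /(congr1 trmx) := mulmx_coker B^T.
  by rewrite trmx_mul trmxK trmx0 => ->; rewrite !mxE.
have [s [s0 hs]] := mx_denominator (row i (cokermx B^T)^T).
have := h _ hs; rewrite -scalemxAl kB scaler0 => /(_ erefl) /eqP.
by rewrite -scalemxAl scaler_eq0 -[f s == 0]negbK frac_neq0 s0 => /eqP.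
Qed.

Lemma lattice_linear_mx n k n' k' (B : 'M_(n, k)) (B' : 'M_(n', k'))
    (g : lattice_module f B -> lattice_module f B') : is_linmap g ->
  exists F, lattice_hom (image f) B B' F /\ forall v, val (g v) = val v *m F :> 'rV_k'.
Proof.
move=> lg; have sI := image_subring f.
pose r i : lattice_module f B := to_submodule (lattice_submodule f B) (lattice_row sI B i).
pose Y := \matrix_i (val (g (r i)) : 'rV_k').
have lval m l (C : 'M_(m, l)) (c : R) (x y : lattice_module f C) :
    val (c *: x + y) = f c *: (val x : 'rV_l) + val y :> 'rV_l by [].
have val0 m l (C : 'M_(m, l)) : val (0 : lattice_module f C) = 0 :> 'rV_l by [].
have comb (c : 'rV_n) (d : 'I_n -> R) : (forall i, c 0 i = f (d i)) ->
    val (\sum_i d i *: r i) = c *m B :> 'rV_k /\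
    val (g (\sum_i d i *: r i)) = c *m Y :> 'rV_k'.
  move=> cd; rewrite !mulmx_sum_row; split.
    transitivity (\sum_i (val (d i *: r i) : 'rV_k)).
      by elim/big_rec2: _ => [|i x y _ e]; rewrite ?val0 // -e.
    by apply: eq_bigr => i _; rewrite cd.
  rewrite linmap_sum //; transitivity (\sum_i (val (g (d i *: r i)) : 'rV_k')).
    by elim/big_rec2: _ => [|i x y _ e]; rewrite ?val0 // -e.
  by apply: eq_bigr => i _; rewrite linmapZ // rowK cd.
have dec (c : 'rV_n) : mx_over (image f) c -> exists d, forall i, c 0 i = f (d i).
  move=> hc; have ex i := cid (hc 0 i).
  by exists (fun i => projT1 (ex i)) => i; case: (ex i).
have [|F eF] := @mx_factor _ _ _ B Y.
  move=> c /dec[d cd] cB; have [e1 <-] := comb c d cd.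
  have -> : \sum_i d i *: r i = 0 by apply: val_inj; rewrite /= e1 cB.
  by rewrite linmap0.
have hF v : val (g v) = val v *m F :> 'rV_k'.
  have [c [/dec[d cd] ev]] : lattice (image f) B (val v) := submodule_typeP v.
  have [e1 e2] := comb c d cd.
  have -> : v = \sum_i d i *: r i by apply: val_inj; rewrite e1 ev.
  by rewrite e1 e2 eF mulmxA.
exists F; split=> // v Bv.
pose w : lattice_module f B := to_submodule (lattice_submodule f B) Bv.
by have := submodule_typeP (g w); rewrite hF.
Qed.

Lemma lattice_module_fg n k (B : 'M[Q]_(n, k)) : fg_module (lattice_module f B).
Proof.
have sI := image_subring f; split=> //.
pose r i : lattice_module f B := to_submodule (lattice_submodule f B) (lattice_row sI B i).
exists (codom r); split=> // v; split=> // _.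
have [c [hc ev]] : lattice (image f) B (val v) := submodule_typeP v.
have ex i := cid (hc 0 i).
exists [seq projT1 (ex i) | i <- enum 'I_n]; split; first by rewrite size_map size_enum_ord size_codom card_ord.
rewrite size_codom card_ord; apply: val_inj; rewrite ev mulmx_sum_row.
transitivity (\sum_(i < n) (f (projT1 (ex i)) *: row i B)).
  by apply: eq_bigr => i _; case: (ex i) => d /= ->.
have val0 : val (0 : lattice_module f B) = 0 :> 'rV_k by [].
have valD (x y : lattice_module f B) : val (x + y) = (val x : 'rV_k) + val y :> 'rV_k by [].
symmetry; elim/big_rec2: _ => [|i x y _ e]; first by rewrite val0.
rewrite valD e; congr (_ + _).
have -> : [seq projT1 (ex i0) | i0 <- enum 'I_n]`_i = projT1 (ex i).
  by rewrite (nth_map i) ?size_enum_ord // nth_ord_enum.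
by rewrite /codom /image_mem (nth_map i) ?size_enum_ord // nth_ord_enum.
Qed.

Lemma lattice_module_torsion_free n k (B : 'M[Q]_(n, k)) : torsion_free (lattice_module f B).
Proof.
move=> a v /(congr1 val) e; have {}e : f a *: (val v : 'rV_k) = 0 := e.
move/eqP: e; rewrite scaler_eq0 -[f a == 0]negbK frac_neq0 negbK.
by case/orP => /eqP; [left | right; apply: val_inj].
Qed.

End Denominators.

Lemma prod_fg_module (K : comNzRingType) (X Z : lmodType K) :
  fg_module X -> fg_module Z -> fg_module (X * Z)%type.
Proof.
move=> [_ [xs [_ hx]]] [_ [zs [_ hz]]]; split=> //.
exists ([seq (x, 0) | x <- xs] ++ [seq (0, z) | z <- zs]); split=> // -[x z]; split=> // _.
have [cs [scs ->]] := (hx x).1 I; have [ds [sds ->]] := (hz z).1 I.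
exists (cs ++ ds); split; first by rewrite !size_cat !size_map scs sds.
rewrite size_cat !size_map.
have lf : is_linmap (fun p : X * Z => p.1) by [].
have ls : is_linmap (fun p : X * Z => p.2) by [].
rewrite [RHS]surjective_pairing (linmap_sum _ _ lf) (linmap_sum _ _ ls) !big_split_ord /=.
congr (_, _).
  rewrite [X in _ + X]big1 ?addr0 => [|i _]; last first.
    by rewrite !nth_cat !size_map scs ltnNge leq_addr /= addKn (nth_map 0) //= scaler0.
  apply: eq_bigr => i _; rewrite !nth_cat !size_map scs !ltn_ord /=.
  by rewrite (nth_map 0).
rewrite [X in X + _]big1 ?add0r => [|i _]; last first.
  by rewrite !nth_cat !size_map scs ltn_ord /= (nth_map 0) //= scaler0.
apply: eq_bigr => i _; rewrite !nth_cat !size_map scs ltnNge leq_addr /= addKn.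
by rewrite (nth_map 0).
Qed.

Lemma prod_torsion_free (K : comNzRingType) (X Z : lmodType K) :
  torsion_free X -> torsion_free Z -> torsion_free (X * Z)%type.
Proof.
move=> tX tZ r [x z] [e1 e2].
case: (tX _ _ e1) => [|->]; first by left.
by case: (tZ _ _ e2) => [|->]; [left | right].
Qed.

Section LiftMatrix.
Variables (R : idomainType) (Q : fieldType) (f : {rmorphism R -> Q}).
Hypothesis f_inj : injective f.
Hypothesis f_frac : forall q : Q, exists a b : R, f b != 0 /\ q = f a / f b.
Notation L := (lattice_module f).

Section HomFun.
Variables (n k n' k' : nat) (B : 'M[Q]_(n, k)) (B' : 'M[Q]_(n', k')) (F : 'M[Q]_(k, k')).
Hypothesis hF : lattice_hom (image f) B B' F.

Definition lattice_fun (v : L B) : L B' :=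
  to_submodule (lattice_submodule f B') (hF (submodule_typeP v : lattice (image f) B (val v))).

Lemma lattice_funE v : val (lattice_fun v) = (val v : 'rV_k) *m F. Proof. by []. Qed.

Lemma lattice_fun_linear : is_linmap lattice_fun.
Proof.
move=> a x y; apply: val_inj.
have e (w w' : 'rV[Q]_k) : (f a *: w + w') *m F = f a *: (w *m F) + w' *m F.
  by rewrite mulmxDl scalemxAl.
exact: e.
Qed.

End HomFun.

Section TowerMaps.
Variables (n k n' l : nat) (BX : 'M[Q]_(n, k)) (BZ : 'M[Q]_(n', l)).
Variables (T : lmodType R) (c : L BX -> T) (d : T -> L BX) (p : T -> T).
Hypotheses (lc : is_linmap c) (ld : is_linmap d) (lp : is_linmap p).
Hypothesis pc : forall x, p (c x) = c x.

(** Turns a finite sum of maps through [Z] into a single passage through X + Z^b, with one copy of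
    [Z] for each pair; composing with [p] beforehand keeps the image of [h] inside the summand. *)
Lemma tower_maps (s : seq ((L BZ -> T) * (T -> L BZ))) :
  (forall q, List.In q s -> [/\ is_linmap q.1, is_linmap q.2 & forall z, p (q.1 z) = q.1 z]) ->
  exists b (g : T -> L (tower BX BZ b)) (h : L (tower BX BZ b) -> T),
  [/\ is_linmap g /\ is_linmap h,
      forall y, h (g y) = c (d y) + \sum_(q <- s) q.1 (q.2 y),
      forall x : L BX, exists w : L (tower BX BZ b), val w = (val x : 'rV_k) *m tower_in Q k l b :> 'rV_(tower_dim k l b) /\ h w = c x,
      forall y, (val (g y) : 'rV_(tower_dim k l b)) *m tower_out Q k l b = val (d y) :> 'rV_k &
      forall w, p (h w) = h w].
Proof.
have sI := image_subring f.
elim: s => [|q s IH] hs.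
  exists 0%N, d, c; split=> //.
  - by move=> y; rewrite big_nil addr0.
  - by move=> x; exists x; rewrite mulmx1.
  - by move=> y; rewrite mulmx1.
have [r rs|b [g [h [[lg lh] hg hx hy hp]]]] := IH; first by apply: hs; right.
have [l1 l2 p1] := hs q (or_introl erefl).
pose U := tower BX BZ b.+1.
have gP y : lattice (image f) U (row_mx (val (q.2 y) : 'rV_l) (val (g y) : 'rV_(tower_dim k l b))).
  by apply: lattice_block; apply: submodule_typeP.
pose g' y : L U := to_submodule (lattice_submodule f U) (gP y).
have sub1 (w : L U) : lattice (image f) BZ (lsubmx (val w : 'rV_(l + tower_dim k l b))).
  by apply: (lattice_lsub (B' := tower BX BZ b)); apply: (submodule_typeP w).
have sub2 (w : L U) : lattice (image f) (tower BX BZ b) (rsubmx (val w : 'rV_(l + tower_dim k l b))).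
  by apply: (lattice_rsub (B := BZ)); apply: (submodule_typeP w).
pose w1 w : L BZ := to_submodule (lattice_submodule f BZ) (sub1 w).
pose w2 w : L (tower BX BZ b) := to_submodule (lattice_submodule f _) (sub2 w).
have lw1 : is_linmap w1.
  move=> a x y; apply: val_inj.
  have e (v v' : 'rV[Q]_(l + tower_dim k l b)) : lsubmx (f a *: v + v') = f a *: lsubmx v + lsubmx v'.
    by rewrite linearP.
  exact: e.
have lw2 : is_linmap w2.
  move=> a x y; apply: val_inj.
  have e (v v' : 'rV[Q]_(l + tower_dim k l b)) : rsubmx (f a *: v + v') = f a *: rsubmx v + rsubmx v'.
    by rewrite linearP.
  exact: e.
exists b.+1, g', (fun w => q.1 (w1 w) + h (w2 w)); split.
- split=> [a x y|a x y]; last first.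
    by rewrite lw1 lw2 l1 lh scalerDr addrACA.
  apply: val_inj; rewrite /= l2 lg.
  have e (v v' : 'rV[Q]_l) (w w' : 'rV[Q]_(tower_dim k l b)) :
    row_mx (f a *: v + v') (f a *: w + w') = f a *: row_mx v w + row_mx v' w'.
    by rewrite scale_row_mx add_row_mx.
  exact: e.
- move=> y; have -> : w1 (g' y) = q.2 y by apply: val_inj; rewrite /= row_mxKl.
  have -> : w2 (g' y) = g y by apply: val_inj; rewrite /= row_mxKr.
  by rewrite hg big_cons addrCA.
- move=> x; have [w [e1 e2]] := hx x.
  have wP : lattice (image f) U (row_mx (0 : 'rV_l) (val w : 'rV_(tower_dim k l b))).
    by apply: lattice_block; [apply: (lattice0 sI) | apply: (submodule_typeP w)].
  exists (to_submodule (lattice_submodule f U) wP); split.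
    by rewrite /= e1 mul_mx_row mulmx0.
  set v := to_submodule _ _.
  have -> : w1 v = 0 by apply: val_inj; rewrite /= row_mxKl.
  have -> : w2 v = w by apply: val_inj; rewrite /= row_mxKr.
  by rewrite (linmap0 l1) add0r.
- by move=> y; rewrite -hy /= mul_row_col mulmx0 add0r.
- by move=> w; rewrite (linmapD _ _ lp) p1 hp.
Qed.

End TowerMaps.

Hypothesis Hadd : forall X : lmodType R, fg_module X -> torsion_free X ->
  forall N : lmodType R, in_Add X N -> dsum_of_fg N.

(** The defect of [E] may factor through a module [BZ'] other than [BZ], provided that its identity
    factors through copies of [BZ]. A free module thus enters as several copies of the rank one
    module, to be peeled off one by one. *)
Theorem lift_idempotent_mx n k n' l n'' l'' (BX : 'M[Q]_(n, k)) (BZ : 'M[Q]_(n', l))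
    (BZ' : 'M[Q]_(n'', l'')) (E : 'M_k) (G : 'M_(k, l'')) (H : 'M_(l'', k)) :
  row_full BX -> row_full BZ ->
  lattice_hom (image f) BX BX E -> lattice_hom (image f) BX BZ' G ->
  lattice_hom (image f) BZ' BX H -> E - E *m E = G *m H ->
  factors_on (L BZ) (fun _ => True) (fun z : L BZ' => z) ->
  exists b (eps : 'M[Q]_(tower_dim k l b)),
  [/\ eps *m eps = eps, lattice_hom (image f) (tower BX BZ b) (tower BX BZ b) eps &
      tower_corner eps = E].
Proof.
move=> fX fZ hE hG hH eE idZ'.
have lE := lattice_fun_linear hE; have lG := lattice_fun_linear hG.
have lH := lattice_fun_linear hH.
have [|||T [Y [c [d [p [[lc ld] hc lp hp [s0 [ls0 es0]]]]]]]] := lift_idempotent _ _ lE lG lH.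
- exact: (lattice_module_fg f).
- apply: Hadd; first by apply: prod_fg_module; apply: (lattice_module_fg f).
  by apply: prod_torsion_free; apply: lattice_module_torsion_free.
- move=> x; apply: val_inj.
  have e (v : 'rV[Q]_k) : v *m E - v *m E *m E = v *m G *m H.
    by rewrite -!mulmxA -mulmxBr eE.
  exact: e.
have [s [ls es]] : factors_on (L BZ) Y (fun y => y - c (d y)).
  have hq : factors_on (L BZ) Y (fun y => \sum_(q <- s0) q.1 (q.2 y)).
    elim: s0 ls0 {es0} => [|q s0 IH] ls0.
      by apply: eq_factors_on (factors_on0 _ T Y) => y _; rewrite big_nil.
    have [l1 l2] := ls0 q (or_introl erefl).
    have h1 : factors_on (L BZ) Y (fun y => q.1 (q.2 y)).
      by apply: (factors_on_compl l1); apply: (factors_on_compr l2 _ idZ').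
    have [r rs|] := IH _; first by apply: ls0; right.
    move=> s hs; have := factors_onD h1 (ex_intro _ s hs).
    by apply: eq_factors_on => y _; rewrite big_cons.
  by apply: eq_factors_on hq => y Yy; rewrite es0.
pose s' := [seq (p \o q.1, q.2) | q <- s].
have [||b [g [h [[lg lh] hg hx hy hph]]]] := @tower_maps _ _ _ _ BX BZ T c d p lc ld lp _ s'.
- by move=> x; have [Yc _] := hc x; have [_ /(_ Yc)] := hp (c x).
- move=> q /List.in_map_iff[r [<- rs]]; have [l1 l2] := ls r rs; split=> //=.
    exact: linmap_comp lp l1.
  by move=> z; have [Yp _] := hp (r.1 z); have [_ /(_ Yp)] := hp (p (r.1 z)).
have Yh w : Y (h w) by rewrite -hph; case: (hp (h w)).
have hgY y : Y y -> h (g y) = y.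
  move=> Yy; rewrite hg big_map.
  have -> : \sum_(q <- s) p (q.1 (q.2 y)) = p (y - c (d y)).
    by rewrite es // (linmap_sum _ _ lp).
  rewrite (linmapB _ _ lp).
  have [_ ->] // := hp y; have [Yc _] := hc (d y).
  by have [_ ->] // := hp (c (d y)); rewrite addrC subrK.
(* On [Y] the map [g] followed by [h] is the identity, so [h] followed by [g] is idempotent on the
   tower; its X-corner is [c] followed by [d], which is [E]. *)
have [eps [heps veps]] := lattice_linear_mx f_inj f_frac (linmap_comp lg lh).
have {}veps w : val (g (h w)) = (val w : 'rV_(tower_dim k l b)) *m eps := veps w.
have sI := image_subring f.
exists b, eps; split=> //.
- apply: (lattice_id_ext sI (tower_row_full b fX fZ)) => v Bv.
  pose w : L (tower BX BZ b) := to_submodule (lattice_submodule f _) Bv.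
  by rewrite mulmxA -[v]/(val w) -!veps hgY.
- apply: (lattice_id_ext sI fX) => v Bv.
  pose x : L BX := to_submodule (lattice_submodule f _) Bv.
  have [w [e1 e2]] := hx x; have [_ e3] := hc x.
  rewrite /tower_corner !mulmxA -[v]/(val x) -e1 -veps hy /= e2 e3.
  exact: lattice_funE.
Qed.

End LiftMatrix.

(** * Peeling off copies of a module with local endomorphism ring *)

Lemma rank_schur (Q : fieldType) l N (d y : 'M[Q]_l) (v : 'M_(l, N)) (u : 'M_(N, l)) (e : 'M_N) :
  d *m y = 1%:M -> y *m d = 1%:M ->
  \rank (block_mx d v u e) = (l + \rank (e - u *m y *m v)%R)%N.
Proof.
move=> dy yd.
have e1 : block_mx 1%:M 0 (u *m y) 1%:M *m block_mx d 0 0 (e - u *m y *m v) *m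
    block_mx 1%:M (y *m v) 0 1%:M = block_mx d v u e.
  rewrite !mulmx_block !mul1mx !mulmx1 !mul0mx !mulmx0 !addr0 !add0r.
  by rewrite -[u *m y *m d]mulmxA yd mulmx1 [d *m _]mulmxA dy mul1mx [u *m _]mulmxA addrC subrK.
have ud : d \in unitmx by have [] := mulmx1_unit dy.
rewrite -e1 mxrankMfree; last first.
  by rewrite row_free_unit unitmxE det_ublock !det1 mulr1 unitr1.
rewrite (eqmxMfull _ _); last first.
  by rewrite row_full_unit unitmxE det_lblock !det1 mulr1 unitr1.
by rewrite rank_diag_block_mx mxrank_unit.
Qed.

Lemma rank_idempotent_compl (Q : fieldType) N (e : 'M[Q]_N) : e *m e = e ->
  \rank (1%:M - e) = (N - \rank e)%N.
Proof.
move=> ee; rewrite -mxrank_ker; apply/eqP; rewrite eqn_leq !mxrankS //.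
  rewrite -[kermx e]mulmx1 -[X in _ *m X](subrK e) mulmxDr mulmx_ker addr0.
  exact: submxMl.
by apply/sub_kermxP; rewrite mulmxBl mul1mx ee subrr.
Qed.

Section IdempotentSchur.
Variables (Q : fieldType) (l N : nat) (d y : 'M[Q]_l) (v : 'M[Q]_(l, N)) (u : 'M[Q]_(N, l)) (e : 'M[Q]_N).
Hypothesis idem : block_mx d v u e *m block_mx d v u e = block_mx d v u e.

Let eqs : [/\ d *m d + v *m u = d, d *m v + v *m e = v,
  u *m d + e *m u = u & u *m v + e *m e = e].
Proof. by move: idem; rewrite mulmx_block => /eq_block_mx[]. Qed.

(** With [A = u y v], the block equations make [e A], [A e] and [A A] all equal to [A - u v], while
    [e e + u v = e]. *)
Lemma idempotent_schur : d *m y = 1%:M -> y *m d = 1%:M ->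
  (e - u *m y *m v) *m (e - u *m y *m v) = e - u *m y *m v.
Proof.
case: eqs => edd evd eud eee dy yd.
set A := u *m y *m v; set U := u *m v.
have E1 : e *m A = A - U.
  rewrite /A !mulmxA; have -> : e *m u = u - u *m d by rewrite -[X in X - _]eud addrAC subrr add0r.
  by rewrite !mulmxBl -[u *m d *m y]mulmxA dy mulmx1.
have E2 : A *m e = A - U.
  rewrite /A -mulmxA; have -> : v *m e = v - d *m v by rewrite -[X in X - _]evd addrAC subrr add0r.
  by rewrite mulmxBr mulmxA -[u *m y *m d]mulmxA yd mulmx1.
have E3 : A *m A = A - U.
  have -> : A *m A = u *m y *m (v *m u) *m y *m v by rewrite /A !mulmxA.
  have -> : v *m u = d - d *m d by rewrite -[X in X - _]edd addrAC subrr add0r.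
  rewrite mulmxBr !mulmxBl !mulmxA -[u *m y *m d]mulmxA yd mulmx1.
  by rewrite -[u *m d *m y]mulmxA dy mulmx1.
rewrite mulmxBl !mulmxBr E1 E2 E3 subrr subr0.
by rewrite -[X in _ = X - _]eee opprB addrA [e *m e + _]addrC.
Qed.

(** Apply the preceding case to the complementary idempotent: the Schur complement of its block
    [1 - d] is [1 - (e + u y v)]. *)
Lemma idempotent_schur_compl : (1%:M - d) *m y = 1%:M -> y *m (1%:M - d) = 1%:M ->
  (e + u *m y *m v) *m (e + u *m y *m v) = e + u *m y *m v.
Proof.
case: eqs => edd evd eud eee dy yd.
set A := u *m y *m v; set U := u *m v.
have E1 : e *m A = U.
  rewrite /A !mulmxA; have -> : e *m u = u *m (1%:M - d).
    by rewrite mulmxBr mulmx1 -[X in X - _]eud addrAC subrr add0r.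
  by rewrite -[u *m _ *m y]mulmxA dy mulmx1.
have E2 : A *m e = U.
  rewrite /A -mulmxA; have -> : v *m e = (1%:M - d) *m v.
    by rewrite mulmxBl mul1mx -[X in X - _]evd addrAC subrr add0r.
  by rewrite mulmxA -[u *m y *m _]mulmxA yd mulmx1.
have E3 : A *m A = A - U.
  have -> : A *m A = u *m y *m (v *m u) *m y *m v by rewrite /A !mulmxA.
  have -> : v *m u = d *m (1%:M - d).
    by rewrite mulmxBr mulmx1 -[X in X - _]edd addrAC subrr add0r.
  rewrite !mulmxA -[_ *m (1%:M - d) *m y]mulmxA dy mulmx1.
  have -> : u *m y *m d = u *m (y - 1%:M).
    by rewrite -mulmxA; congr (_ *m _); rewrite -yd mulmxBr mulmx1 subKr.
  by rewrite mulmxBr mulmx1 mulmxBl.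
rewrite mulmxDl !mulmxDr E1 E2 E3 -[X in _ = X + _]eee.
by rewrite [U + (A - U)]addrC subrK [e *m e + U]addrC.
Qed.

End IdempotentSchur.

Section Peel.
Variables (Q : fieldType) (A : Q -> Prop).
Hypothesis sA : is_subring A.

Definition lattice_unit n k (B : 'M[Q]_(n, k)) (F : 'M[Q]_k) : Prop :=
  exists G, [/\ lattice_hom A B B G, F *m G = 1%:M & G *m F = 1%:M].

Definition local_lattice n k (B : 'M[Q]_(n, k)) : Prop :=
  forall F, lattice_hom A B B F -> lattice_unit B F \/ lattice_unit B (1%:M - F).

(** The trace ideal of [Z] in the endomorphism ring of X. *)
Definition trace_through n k n' l (BX : 'M[Q]_(n, k)) (BZ : 'M[Q]_(n', l)) (F : 'M[Q]_k) : Prop :=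
  exists s : seq ('M[Q]_(k, l) * 'M[Q]_(l, k)),
    (forall p, p \in s -> lattice_hom A BX BZ p.1 /\ lattice_hom A BZ BX p.2) /\
    F = \sum_(p <- s) p.1 *m p.2.

Variables (n k n' l : nat) (BX : 'M[Q]_(n, k)) (BZ : 'M[Q]_(n', l)).

Lemma trace_through0 : trace_through BX BZ 0.
Proof. by exists [::]; rewrite big_nil. Qed.

Lemma trace_throughD F G :
  trace_through BX BZ F -> trace_through BX BZ G -> trace_through BX BZ (F + G).
Proof.
case=> s [hs ->] [t [ht ->]]; exists (s ++ t); rewrite big_cat; split=> // p.
by rewrite mem_cat => /orP[/hs|/ht].
Qed.

Lemma trace_through1 G H :
  lattice_hom A BX BZ G -> lattice_hom A BZ BX H -> trace_through BX BZ (G *m H).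
Proof.
move=> hG hH; exists [:: (G, H)]; rewrite big_seq1; split=> // p.
by rewrite inE => /eqP->.
Qed.

Lemma tower_in_hom b : lattice_hom A BX (tower BX BZ b) (tower_in Q k l b).
Proof.
elim: b => [|b IH] v Bv /=; first by rewrite mulmx1.
rewrite mul_mx_row mulmx0; apply: lattice_block; last exact: IH.
exact: lattice0.
Qed.

Lemma tower_out_hom b : lattice_hom A (tower BX BZ b) BX (tower_out Q k l b).
Proof.
elim: b => [|b IH] v Bv /=; first by rewrite mulmx1.
rewrite -[v]hsubmxK mul_row_col mulmx0 add0r; apply: IH.
exact: lattice_rsub Bv.
Qed.

(** At a copy of [Z] the diagonal block [d] or [1 - d] is invertible. The matching Schur complement
    is an idempotent with one copy of [Z] fewer; its corner changes by a map through [Z], and its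
    rank drops by [l] or not at all. *)
Lemma peel b (eps : 'M[Q]_(tower_dim k l b)) : local_lattice BZ ->
  eps *m eps = eps -> lattice_hom A (tower BX BZ b) (tower BX BZ b) eps ->
  exists e j, [/\ e *m e = e, lattice_hom A BX BX e,
    trace_through BX BZ (e - tower_corner eps) & \rank eps = (\rank e + j * l)%N].
Proof.
move=> locZ; elim: b eps => [|b IH] eps idem heps.
  exists eps, 0%N; rewrite addn0; split=> //.
  by rewrite /tower_corner /= mul1mx mulmx1 subrr; apply: trace_through0.
pose N := tower_dim k l b; pose B := tower BX BZ b.
pose d : 'M_l := ulsubmx (eps : 'M_(l + N)).
pose v : 'M_(l, N) := ursubmx (eps : 'M_(l + N)).
pose u : 'M_(N, l) := dlsubmx (eps : 'M_(l + N)).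
pose e : 'M_N := drsubmx (eps : 'M_(l + N)).
have Eb : eps = block_mx d v u e :> 'M_(l + N) by rewrite submxK.
have topE w : lattice A BZ w -> lattice A (tower BX BZ b.+1) (row_mx (w *m d) (w *m v)).
  move=> Bw; have := heps _ (lattice_block Bw (lattice0 sA B)).
  by rewrite Eb mul_row_block !mul0mx !addr0.
have botE w : lattice A B w -> lattice A (tower BX BZ b.+1) (row_mx (w *m u) (w *m e)).
  move=> Bw; have := heps _ (lattice_block (lattice0 sA BZ) Bw).
  by rewrite Eb mul_row_block !mul0mx !add0r.
have hd : lattice_hom A BZ BZ d.
  by move=> w /topE /lattice_lsub; rewrite row_mxKl.
have hv : lattice_hom A BZ B v.
  by move=> w /topE /lattice_rsub; rewrite row_mxKr.
have hu : lattice_hom A B BZ u.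
  by move=> w /botE /lattice_lsub; rewrite row_mxKl.
have he : lattice_hom A B B e.
  by move=> w /botE /lattice_rsub; rewrite row_mxKr.
have idem' : block_mx d v u e *m block_mx d v u e = block_mx d v u e by rewrite -Eb.
have cornerE (y : 'M_l) :
    tower_in Q k l b *m (u *m y *m v) *m tower_out Q k l b =
    (tower_in Q k l b *m u) *m (y *m v *m tower_out Q k l b) by rewrite !mulmxA.
have trE y : lattice_hom A BZ BZ y ->
    trace_through BX BZ ((tower_in Q k l b *m u) *m (y *m v *m tower_out Q k l b)).
  move=> hy; apply: trace_through1; first exact: lattice_homM (tower_in_hom b) hu.
  exact: lattice_homM (lattice_homM hy hv) (@tower_out_hom b).
have huyv y : lattice_hom A BZ BZ y -> lattice_hom A B B (u *m y *m v).
  by move=> hy; apply: lattice_homM hv; apply: lattice_homM hu hy.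
case: (locZ d hd) => -[y [hy dy yd]].
  have [||e0 [j [h1 h2 h3 h4]]] := IH (e - u *m y *m v).
  - exact: idempotent_schur idem' dy yd.
  - by apply: lattice_homB => //; apply: huyv.
  exists e0, j.+1; split=> //.
    rewrite tower_cornerS -/e -(subrKA (tower_corner (e - u *m y *m v))).
    apply: trace_throughD => //.
    rewrite /tower_corner mulmxBr mulmxBl addrAC subrr add0r cornerE.
    by rewrite -mulNmx -mulmxN; apply: trace_through1;
      [apply: lattice_homM (tower_in_hom b) (lattice_homN sA hu) |
       exact: lattice_homM (lattice_homM hy hv) (@tower_out_hom b)].
  by rewrite {1}Eb (rank_schur _ _ _ dy yd) h4 mulSn addnCA.
have [||e0 [j [h1 h2 h3 h4]]] := IH (e + u *m y *m v).
- exact: idempotent_schur_compl idem' dy yd.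
- by apply: lattice_homD => //; apply: huyv.
exists e0, j; split=> //.
  rewrite tower_cornerS -/e -(subrKA (tower_corner (e + u *m y *m v))).
  apply: trace_throughD => //.
  by rewrite /tower_corner mulmxDr mulmxDl addrAC subrr add0r cornerE; apply: trE.
(* When [1 - d] is inverted it is the rank of the complementary idempotent that drops by [l],
   exactly as the dimension does; so the rank itself is unchanged. *)
rewrite -h4; have r1 := rank_idempotent_compl idem.
have r2 := rank_idempotent_compl (idempotent_schur_compl idem' dy yd).
have r3 : \rank (1%:M - eps) = (l + \rank (1%:M - (e + u *m y *m v))%R)%N.
  rewrite {1}Eb [1%:M](scalar_mx_block l N) opp_block_mx add_block_mx !add0r.
  by rewrite (rank_schur _ _ _ dy yd) !mulNmx mulmxN opprK opprD addrA.
move: r3; rewrite r1 r2.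
have := rank_leq_row eps; have := rank_leq_row (e + u *m y *m v).
rewrite /= -/N; move: (\rank eps) (\rank _) => a c h5 h6 h7.
apply/eqP; rewrite -(eqn_add2r (l + (N - c))) -{1}h7 subnKC // addnCA subnKC //.
Qed.

End Peel.

(** * Integrality and localization *)

Section Integrality.
Variables (R : idomainType) (Q : fieldType) (f : {rmorphism R -> Q}).
Hypothesis f_inj : injective f.
Hypothesis f_frac : forall q : Q, exists a b : R, f b != 0 /\ q = f a / f b.

Lemma integral_overS (A A' : Q -> Prop) x :
  (forall y, A y -> A' y) -> integral_over A x -> integral_over A' x.
Proof. by move=> AA' [p [pm [pA px]]]; exists p; split=> //; split=> // i; apply: AA'. Qed.

Lemma integral_over_mem (A : Q -> Prop) x : is_subring A -> A x -> integral_over A x.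
Proof.
move=> sA Ax; exists ('X - x%:P); split; first exact: monicXsubC.
split; last by rewrite root_XsubC.
move=> i; rewrite coefB coefX coefC; apply: subringB => //.
  by case: (i == 1)%N; [apply: subring1 | apply: subring0].
by case: (i == 0)%N => //; apply: subring0.
Qed.

Lemma integral_overP x : integral_over (image f) x <-> integralOver f x.
Proof.
split=> [[p [pm [pA px]]]|[p pm px]]; last first.
  exists (map_poly f p); split; first by rewrite monic_map.
  by split=> // i; rewrite coef_map; exists p`_i.
pose c i := projT1 (cid (pA i)); have cE i : p`_i = f (c i) by rewrite /c; case: cid.
have ep : p = map_poly f (\poly_(i < size p) c i).
  apply/polyP => i; rewrite coef_map coef_poly; case: ltnP => ip; first exact: cE.
  by rewrite raddf0 nth_default.
exists (\poly_(i < size p) c i); last by rewrite -ep.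
set P := \poly_(i < _) _ in ep *.
have h : f (lead_coef P) = 1.
  by rewrite -(lead_coef_map_inj f_inj (rmorph0 f)) -ep (monicP pm).
by rewrite monicE; apply/eqP; apply: f_inj; rewrite rmorph1.
Qed.

(** The monic polynomial with coefficients [p_i a^(n-i)] vanishes at [a * x], and each of its lower
    coefficients contains the factor [a * p_i]. *)
Lemma integral_scale (A : Q -> Prop) a x p : is_subring A -> A a ->
  p \is monic -> root p x -> (forall i, A (a * p`_i)) -> integral_over A (a * x).
Proof.
move=> sA Aa pm px hs.
case: (ltnP 1 (size p)) => [sp|]; last first.
  move=> /size1_polyC ep; move: pm px; rewrite ep monicE lead_coefC => /eqP ->.
  by rewrite rootC oner_eq0.
pose n := (size p).-1.
have spn : size p = n.+1 by rewrite prednK // (ltn_trans _ sp).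
pose q := \poly_(i < n.+1) (p`_i * a ^+ (n - i)).
have pn : p`_n = 1 by have := monicP pm; rewrite lead_coefE.
have qn : q`_n = 1 by rewrite coef_poly ltnSn subnn mulr1.
have sq : size q = n.+1.
  by apply: size_poly_eq; rewrite subnn mulr1 pn oner_neq0.
exists q; split; first by rewrite monicE lead_coefE sq /= qn.
split.
  move=> i; rewrite coef_poly; case: ltnP => [|_]; last exact: subring0.
  rewrite ltnS leq_eqVlt => /orP[/eqP->|ltin].
    by rewrite subnn mulr1 pn; apply: subring1.
  rewrite -(subnSK ltin) exprS mulrA [p`_i * _]mulrC; apply: subringM => //.
  exact: subringX.
apply/rootP; rewrite horner_poly.
have := rootP px; rewrite horner_coef spn => h.
transitivity (a ^+ n * (\sum_(i < n.+1) p`_i * x ^+ i)); last by rewrite h mulr0.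
rewrite mulr_sumr; apply: eq_bigr => i _.
have le_in : (i <= n)%N by rewrite -ltnS.
have -> : a ^+ n = a ^+ (n - i) * a ^+ i by rewrite -exprD subnK.
by rewrite exprMn; ring.
Qed.

Section Loc.
Variable m : R -> Prop.
Hypothesis mm : maximal_ideal m.

Lemma loc_subring : is_subring (loc f m).
Proof.
have pm := maximal_prime mm; have n1 := maximal_proper mm.
have f0 s : ~ m s -> f s != 0.
  move=> ms; rewrite frac_neq0 //; apply/eqP => s0; apply: ms; rewrite s0.
  exact: ideal0 (maximal_is_ideal mm).
split; first by exists 0, 1; rewrite rmorph0 mul0r.
split; first by exists 1, 1; rewrite rmorph1 divr1.
split=> [_ _ [a [s [ms ->]]] [b [t [mt ->]]]|_ _ [a [s [ms ->]]] [b [t [mt ->]]]].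
  exists (a * t - b * s), (s * t); split; first exact: primeNM.
  rewrite rmorphB !rmorphM; have := f0 s ms; have := f0 t mt => ft fs.
  by field; rewrite ft fs.
exists (a * b), (s * t); split; first exact: primeNM.
by rewrite !rmorphM mulf_div.
Qed.

Lemma loc_neq0 s : ~ m s -> f s != 0.
Proof.
move=> ms; rewrite frac_neq0 //; apply/eqP => s0; apply: ms; rewrite s0.
exact: ideal0 (maximal_is_ideal mm).
Qed.

Lemma loc_image r : loc f m (f r).
Proof. by exists r, 1; rewrite rmorph1 divr1; split=> //; apply: maximal_proper. Qed.

Lemma loc_inv s : ~ m s -> loc f m (f s)^-1.
Proof. by exists 1, s; rewrite rmorph1 div1r. Qed.

Lemma loc_denominator (T : eqType) (l : seq T) (q : T -> Q) :
  (forall i, i \in l -> loc f m (q i)) ->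
  exists s, ~ m s /\ forall i, i \in l -> image f (f s * q i).
Proof.
have pm := maximal_prime mm.
elim: l => [|i l IH] h; first by exists 1; split=> //; apply: maximal_proper.
have [j jl|s [ms hs]] := IH; first by apply: h; rewrite inE jl orbT.
have [a [t [mt e]]] := h i (mem_head _ _).
exists (s * t); split; first exact: primeNM.
move=> j; rewrite inE => /orP[/eqP->|/hs[c hc]].
  by exists (s * a); rewrite e !rmorphM -mulrA [f a / _]mulrC mulVKf ?loc_neq0.
by exists (t * c); rewrite !rmorphM mulrAC hc mulrC.
Qed.

Lemma integral_loc_scale x : integral_over (loc f m) x ->
  exists s, ~ m s /\ integral_over (image f) (f s * x).
Proof.
case=> p [pm [pA px]].
have [i _|s [ms hs]] := @loc_denominator nat (iota 0 (size p)) (fun i => p`_i).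
  exact: pA.
have sI := image_subring f.
exists s; split=> //; apply: (integral_scale sI _ pm px) => [|i]; first by exists s.
case: (ltnP i (size p)) => ip; first by apply: hs; rewrite mem_iota.
by exists 0; rewrite nth_default // mulr0 rmorph0.
Qed.

(** Multiplying an integral equation of degree n for the inverse of [r] by [r ^+ n] writes 1 as a
    multiple of [r] in R_m. *)
Lemma maximal_nonunit r : m r -> r != 0 -> ~ integral_over (loc f m) (f r)^-1.
Proof.
move=> mr r0 [p [pm [pA px]]]; have sL := loc_subring.
have fr0 : f r != 0 by rewrite frac_neq0.
have [n spn] : exists n, size p = n.+1.
  by exists (size p).-1; rewrite prednK // size_poly_gt0 monic_neq0.
have pn : p`_n = 1 by have := monicP pm; rewrite lead_coefE spn.
have [q [Lq e]] : exists q, loc f m q /\ 1 = f r * q.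
  exists (- \sum_(i < n) p`_i * f r ^+ (n - i.+1)); split.
    apply: subringN => //; apply: subring_sum => // i _; apply: subringM => //.
    by apply: subringX => //; apply: loc_image.
  have := rootP px; rewrite horner_coef spn big_ord_recr /= pn mul1r.
  move/(congr1 (fun z => f r ^+ n * z)); rewrite mulr0 mulrDr exprVn mulfV ?expf_neq0 //.
  move/eqP; rewrite addrC addr_eq0 => /eqP ->; rewrite mulrN; congr (- _).
  rewrite !mulr_sumr; apply: eq_bigr => i _.
  have ltin := ltn_ord i.
  rewrite mulrCA [RHS]mulrCA; congr (_ * _); rewrite -exprS subnSK // exprVn.
  by rewrite -{1}(subnK (ltnW ltin)) exprD mulfK // expf_neq0.
case: Lq => a [s [ms eq]]; apply: (ms).
have -> : s = r * a.
  apply: f_inj; rewrite rmorphM; move: e; rewrite eq mulrA => e.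
  by rewrite -[RHS](divfK (loc_neq0 ms)) -e mul1r.
by apply: idealMr => //; apply: maximal_is_ideal.
Qed.

End Loc.

Definition image_span (ds : seq Q) (z : Q) : Prop :=
  exists c : nat -> R, z = \sum_(i < size ds) f (c i) * ds`_i.

Lemma image_span_mem ds d : d \in ds -> image_span ds d.
Proof.
move=> dds; exists (fun i => (i == index d ds)%:R).
have lt : (index d ds < size ds)%N by rewrite index_mem.
rewrite (bigD1 (Ordinal lt)) //= eqxx rmorph1 mul1r nth_index // big1 ?addr0 // => i.
by rewrite -val_eqE /= => /negbTE ->; rewrite rmorph0 mul0r.
Qed.

Lemma image_span0 ds : image_span ds 0.
Proof. by exists (fun _ => 0); rewrite big1 // => i _; rewrite rmorph0 mul0r. Qed.

Lemma image_spanD ds x y : image_span ds x -> image_span ds y -> image_span ds (x + y).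
Proof.
move=> [c ->] [d ->]; exists (fun i => c i + d i); rewrite -big_split.
by apply: eq_bigr => i _; rewrite rmorphD mulrDl.
Qed.

Lemma image_spanZ ds r x : image_span ds x -> image_span ds (f r * x).
Proof.
move=> [c ->]; exists (fun i => r * c i); rewrite mulr_sumr.
by apply: eq_bigr => i _; rewrite rmorphM mulrA.
Qed.

Lemma image_span_ind ds (J : Q -> Prop) : J 0 -> (forall x y, J x -> J y -> J (x + y)) ->
  (forall r d, d \in ds -> J (f r * d)) -> forall z, image_span ds z -> J z.
Proof.
move=> J0 JD Jd z [c ->]; elim/big_ind: _ => // i _.
by apply: Jd; apply: mem_nth.
Qed.

(** [ds] consists of products of powers of the [t] below the degrees of their equations, and spans
    the ring that they generate over [R]. *)
Lemma integral_order (ts : seq Q) : (forall t, t \in ts -> integralOver f t) ->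
  exists ds : seq Q, [/\ 1 \in ds,
    forall A, is_subring A -> (forall r, A (f r)) -> (forall t, t \in ts -> A t) ->
      forall d, d \in ds -> A d &
    forall t d, t \in ts -> d \in ds -> image_span ds (t * d)].
Proof.
elim: ts => [|t ts IH] hts.
  exists [:: 1]; split=> //; first exact: mem_head.
  by move=> A sA _ _ d; rewrite inE => /eqP->; apply: subring1.
have [u uts|ds [ds1 dsA dst]] := IH; first by apply: hts; rewrite inE uts orbT.
have [p pm pt] := hts t (mem_head _ _).
have [n spn] : exists n, size p = n.+1.
  by exists (size p).-1; rewrite prednK // size_poly_gt0 monic_neq0.
have pn : p`_n = 1 by have := monicP pm; rewrite lead_coefE spn.
have tn : t ^+ n = - \sum_(i < n) f p`_i * t ^+ i.
  have := rootP pt; rewrite horner_coef (size_map_inj_poly f_inj (rmorph0 f)) spn.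
  rewrite big_ord_recr /= coef_map /= pn rmorph1 mul1r => /eqP.
  rewrite addrC addr_eq0 => /eqP ->; congr (- _).
  by apply: eq_bigr => i _; rewrite coef_map.
have n0 : (0 < n)%N.
  case: (n) tn => // /eqP; rewrite expr0 big_ord0 oppr0 oner_eq0 //.
pose es := [seq t ^+ k * d | k <- iota 0 n, d <- ds].
have esE k d : (k < n)%N -> d \in ds -> t ^+ k * d \in es.
  by move=> kn dds; apply/allpairsP; exists (k, d); rewrite mem_iota.
have span_es k z : (k < n)%N -> image_span ds z -> image_span es (t ^+ k * z).
  move=> kn; move: z; apply: image_span_ind.
  - by rewrite mulr0; apply: image_span0.
  - by move=> x y hx hy; rewrite mulrDr; apply: image_spanD.
  - by move=> r d dds; rewrite mulrCA; apply/image_spanZ/image_span_mem/esE.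
exists es; split.
- by rewrite -[1]mulr1 -{1}(expr0 t); apply: esE.
- move=> A sA fA tA d /allpairsP[[k e] /= [_ eds ->]].
  have At u : u \in ts -> A u by move=> uts; apply: tA; rewrite inE uts orbT.
  apply: subringM => //; last exact: dsA eds.
  by apply: subringX => //; apply: tA; rewrite mem_head.
- move=> u d uts /allpairsP[[k e] /= [kn eds ->]].
  have {}kn : (k < n)%N by move: kn; rewrite mem_iota.
  move: uts; rewrite inE => /orP[/eqP->|uts]; last first.
    by rewrite mulrCA; apply: span_es => //; apply: dst.
  rewrite mulrA -exprS; move: kn; rewrite leq_eqVlt => /orP[/eqP ->|kn].
    rewrite tn mulNr -mulN1r -(rmorph1 f) -rmorphN; apply: image_spanZ.
    rewrite mulr_suml; elim/big_ind: _ => [|x y hx hy|i _]; first exact: image_span0.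
      exact: image_spanD.
    by rewrite -mulrA; apply/image_spanZ/image_span_mem/esE.
  exact/image_span_mem/esE.
Qed.

End Integrality.

(** * Local subrings of a field and radical endomorphisms *)

Section LocalSubring.
Variables (Q : fieldType) (L : Q -> Prop).
Hypothesis sL : is_subring L.

Definition unit_in (x : Q) : Prop := x != 0 /\ L x^-1.
Definition local_subring : Prop := forall x, L x -> unit_in x \/ unit_in (1 - x).
Definition nonunit (x : Q) : Prop := L x /\ ~ unit_in x.

Lemma nonunitMl a x : L a -> nonunit x -> nonunit (a * x).
Proof.
move=> La [Lx nx]; split; first exact: subringM.
case=> ax0 h; apply: nx; have /norP[a0 x0] : ~~ ((a == 0) || (x == 0)) by rewrite -mulf_eq0.
split=> //; have -> : x^-1 = a * (a * x)^-1 by rewrite invfM mulrA mulfV // mul1r.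
exact: subringM.
Qed.

Lemma nonunitMr a x : L a -> nonunit x -> nonunit (x * a).
Proof. by rewrite mulrC; apply: nonunitMl. Qed.

Lemma nonunit0 : nonunit 0.
Proof. by split; [apply: subring0 | case; rewrite eqxx]. Qed.

Lemma nonunitN x : nonunit x -> nonunit (- x).
Proof.
by move=> nx; rewrite -mulN1r; apply: nonunitMl => //; apply: subringN sL (subring1 sL).
Qed.

Lemma nonunit1 : ~ nonunit 1.
Proof. by case=> _; apply; split; rewrite ?oner_neq0 // invr1; apply: subring1. Qed.

Hypothesis locL : local_subring.

Lemma nonunitD x y : nonunit x -> nonunit y -> nonunit (x + y).
Proof.
move=> nx ny; split; first by apply: subringD; [|case: nx|case: ny].
case=> z0 Lz; have h u : nonunit u -> ~ unit_in (u / (x + y)).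
  by move=> nu; have [] := nonunitMr Lz nu.
have [|/(h x nx) //|] := locL (x := x / (x + y)).
  by apply: subringM => //; case: nx.
have -> : 1 - x / (x + y) = y / (x + y) by rewrite -{1}(divff z0) -mulrBl addrAC subrr add0r.
exact: h.
Qed.

Lemma nonunit_sum (T : Type) (s : seq T) (P : pred T) F :
  (forall i, P i -> nonunit (F i)) -> nonunit (\sum_(i <- s | P i) F i).
Proof.
move=> h; elim/big_ind: _ => [|x y|i Pi]; [exact: nonunit0 | exact: nonunitD | exact: h].
Qed.

Lemma unit_in1B x : nonunit x -> unit_in (1 - x).
Proof. by case=> Lx nx; case: (locL Lx). Qed.

(** In the Leibniz formula every permutation but the identity contributes an off-diagonal, hence
    nonunit, factor; the identity contributes a product of elements that are 1 modulo nonunits. *)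
Lemma unit_det1B n (T : 'M[Q]_n) : mx_over nonunit T -> unit_in (\det (1%:M - T)).
Proof.
move=> hT; rewrite -[\det _](subKr 1); apply: unit_in1B.
have LT i j : L ((1%:M - T) i j).
  by apply: mx_overB => //; [apply: mx_over_scalar sL (subring1 sL) | move=> k l; case: (hT k l)].
rewrite /determinant (bigD1 1%g) //= odd_perm1 expr0 mul1r opprD addrA.
apply: nonunitD; last first.
  apply/nonunitN/nonunit_sum => s s1; apply: nonunitMl.
    by apply: subringX sL _; apply: subringN sL (subring1 sL).
  have [i si] : exists i, s i != i.
    apply/existsP; rewrite -negb_forall; apply: contra s1 => /forallP h.
    by apply/eqP/permP => i; rewrite perm1; apply/eqP.
  rewrite (bigD1 i) //=; apply: nonunitMr; first by apply: subring_prod.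
  by rewrite !mxE eq_sym (negbTE si) sub0r; apply/nonunitN/hT.
suff [] : L (\prod_i (1%:M - T) i ((1%g : 'S_n) i)) /\ nonunit (1 - \prod_i (1%:M - T) i ((1%g : 'S_n) i)) by [].
elim/big_ind: _ => [|x y [Lx nx] [Ly ny]|i _].
- by split; [apply: subring1 | rewrite subrr; apply: nonunit0].
- split; first exact: subringM.
  have -> : 1 - x * y = (1 - x) + x * (1 - y) by ring.
  by apply: nonunitD => //; apply: nonunitMl.
- split=> //; rewrite perm1 !mxE eqxx subKr; exact: hT.
Qed.

(** [F] maps the lattice into nonunit multiples of itself. The rows of [B] may be dependent, so [T]
    is one among several matrices that describe [F] on them. *)
Definition radical_endo n k (B : 'M[Q]_(n, k)) (F : 'M[Q]_k) : Prop :=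
  exists T, mx_over nonunit T /\ B *m F = T *m B.

Lemma radical_endoD n k (B : 'M[Q]_(n, k)) F G :
  radical_endo B F -> radical_endo B G -> radical_endo B (F + G).
Proof.
move=> [T [hT eT]] [U [hU eU]]; exists (T + U); rewrite mulmxDr mulmxDl eT eU.
by split=> // i j; rewrite mxE; apply: nonunitD.
Qed.

Lemma mx_over_nonunitM m n p (T : 'M[Q]_(m, n)) (U : 'M[Q]_(n, p)) :
  mx_over nonunit T -> mx_over L U -> mx_over nonunit (T *m U).
Proof. by move=> hT hU i j; rewrite mxE; apply: nonunit_sum => l _; apply: nonunitMr. Qed.

Lemma mx_over_nonunitMl m n p (T : 'M[Q]_(m, n)) (U : 'M[Q]_(n, p)) :
  mx_over L T -> mx_over nonunit U -> mx_over nonunit (T *m U).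
Proof. by move=> hT hU i j; rewrite mxE; apply: nonunit_sum => l _; apply: nonunitMl. Qed.

Lemma radical_endoMr n k (B : 'M[Q]_(n, k)) F G :
  radical_endo B F -> lattice_hom L B B G -> radical_endo B (F *m G).
Proof.
move=> [T [hT eT]] /(lattice_homP sL)[U [hU eU]]; exists (T *m U).
by split; [apply: mx_over_nonunitM | rewrite mulmxA eT -[LHS]mulmxA eU mulmxA].
Qed.

Lemma radical_endoZ n k (B : 'M[Q]_(n, k)) a G :
  nonunit a -> lattice_hom L B B G -> radical_endo B (a *: G).
Proof.
move=> na /(lattice_homP sL)[U [hU eU]]; exists (a *: U).
split; last by rewrite -scalemxAr eU scalemxAl.
by move=> i j; rewrite mxE; apply: nonunitMr.
Qed.

(** Nakayama's lemma in matrix form: [1 - F] acts on the generators by [1 - T], whose determinant is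
    a unit. *)
Lemma radical_endo_unit n k (B : 'M[Q]_(n, k)) F : row_full B ->
  radical_endo B F -> lattice_unit L B (1%:M - F).
Proof.
move=> fB [T [hT eT]]; have LT : mx_over L T by move=> i j; case: (hT i j).
have [d0 Ld] := unit_det1B hT.
set U := 1%:M - T in d0 Ld.
have eU : B *m (1%:M - F) = U *m B by rewrite mulmxBr mulmx1 eT mulmxBl mul1mx.
have LU : mx_over L U by apply: mx_overB => //; apply: mx_over_scalar sL (subring1 sL).
have uU : U \in unitmx by rewrite unitmxE unitfE.
have uF : 1%:M - F \in unitmx.
  rewrite -row_full_unit -col_leq_rank -{1}(eqP fB).
  have : (\rank (U *m B)%R <= \rank (1%:M - F)%R)%N by rewrite -eU; apply: mxrankM_maxr.
  by rewrite (eqmxMfull _ _) // row_full_unit.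
exists (invmx (1%:M - F)); split; [|exact: mulmxV|exact: mulVmx].
apply/(lattice_homP sL); exists (invmx U); split.
  by rewrite /invmx uU; apply: mx_overZ => //; apply: mx_over_adj.
by apply: (canRL (mulKmx uU)); rewrite mulmxA -eU mulmxK.
Qed.

End LocalSubring.

(** * Lattices with only trivial idempotents have local endomorphism rings *)

Section LatticeRows.
Variables (Q : fieldType) (A : Q -> Prop).
Hypothesis sA : is_subring A.

Lemma lattice_sum n k (B : 'M[Q]_(n, k)) (T : Type) (s : seq T) (P : pred T) F :
  (forall i, P i -> lattice A B (F i)) -> lattice A B (\sum_(i <- s | P i) F i).
Proof.
move=> h; elim/big_ind: _ => [|x y|i Pi]; [exact: lattice0 | exact: latticeD | exact: h].
Qed.

Lemma lattice_hom_rows n k n' k' (B : 'M[Q]_(n, k)) (B' : 'M[Q]_(n', k')) F :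
  (forall i, lattice A B' (row i B *m F)) -> lattice_hom A B B' F.
Proof.
move=> h v [c [Ac ->]]; rewrite -mulmxA mulmx_sum_row; apply: lattice_sum => i _.
by rewrite row_mul; apply: latticeZ.
Qed.

End LatticeRows.

Section CoreTheorem.
Variables (R : idomainType) (Q : fieldType) (f : {rmorphism R -> Q}).
Hypothesis f_inj : injective f.
Hypothesis f_frac : forall q : Q, exists a b : R, f b != 0 /\ q = f a / f b.
Hypothesis Rfc : sr_finite_character (fun _ : R => True).
Hypothesis Rdim : sr_krull_dim (fun _ : R => True) 1.
Hypothesis Hadd : forall X : lmodType R, fg_module X -> torsion_free X ->
  forall N : lmodType R, in_Add X N -> dsum_of_fg N.
Variable m : R -> Prop.
Hypothesis mm : maximal_ideal m.

(** The chain of length one provides a nonzero nonunit [x]. If [x] is outside [m], some [1 - b * x]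
    lies in [m], and it is nonzero because [x] is no unit. *)
Lemma maximal_nonzero : exists r, m r /\ r != 0.
Proof.
have [[c [pc hc]] _] := Rdim.
have [_ [x [c1x nc0x]]] := hc 0%N isT.
have x0 : x != 0.
  by apply/eqP => x0; apply: nc0x; rewrite x0; apply: ideal0; apply: prime_is_ideal; apply: pc.
case: (pselect (m x)) => mx; first by exists x.
have [b mb] := maximal_inv mm mx; exists (1 - b * x); split=> //.
apply/eqP => /eqP; rewrite subr_eq0 => /eqP e.
have p1 := pc 1%N isT; apply: (prime_proper p1); rewrite e.
by apply: idealMl => //; apply: prime_is_ideal.
Qed.

Variable L : Q -> Prop.
Hypothesis sL : is_subring L.
Hypothesis locL_sub : forall q, loc f m q -> L q.
Hypothesis L_integral : forall q, L q -> integral_over (loc f m) q.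

Lemma L_f r : L (f r).
Proof. by apply: locL_sub; apply: loc_image. Qed.

Lemma L_unit s : ~ m s -> unit_in L (f s).
Proof.
by move=> ms; split; [apply: loc_neq0 ms | apply/locL_sub/loc_inv].
Qed.

Lemma nonunit_f r : m r -> nonunit L (f r).
Proof.
move=> mr; split; first exact: L_f.
by case=> fr0 /L_integral; apply: maximal_nonunit; rewrite // -(frac_neq0 f_inj).
Qed.

Lemma integral_common_scale (l : seq Q) : (forall x, x \in l -> L x) ->
  exists c, ~ m c /\ forall x, x \in l -> integralOver f (f c * x).
Proof.
elim: l => [|x l IH] hl; first by exists 1; split=> //; apply: maximal_proper.
have [y yl|c [mc hc]] := IH; first by apply: hl; rewrite inE yl orbT.
have [s [ms /(integral_overP f_inj) hs]] := integral_loc_scale f_inj mm (L_integral (hl x (mem_head _ _))).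
exists (c * s); split; first exact: primeNM (maximal_prime mm) mc ms.
move=> y; rewrite inE rmorphM => /orP[/eqP->|/hc hy].
  by rewrite -mulrA; apply: integral_mul => //; apply: integral_id.
by rewrite [f c * _]mulrC -mulrA; apply: integral_mul => //; apply: integral_id.
Qed.

(** The rows of [B] over [R] need not be stable under [F]. After [c] has made the matrix entries of
    [F] integral over [R], the rows are multiplied by a finite spanning set of the ring of these
    entries; over [L] nothing changes. *)
Lemma finite_order_lattice n k (B : 'M[Q]_(n, k)) (F : 'M[Q]_k) : lattice_hom L B B F ->
  exists c N (BX : 'M[Q]_(N.+1, k)), [/\ ~ m c,
    lattice_hom (image f) BX BX (f c *: F) & forall v, lattice L BX v <-> lattice L B v].
Proof.
move=> /(lattice_homP sL)[T [LT eT]].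
have [x /imageP[p _ ->]|c [mc hc]] := @integral_common_scale [seq T p.1 p.2 | p : 'I_n * 'I_n].
  exact: LT.
pose ts := [seq f c * T p.1 p.2 | p : 'I_n * 'I_n].
have [t /imageP[p _ ->]|ds [ds1 dsA dst]] := @integral_order _ _ f f_inj ts.
  by apply: hc; apply: image_f.
have dsL d : d \in ds -> L d.
  apply: dsA => // [r|t /imageP[p _ ->]]; first exact: L_f.
  by apply: subringM => //; apply: L_f.
pose I : finType := ('I_(size ds) * 'I_n)%type.
(* The zero row makes the number of generators a successor, as the ring of square matrices used for
   the characteristic polynomial demands. *)
pose BX := col_mx (0 : 'rV[Q]_k) (\matrix_(x < #|I|) (ds`_(enum_val x).1 *: row (enum_val x).2 B)).
have memX A (sA : is_subring A) d i : d \in ds -> lattice A BX (d *: row i B).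
  move=> dds; have lt : (index d ds < size ds)%N by rewrite index_mem.
  pose x : 'I_#|I| := enum_rank ((Ordinal lt, i) : I).
  have -> : d *: row i B = row (rshift 1 x) BX.
    by rewrite rowKd rowK enum_rankK /= nth_index.
  exact: lattice_row.
have rowX x : row x BX = 0 \/ exists a i, a \in ds /\ row x BX = a *: row i B.
  rewrite -[x](@splitK 1 #|I|); case: (fintype.split _) => y /=.
    by left; rewrite rowKu row0.
  right; rewrite rowKd rowK.
  by exists ds`_(enum_val y).1, (enum_val y).2; rewrite mem_nth.
have sI := image_subring f.
exists c, #|I|, BX; split=> //.
  apply: lattice_hom_rows => // x; case: (rowX x) => [->|[a [i [ads ->]]]].
    by rewrite mul0mx; apply: lattice0.
  rewrite -scalemxAl -scalemxAr -row_mul eT row_mul mulmx_sum_row scaler_sumr scaler_sumr.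
  apply: lattice_sum => // j _; rewrite !scalerA mxE.
  have : image_span f ds (a * (f c * T i j)).
    rewrite mulrC; apply: dst => //.
    by apply/imageP; exists (i, j).
  move: (a * _); apply: (image_span_ind (J := fun z => lattice (image f) BX (z *: row j B))).
  - by rewrite scale0r; apply: (lattice0 sI).
  - by move=> x1 x2 h1 h2; rewrite scalerDl; apply: latticeD.
  - by move=> r d dds; rewrite -scalerA; apply: latticeZ => //; [exists r | apply: memX].
move=> v; split=> Bv.
  rewrite -[v]mulmx1; apply: (@lattice_hom_rows _ _ sL _ _ _ _ BX) Bv => x.
  rewrite mulmx1; case: (rowX x) => [->|[a [i [ads ->]]]]; first exact: lattice0.
  by apply: latticeZ => //; [apply: dsL | apply: lattice_row].
rewrite -[v]mulmx1; apply: (@lattice_hom_rows _ _ sL _ _ _ _ B) Bv => i.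
by rewrite mulmx1 -[row i B]scale1r; apply: memX.
Qed.

Definition eval_mx k (G : 'M[Q]_k.+1) (p : {poly R}) : 'M[Q]_k.+1 := horner_mx G (map_poly f p).

Lemma eval_mxM k (G : 'M[Q]_k.+1) p q : eval_mx G (p * q) = eval_mx G p *m eval_mx G q.
Proof. by rewrite /eval_mx !rmorphM. Qed.
Lemma eval_mxD k (G : 'M[Q]_k.+1) p q : eval_mx G (p + q) = eval_mx G p + eval_mx G q.
Proof. by rewrite /eval_mx !rmorphD. Qed.
Lemma eval_mxB k (G : 'M[Q]_k.+1) p q : eval_mx G (p - q) = eval_mx G p - eval_mx G q.
Proof. by rewrite /eval_mx !rmorphB. Qed.
Lemma eval_mxC k (G : 'M[Q]_k.+1) c : eval_mx G c%:P = (f c)%:M.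
Proof. by rewrite /eval_mx map_polyC horner_mx_C. Qed.
Lemma eval_mxX k (G : 'M[Q]_k.+1) : eval_mx G 'X = G.
Proof. by rewrite /eval_mx map_polyX horner_mx_X. Qed.

Lemma eval_mx_hom A N k (BX : 'M[Q]_(N, k.+1)) G p : is_subring A -> (forall r, A (f r)) ->
  lattice_hom A BX BX G -> lattice_hom A BX BX (eval_mx G p).
Proof.
move=> sA Af hG; elim/poly_ind: p => [|p c IH].
  by rewrite /eval_mx !rmorph0; apply: lattice_hom0.
rewrite eval_mxD eval_mxM eval_mxX eval_mxC; apply: lattice_homD => //.
  exact: lattice_homM IH hG.
by rewrite -scalemx1; apply: lattice_homZ => //; apply: lattice_hom1.
Qed.

(** Cayley-Hamilton is applied to the matrix of [G] on the generators, which has entries in [R], so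
    that [P] has coefficients in [R]. *)
Lemma eval_mx_root N k (BX : 'M[Q]_(N.+1, k.+1)) G : row_full BX ->
  lattice_hom (image f) BX BX G ->
  exists P, P \is monic /\ eval_mx G P = 0.
Proof.
move=> /row_fullP[C CB] /(lattice_homP (image_subring f))[T [fT eT]].
pose U := \matrix_(i, j) projT1 (cid (fT i j)).
have TU : T = map_mx f U by apply/matrixP => i j; rewrite !mxE; case: (cid (fT i j)).
exists (char_poly U); split; first exact: char_poly_monic.
have E p : BX *m horner_mx G p = horner_mx T p *m BX.
  elim/poly_ind: p => [|p c IH]; first by rewrite !rmorph0 mulmx0 mul0mx.
  rewrite !rmorphD !rmorphM /= !horner_mx_X !horner_mx_C mulmxDr mulmxDl.
  by rewrite mulmxA IH -!mulmxA eT mul_mx_scalar mul_scalar_mx.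
rewrite -[LHS]mul1mx -CB -mulmxA /eval_mx E.
have -> : map_poly f (char_poly U) = char_poly T by rewrite TU map_char_poly.
by rewrite Cayley_Hamilton mul0mx mulmx0.
Qed.

Lemma lattice_hom_subring A A' n k n' k' (B : 'M[Q]_(n, k)) (B' : 'M[Q]_(n', k')) F :
  is_subring A -> is_subring A' -> (forall x, A x -> A' x) ->
  lattice_hom A B B' F -> lattice_hom A' B B' F.
Proof.
move=> sA sA' AA' /(lattice_homP sA)[T [AT e]]; apply/(lattice_homP sA').
by exists T; split=> // i j; apply: AA'.
Qed.

End CoreTheorem.

Section CoreTheorem2.
Variables (R : idomainType) (Q : fieldType) (f : {rmorphism R -> Q}).
Hypothesis f_inj : injective f.
Hypothesis f_frac : forall q : Q, exists a b : R, f b != 0 /\ q = f a / f b.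

Lemma factors_on_free N : factors_on (lattice_module f (1%:M : 'M[Q]_1)) (fun _ => True)
  (fun z : lattice_module f (1%:M : 'M[Q]_N) => z).
Proof.
have sI := image_subring f.
have free n1 n2 (D : 'M[Q]_(n1, n2)) : mx_over (image f) D ->
    lattice_hom (image f) (1%:M : 'M_n1) (1%:M : 'M_n2) D.
  by move=> hD; apply/lattice_homP => //; exists D; rewrite mulmx1 mul1mx.
have h1 i : lattice_hom (image f) (1%:M : 'M_1) (1%:M : 'M_N) (delta_mx 0 i).
  by apply: free; apply: mx_over_delta.
have h2 i : lattice_hom (image f) (1%:M : 'M_N) (1%:M : 'M_1) (delta_mx i 0).
  by apply: free; apply: mx_over_delta.
exists [seq (lattice_fun (h1 i), lattice_fun (h2 i)) | i <- enum 'I_N]; split.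
  by move=> p /List.in_map_iff[i [<- _]]; split; apply: lattice_fun_linear.
move=> y _; apply: val_inj; rewrite big_map enumT.
have val0 : val (0 : lattice_module f (1%:M : 'M[Q]_N)) = 0 :> 'rV_N by [].
transitivity (\sum_(i < N) (val y : 'rV_N) *m delta_mx i (0 : 'I_1) *m delta_mx (0 : 'I_1) i).
  under eq_bigr do rewrite -mulmxA mul_delta_mx.
  by rewrite -mulmx_sumr -[X in _ = _ *m X](_ : 1%:M = _) ?mulmx1 // scalar_mx_sum_delta;
    apply: eq_bigr => i _; rewrite scale1r.
symmetry; elim/big_rec2: _ => [|i x z _ e]; first by rewrite val0.
by rewrite -e.
Qed.

Variables (L : Q -> Prop).
Hypothesis sL : is_subring L.
Hypothesis locL : local_subring L.

Lemma lattice_unit_factor n k (B : 'M[Q]_(n, k)) X Y : lattice_hom L B B Y ->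
  lattice_unit L B (X *m Y) -> lattice_unit L B X.
Proof.
move=> hY [Z [hZ XYZ _]]; exists (Y *m Z).
have e : X *m (Y *m Z) = 1%:M by rewrite mulmxA.
by split=> //; [apply: lattice_homM hY hZ | apply: mulmx1C].
Qed.

Lemma lattice_unit_scale n k (B : 'M[Q]_(n, k)) a X : L a ->
  lattice_unit L B (a *: X) -> lattice_unit L B X.
Proof.
move=> La; rewrite -mul_mx_scalar; apply: lattice_unit_factor.
by rewrite -scalemx1; apply: lattice_homZ => //; apply: lattice_hom1.
Qed.

Lemma lattice_unit_scalar n k (B : 'M[Q]_(n, k)) a : unit_in L a ->
  lattice_unit L B (a *: 1%:M).
Proof.
move=> [a0 La]; exists (a^-1 *: 1%:M); split.
- by apply: lattice_homZ => //; apply: lattice_hom1.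
- by rewrite -scalemxAl mul1mx scalerA mulfV // scale1r.
- by rewrite -scalemxAl mul1mx scalerA mulVf // scale1r.
Qed.

Lemma local_lattice1 : local_lattice L (1%:M : 'M[Q]_1).
Proof.
have key (F : 'M[Q]_1) : unit_in L (F 0 0) -> lattice_unit L (1%:M : 'M[Q]_1) F.
  have -> : F = F 0 0 *: 1%:M by apply/matrixP => i j; rewrite !mxE !ord1 mulr1.
  by rewrite !mxE mulr1; apply: lattice_unit_scalar.
move=> F /(lattice_homP sL)[T []]; rewrite mulmx1 mul1mx => LT FT.
have LF : L (F 0 0) by rewrite FT.
case: (locL LF) => u; [left | right]; apply: key => //.
by rewrite !mxE.
Qed.

(* If some functional on the lattice takes a unit value then the lattice is free of rank one. *)
Lemma unit_functional_local n k (B : 'M[Q]_(n, k.+1)) v (g : 'M_(k.+1, 1)) :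
  (forall E, E *m E = E -> lattice_hom L B B E -> E = 0 \/ E = 1%:M) ->
  lattice L B v -> lattice_hom L B (1%:M : 'M_1) g -> unit_in L ((v *m g) 0 0) ->
  local_lattice L B.
Proof.
move=> triv Bv hg [x0 Lx]; set x := (v *m g) 0 0 in x0 Lx.
pose y := x^-1 *: v.
have By : lattice L B y by apply: latticeZ.
have val1 w : lattice L B w -> L ((w *m g) 0 0).
  by move=> /hg[c [Lc ->]]; rewrite mulmx1.
have mx11 (M : 'M[Q]_1) : M = (M 0 0)%:M by apply/matrixP => i j; rewrite !mxE !ord1.
have yg : y *m g = 1%:M.
  by rewrite /y -scalemxAl [v *m g]mx11 -/x -mul_scalar_mx -scalar_mxM mulVf.
have hgy : lattice_hom L B B (g *m y).
  by move=> w Bw; rewrite mulmxA [w *m g]mx11 mul_scalar_mx; apply: latticeZ => //; apply: val1.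
have gy1 : g *m y = 1%:M.
  case: (triv (g *m y)) => // [|e].
    by rewrite -mulmxA [y *m _]mulmxA yg mul1mx.
  have : y *m (g *m y) *m g = 1%:M by rewrite mulmxA yg mul1mx yg.
  rewrite e mulmx0 mul0mx => /matrixP/(_ 0 0); rewrite !mxE => /eqP.
  by rewrite eq_sym oner_eq0.
move=> F hF.
pose s := (y *m F *m g) 0 0.
have Fs : F = s *: 1%:M.
  have e : F = g *m (y *m F *m g) *m y.
    by rewrite !mulmxA gy1 mul1mx -mulmxA gy1 mulmx1.
  by rewrite {1}e [y *m F *m g]mx11 -/s mul_mx_scalar -scalemxAl gy1.
have Ls : L s by apply/val1/hF.
rewrite Fs; case: (locL Ls) => u; [left | right]; first exact: lattice_unit_scalar.
by rewrite -{1}[1%:M]scale1r -scalerBl; apply: lattice_unit_scalar.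
Qed.

Lemma radical_endoN n k (B : 'M[Q]_(n, k)) F : radical_endo L B F -> radical_endo L B (- F).
Proof.
case=> T [hT eT]; exists (- T); rewrite mulmxN eT mulNmx; split=> // i j.
by rewrite mxE; apply: nonunitN.
Qed.

(** When every functional takes only nonunit values on the lattice, a map through the rank one free
    module sends each generator to a nonunit multiple of a lattice element. *)
Lemma trace_through_radical n k (B : 'M[Q]_(n, k)) F :
  ~ (exists v g, [/\ lattice L B v, lattice_hom L B (1%:M : 'M_1) g &
      unit_in L ((v *m g) 0 0)]) ->
  trace_through L B (1%:M : 'M_1) F -> radical_endo L B F.
Proof.
move=> no [s [hs ->]]; elim: s hs => [|p s IH] hs.
  exists 0; rewrite big_nil mulmx0 mul0mx; split=> // i j; rewrite mxE.
  exact: nonunit0.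
rewrite big_cons; apply: radical_endoD => //; last first.
  by apply: IH => q qs; apply: hs; rewrite inE qs orbT.
have [h1 h2] := hs p (mem_head _ _).
have /h2[c [Lc ec]] : lattice L (1%:M : 'M[Q]_1) (1%:M : 'M_1).
  by exists 1%:M; rewrite mulmx1; split=> //; apply: mx_over_scalar sL (subring1 sL).
exists (B *m p.1 *m c); split; last first.
  by rewrite mulmxA -[RHS]mulmxA -ec mul1mx.
apply: mx_over_nonunitM => // i j; rewrite !ord1.
have Bi := lattice_row sL B i.
have e : (row i B *m p.1) 0 0 = (B *m p.1) i 0 by rewrite -row_mul mxE.
split; first by rewrite -e; have [d [Ld ->]] := h1 _ Bi; rewrite mulmx1.
by move=> u; apply: no; exists (row i B), p.1; rewrite e.
Qed.

End CoreTheorem2.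

Section CoreTheorem3.
Variables (R : idomainType) (Q : fieldType) (f : {rmorphism R -> Q}).
Hypothesis f_inj : injective f.
Hypothesis f_frac : forall q : Q, exists a b : R, f b != 0 /\ q = f a / f b.
Hypothesis Rfc : sr_finite_character (fun _ : R => True).
Hypothesis Rdim : sr_krull_dim (fun _ : R => True) 1.
Hypothesis Hadd : forall X : lmodType R, fg_module X -> torsion_free X ->
  forall N : lmodType R, in_Add X N -> dsum_of_fg N.
Variable m : R -> Prop.
Hypothesis mm : maximal_ideal m.
Variable L : Q -> Prop.
Hypothesis sL : is_subring L.
Hypothesis locL_sub : forall q, loc f m q -> L q.
Hypothesis L_integral : forall q, L q -> integral_over (loc f m) q.
Hypothesis locL : local_subring L.

Theorem trivial_idempotents_local n k (B : 'M[Q]_(n, k.+1)) : row_full B ->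
  (forall E, E *m E = E -> lattice_hom L B B E -> E = 0 \/ E = 1%:M) ->
  local_lattice L B.
Proof.
move=> fB triv F hF.
have im := maximal_is_ideal mm.
have Lf := L_f mm locL_sub; have Lu := L_unit f_inj mm locL_sub.
have sI := image_subring f.
have If r : image f (f r) by exists r.
have [c [N [BX [mc hG hL]]]] := finite_order_lattice f_inj mm sL locL_sub L_integral hF.
set G := f c *: F in hG.
have homE E : lattice_hom L BX BX E <-> lattice_hom L B B E.
  by split=> h v /hL /h /hL.
have fX : row_full BX.
  rewrite -col_leq_rank -{1}(eqP fB).
  have [U ->] : exists U, B = U *m BX.
    have ex i : exists d, row i B = d *m BX.
      by have /hL[d [_ e]] := lattice_row sL B i; exists d.
    exists (\matrix_i projT1 (cid (ex i))); apply/row_matrixP => i.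
    by rewrite row_mul rowK; case: (cid (ex i)).
  exact: mxrankM_maxr.
have hGL p : lattice_hom L B B (eval_mx f G p).
  apply: eval_mx_hom => //; apply/homE.
  by apply: lattice_hom_subring hG => // _ [r ->].
have hcF : lattice_unit L B G -> lattice_unit L B F.
  by apply: lattice_unit_scale.
have evX : eval_mx f G 'X = G := eval_mxX f G.
have [P [Pmon PG]] := eval_mx_root fX hG.
(* A constant term outside [m] inverts [G] at once: [G] times a polynomial in [G] is minus that
   constant. *)
case: (pselect (m P`_0)) => mP0; last first.
  left; apply: hcF.
  have ud := Lu _ mP0; have [d0 Ld] := ud.
  have e : G *m eval_mx f G (drop_poly 1 P) = (- f P`_0) *: 1%:M.
    have eP : P = (P`_0)%:P + 'X * drop_poly 1 P.
      rewrite -[LHS](poly_take_drop 1 P) expr1 [drop_poly 1 P * _]mulrC.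
      by congr (_ + _); rewrite /take_poly poly_def big_ord_recl big_ord0 addr0 expr0 alg_polyC.
    move: PG; rewrite eP eval_mxD eval_mxM evX eval_mxC -eP => /eqP.
    by rewrite addrC addr_eq0 => /eqP ->; rewrite -scalemx1 scaleNr.
  apply: (lattice_unit_factor (Y := eval_mx f G (drop_poly 1 P))) => //.
  rewrite e; apply: lattice_unit_scalar => //; split; first by rewrite oppr_eq0.
  by rewrite invrN; apply: subringN.
(* [CX] is a left inverse of [BX] and [r] clears the denominators of [BX *m CX], so multiplication
   by [r] factors through the free module on the generators. The factor [r0] puts [r] into [m]. *)
have [CX CB] := row_fullP fX.
have [s [s0 hs]] := mx_denominator f_inj f_frac (BX *m CX).
have [r0 [mr0 r0n0]] := maximal_nonzero Rdim mm.
pose r := s * r0.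
have rn0 : r != 0 by rewrite mulf_neq0.
have mr : m r by apply: idealMl.
have hr : mx_over (image f) (f r *: (BX *m CX)).
  by rewrite rmorphM mulrC -scalerA; apply: mx_overZ.
have [_ Rdim2] := Rdim.
have [e [e1 [e2 [e3 [e4 [h [k0 [M [t0 [eX eid nmt0 epow]]]]]]]]]] :=
  poly_local_idempotent Rfc Rdim2 mm rn0 mr Pmon mP0.
have hI p : lattice_hom (image f) BX BX (eval_mx f G p).
  exact: eval_mx_hom.
have [|||||||b [eps [idem heps cor]]] := @lift_idempotent_mx _ _ f f_inj f_frac Hadd
    _ _ _ _ _ _ BX (1%:M : 'M_1) (1%:M : 'M_N.+1) (eval_mx f G e) (f r *: CX) (BX *m eval_mx f G h).
- by [].
- by rewrite row_full_unit unitmx1.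
- exact: hI.
- move=> v [d [Id ->]]; exists (d *m (f r *: (BX *m CX))); split; first exact: mx_overM.
  by rewrite mulmx1 -!scalemxAr !mulmxA.
- move=> v [d [Id ->]]; rewrite mulmx1 mulmxA; apply: hI.
  by exists d.
- rewrite -scalemxAl mulmxA CB mul1mx -eval_mxM -eval_mxB eid eval_mxD !eval_mxM PG.
  by rewrite mul0mx addr0 eval_mxC mul_scalar_mx.
- exact: factors_on_free.
have [e0 [j [e0id he0 tr0 _]]] : exists e0 j, [/\ e0 *m e0 = e0, lattice_hom L BX BX e0,
    trace_through L BX (1%:M : 'M_1) (e0 - tower_corner eps) & \rank eps = (\rank e0 + j * 1)%N].
  apply: peel => //; first exact: local_lattice1.
  by apply: lattice_hom_subring heps => // _ [d ->].
rewrite cor in tr0.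
have tr : trace_through L B (1%:M : 'M_1) (e0 - eval_mx f G e).
  have [l [hl el]] := tr0; exists l; split=> // p /hl[h1 h2]; split.
    by move=> v /hL; apply: h1.
  by move=> v /h2 /hL.
(* A unit value makes the lattice free of rank one. Otherwise the part removed by peeling is
   radical, and [e0], which must be 0 or 1, agrees with [eval_mx f G e] modulo the radical. *)
case: (pselect (exists v g, [/\ lattice L B v, lattice_hom L B (1%:M : 'M_1) g &
      unit_in L ((v *m g) 0 0)])) => [[v [g [Bv hg u]]]|no].
  exact: (unit_functional_local sL locL triv Bv hg u).
have rad := trace_through_radical sL locL no tr.
have sc1 a : L a -> lattice_hom L B B (a *: 1%:M).
  by move=> La; apply: lattice_homZ => //; apply: lattice_hom1.
case: (triv e0) => // [|ee|ee]; first exact/homE.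
(* Here the idempotent is radical. A unit multiple of a power of [G] is a combination of it, [r] and
   [P], so [F ^+ M] is radical and [1 - F], a divisor of [1 - F ^+ M], is invertible. *)
- right; rewrite ee sub0r in rad.
  have {rad}rad : radical_endo L B (eval_mx f G e).
    by rewrite -[eval_mx f G e]opprK; apply: radical_endoN.
  have rM : radical_endo L B (eval_mx f G (t0%:P * 'X^M)).
    rewrite epow !eval_mxD [eval_mx f G (P * _)]eval_mxM PG mul0mx addr0.
    apply: radical_endoD => //.
      by rewrite eval_mxM; apply: radical_endoMr.
    rewrite eval_mxM eval_mxC mul_scalar_mx; apply: radical_endoZ => //.
    exact: (nonunit_f f_inj mm locL_sub L_integral).
  have GM : eval_mx f G (t0%:P * 'X^M) = f t0 *: (f c ^+ M *: F ^+ M).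
    by rewrite eval_mxM eval_mxC mul_scalar_mx /eval_mx map_polyXn rmorphXn /= horner_mx_X exprZn.
  have rF : radical_endo L B (F ^+ M).
    have [t0n Lt] := Lu _ nmt0; have [cn Lc] := Lu _ mc.
    have Lcm : L ((f c ^+ M)^-1) by rewrite -exprVn; apply: subringX.
    have := radical_endoMr sL locL rM (sc1 _ (subringM sL Lt Lcm)).
    rewrite GM -scalemxAr mulmx1 !scalerA.
    rewrite [X in X *: _](_ : _ = 1) ?scale1r //.
    have cMn : f c ^+ M != 0 by rewrite expf_neq0.
    by field; rewrite t0n cMn.
  have := radical_endo_unit sL locL fB rF.
  have -> : 1%:M - F ^+ M = (1%:M - F) *m (\sum_(i < M) F ^+ i).
    have := subrX1 F M => /(congr1 -%R); rewrite opprB => ->.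
    by rewrite -mulNr opprB.
  apply: lattice_unit_factor => //.
  have hp i : lattice_hom L B B (F ^+ i).
    elim: i => [|i IH]; first by rewrite expr0; apply: lattice_hom1.
    by rewrite exprS; apply: lattice_homM hF IH.
  elim: (M) => [|i IH]; first by rewrite big_ord0; apply: lattice_hom0.
  by rewrite big_ord_recr; apply: lattice_homD.
(* Here the idempotent is 1 modulo the radical, hence invertible, and it is a multiple of [G]. *)
- left; apply: hcF; rewrite ee in rad.
  have := radical_endo_unit sL locL fB rad; rewrite subKr eX eval_mxM evX.
  exact: lattice_unit_factor.
Qed.

End CoreTheorem3.

(** * The integral closure *)

Section Closure.
Variables (R : idomainType) (Q : fieldType) (f : {rmorphism R -> Q}).
Hypothesis f_inj : injective f.
Hypothesis f_frac : forall q : Q, exists a b : R, f b != 0 /\ q = f a / f b.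
Hypothesis Rfc : sr_finite_character (fun _ : R => True).
Hypothesis Rdim : sr_krull_dim (fun _ : R => True) 1.
Hypothesis Hadd : forall X : lmodType R, fg_module X -> torsion_free X ->
  forall N : lmodType R, in_Add X N -> dsum_of_fg N.

Notation Rbar := (integral_over (image f)).
Notation Lbar m := (integral_over (loc f m)).

Lemma closure_subring : is_subring Rbar.
Proof.
have h x : Rbar x <-> integralOver f x by apply: integral_overP.
split; first by apply/h; apply: integral0.
split; first by apply/h; apply: integral1.
split=> x y /h hx /h hy; apply/h; [exact: integral_sub | exact: integral_mul].
Qed.

Lemma closure_image r : Rbar (f r).
Proof. by apply: integral_over_mem; [apply: image_subring | exists r]. Qed.

Section AtMaximal.
Variable m : R -> Prop.
Hypothesis mm : maximal_ideal m.

Let sL := loc_subring f_inj mm.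

Lemma image_loc x : image f x -> loc f m x.
Proof. by case=> r ->; apply: loc_image. Qed.

Lemma loc_closure_image x : Rbar x -> Lbar m x.
Proof. exact: integral_overS image_loc. Qed.

Lemma loc_closureP x : Lbar m x <-> exists s, ~ m s /\ Rbar (f s * x).
Proof.
split=> [|[s [ms [p [pm [pA px]]]]]]; first exact: integral_loc_scale.
have Ls := loc_inv f ms.
rewrite -[x](mulKf (loc_neq0 f_inj mm ms)).
apply: (integral_scale sL Ls pm px) => i.
by apply: subringM => //; apply: image_loc.
Qed.

Lemma loc_closure_subring : is_subring (Lbar m).
Proof.
have sR := closure_subring; have pm := maximal_prime mm.
have Rf := closure_image.
split; first by apply: integral_over_mem => //; apply: subring0.
split; first by apply: integral_over_mem => //; apply: subring1.
split=> x y /loc_closureP[s [ms hs]] /loc_closureP[t [mt ht]]; apply/loc_closureP;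
  exists (s * t); split; try exact: primeNM; rewrite rmorphM.
  have -> : f s * f t * (x - y) = f t * (f s * x) - f s * (f t * y) by ring.
  by apply: subringB => //; apply: subringM.
have -> : f s * f t * (x * y) = (f s * x) * (f t * y) by ring.
exact: subringM.
Qed.

Lemma loc_local : local_subring (loc f m).
Proof.
move=> _ [a [s [ms ->]]].
have fs := loc_neq0 f_inj mm ms.
have key b : ~ m b -> unit_in (loc f m) (f b / f s).
  move=> mb; split; first by rewrite mulf_neq0 ?invr_eq0 // (loc_neq0 f_inj mm mb).
  by exists s, b; rewrite invfM invrK mulrC.
case: (pselect (m a)) => ma; last by left; apply: key.
right; have -> : 1 - f a / f s = f (s - a) / f s.
  by rewrite rmorphB mulrBl divff.
apply: key => h; apply: ms; rewrite -(subrK a s).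
by apply: idealD => //; apply: maximal_is_ideal.
Qed.

Lemma loc_integral q : loc f m q -> Lbar m q.
Proof. exact: integral_over_mem. Qed.

(* The powers of t span a lattice of rank one, where idempotents are trivial. *)
Lemma integral_unit_dichotomy (L : Q -> Prop) t : is_subring L ->
  (forall q, loc f m q -> L q) -> L t -> Lbar m t -> unit_in L t \/ unit_in L (1 - t).
Proof.
move=> sL' LL Lt [p [pm [pA pt]]].
have [n spn] : exists n, size p = n.+2.
  case: (ltnP 1 (size p)) => [sp|/size1_polyC ep].
    by exists (size p).-2; case: (size p) sp => [|[|]].
  by move: pm pt; rewrite ep monicE lead_coefC => /eqP ->; rewrite rootC oner_eq0.
have pn : p`_n.+1 = 1 by have := monicP pm; rewrite lead_coefE spn.
pose B : 'M[Q]_(n.+1, 1) := \col_i t ^+ i.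
have fB : row_full B.
  apply/row_fullP; exists (delta_mx 0 0); apply/matrixP => i j.
  rewrite !ord1 !mxE (bigD1 0) //= big1 ?addr0 => [|k k0]; first by rewrite !mxE eqxx mulr1.
  by rewrite !mxE eqxx (negbTE k0) mul0r.
have mx11 (M : 'M[Q]_1) : M = (M 0 0)%:M by apply/matrixP => i j; rewrite !mxE !ord1.
have rowB i : row i B = (t ^+ i)%:M by rewrite [LHS]mx11 !mxE.
have triv E : E *m E = E -> lattice_hom (loc f m) B B E -> E = 0 \/ E = 1%:M.
  rewrite [E]mx11; set e := E 0 0 => /matrixP/(_ 0 0); rewrite -scalar_mxM !mxE !mulr1n => ee _.
  have /eqP : e * (e - 1) = 0 by rewrite mulrBr mulr1 ee subrr.
  rewrite mulf_eq0 subr_eq0 => /orP[]/eqP->; last by right.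
  by left; apply/matrixP => i j; rewrite !mxE mul0rn.
have hF : lattice_hom (loc f m) B B t%:M.
  apply: lattice_hom_rows => // i; rewrite rowB -scalar_mxM -exprSr.
  have := ltn_ord i; rewrite ltnS leq_eqVlt => /orP[/eqP->|lti]; last first.
    by rewrite -[i.+1]/(nat_of_ord (Ordinal (lti : (i.+1 < n.+1)%N))) -rowB; apply: lattice_row.
  have -> : (t ^+ n.+1)%:M = \sum_(j < n.+1) (- p`_j) *: row j B :> 'M_1.
    have := rootP pt; rewrite horner_coef spn big_ord_recr /= pn mul1r addrC => /eqP.
    rewrite addr_eq0 => /eqP ->; rewrite -sumrN; apply/matrixP => x y.
    rewrite !mxE !ord1 eqxx mulr1n summxE; apply: eq_bigr => j _.
    by rewrite !mxE mulNr.
  apply: lattice_sum => // j _; apply: latticeZ => //; last exact: lattice_row.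
  by apply: subringN.
(* The inverse endomorphism sends 1 to the inverse scalar, which therefore lies in R_m[t], a subset
   of [L]. *)
have rank1 : forall E, lattice_unit (loc f m) B E -> unit_in L (E 0 0).
  move=> E [G [hG EG _]].
  have e : E 0 0 * G 0 0 = 1.
    by move/matrixP: EG => /(_ 0 0); rewrite !mxE big_ord_recl big_ord0 addr0.
  have E0 : E 0 0 != 0.
    by apply/eqP => z; move/eqP: e; rewrite z mul0r eq_sym oner_eq0.
  split=> //; have -> : (E 0 0)^-1 = G 0 0 by rewrite -[LHS]mulr1 -e mulKf.
  have [c [Lc ec]] := hG _ (lattice_row sL B 0).
  have -> : G 0 0 = (row 0 B *m G) 0 0 by rewrite rowB expr0 mul1mx.
  rewrite ec mxE; apply: subring_sum => // i _; apply: subringM => //.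
    exact: LL.
  by rewrite mxE; apply: subringX.
(* The coefficient ring is R_m itself, whose locality is elementary; the locality of [L] is the aim
   here. *)
have [] := trivial_idempotents_local f_inj f_frac Rfc Rdim Hadd mm sL (fun q h => h)
  loc_integral loc_local fB triv hF => /rank1; rewrite !mxE ?mulr1n; [left | right] => //.
Qed.

Lemma subring_local (L : Q -> Prop) : is_subring L -> (forall q, loc f m q -> L q) ->
  (forall q, L q -> Lbar m q) -> local_subring L.
Proof. by move=> sL' LL Li x Lx; apply: integral_unit_dichotomy => //; apply: Li. Qed.

Lemma loc_closure_local : local_subring (Lbar m).
Proof. by apply: subring_local => //; [apply: loc_closure_subring | apply: loc_integral]. Qed.

(** The contraction of the maximal ideal of the closure of R_m, a ring that is local by
    [loc_closure_local]. *)
Definition closure_maximal : Q -> Prop := fun x => Rbar x /\ ~ unit_in (Lbar m) x.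

Lemma closure_maximal_nonunit x : closure_maximal x -> nonunit (Lbar m) x.
Proof. by case=> Rx nx; split=> //; apply: loc_closure_image. Qed.

Lemma ideal_over_nonunit (I : Q -> Prop) x : sr_ideal Rbar I ->
  (forall r, I (f r) -> m r) -> I x -> ~ unit_in (Lbar m) x.
Proof.
move=> [IR [_ [_ IM]]] Im Ix [x0 /loc_closureP[s [ms hs]]].
by apply: ms; apply: Im; rewrite -(mulfVK x0 (f s)); apply: IM.
Qed.

Lemma closure_maximal_ideal : sr_ideal Rbar closure_maximal.
Proof.
have sR := closure_subring; have sLb := loc_closure_subring.
split; first by move=> x [].
have loc2 := loc_closure_local.
split; first by split; [apply: subring0 | case; rewrite eqxx].
split=> [x y hx hy|a x Ra hx].
  split; first by apply: subringB => //; [case: hx | case: hy].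
  by have [] := nonunitD sLb loc2 (closure_maximal_nonunit hx) (nonunitN sLb (closure_maximal_nonunit hy)).
split; first by apply: subringM => //; case: hx.
by have [] := nonunitMl sLb (loc_closure_image Ra) (closure_maximal_nonunit hx).
Qed.

Lemma closure_maximal_over r : closure_maximal (f r) <-> m r.
Proof.
split=> [[_ nu]|mr].
  apply: contrapT => mr; apply: nu; split; first exact: (loc_neq0 f_inj mm).
  by apply/loc_integral/loc_inv.
split; first exact: closure_image.
by case=> fr0; apply: maximal_nonunit => //; rewrite -(frac_neq0 f_inj).
Qed.

Lemma closure_maximalP : sr_maximal_ideal Rbar closure_maximal.
Proof.
have iP := closure_maximal_ideal.
split; first by split=> // /(@closure_maximal_nonunit 1); apply: nonunit1; apply: loc_closure_subring.
move=> J [iJ J1] PJ y Jy; have [JR [J0 [JB JM]]] := iJ.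
apply: contrapT => nPy.
have [y0 /loc_closureP[s [ms hs]]] : unit_in (Lbar m) y.
  by apply: contrapT => nu; apply: nPy; split=> //; apply: JR.
have Js : J (f s) by rewrite -(mulfVK y0 (f s)); apply: JM.
have [b mb] := maximal_inv mm ms.
apply: J1; have -> : 1 = f (1 - b * s) - (- f b * f s) by rewrite rmorphB rmorphM rmorph1; ring.
apply: JB; first by apply/PJ/closure_maximal_over.
by apply: JM => //; apply: subringN closure_subring (closure_image b).
Qed.

Lemma closure_maximal_unique P' : sr_maximal_ideal Rbar P' -> (forall r, P' (f r) <-> m r) ->
  forall x, P' x <-> closure_maximal x.
Proof.
move=> mP' over.
have sub x : P' x -> closure_maximal x.
  move=> Px; have [[iP' _] _] := mP'; split; first by case: iP' => h _; apply: h.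
  by apply: (ideal_over_nonunit iP') => // r /over.
move=> x; split=> [/sub //|]; have [_ P'max] := mP'.
by apply: P'max => //; case: closure_maximalP.
Qed.

End AtMaximal.

Lemma closure_maximal_inv I a : sr_maximal_ideal Rbar I -> Rbar a -> ~ I a ->
  exists b, Rbar b /\ I (1 - b * a).
Proof.
move=> [[iI I1] Imax] Ra nIa; have [IR [I0 [IB IM]]] := iI.
have sR := closure_subring.
apply: contrapT => no; apply: nIa.
apply: (Imax (fun z => exists x b, [/\ I x, Rbar b & z = x + b * a])).
- split; last by case=> x [b [Ix Rb e]]; apply: no; exists b; split=> //; rewrite e addrK.
  split; first by move=> _ [x [b [Ix Rb ->]]]; apply: subringD => //; [apply: IR | apply: subringM].
  split; first by exists 0, 0; split=> //; [apply: subring0 | rewrite mul0r addr0].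
  split=> [_ _ [x [b [Ix Rb ->]]] [y [c [Iy Rc ->]]]|c _ Rc [x [b [Ix Rb ->]]]].
    by exists (x - y), (b - c); split; [apply: IB | apply: subringB | ring].
  by exists (c * x), (c * b); split; [apply: IM | apply: subringM | ring].
- by move=> x Ix; exists x, 0; split=> //; [apply: subring0 | rewrite mul0r addr0].
- by exists 0, 1; split=> //; [apply: subring1 | rewrite mul1r add0r].
Qed.

(** An inverse [b] of [f a] modulo [I] is integral of some degree k. Its equation times [f a ^+ k]
    puts some [1 + a * c] with [c] in [R] into the contraction. *)
Lemma contraction_maximal I : sr_maximal_ideal Rbar I -> maximal_ideal (fun r => I (f r)).
Proof.
move=> mI; have [[iI I1] Imax] := mI; have [IR [I0 [IB IM]]] := iI.
have sR := closure_subring; have Rf := closure_image.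
have ID x y : I x -> I y -> I (x + y).
  move=> Ix Iy; have -> : x + y = x - (0 - y) by rewrite sub0r opprK.
  by apply: (IB) => //; apply: IB.
pose n r := I (f r).
have idn : ideal n.
  split=> //; split; first by rewrite /n rmorph0.
  split=> [x y nx ny|a x _ nx]; first by rewrite /n rmorphB; apply: IB.
  by rewrite /n rmorphM; apply: IM.
split; first by split=> //; rewrite rmorph1.
move=> J [iJ J1] nJ a Ja; apply: contrapT => nIa; apply: J1.
have [b [Rb hb]] := closure_maximal_inv mI (Rf a) nIa.
have [p [pm [pA pb]]] := Rb.
have [k spk] : exists k, size p = k.+1.
  by exists (size p).-1; rewrite prednK // size_poly_gt0 monic_neq0.
have pk : p`_k = 1 by have := monicP pm; rewrite lead_coefE spk.
have hX i : I (1 - (b * f a) ^+ i).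
  elim: i => [|i IH]; first by rewrite expr0 subrr.
  rewrite exprS; have -> : 1 - b * f a * (b * f a) ^+ i =
     (1 - b * f a) + (b * f a) * (1 - (b * f a) ^+ i) by ring.
  by apply: ID => //; apply: IM => //; apply: subringM.
have [c hc] : exists c, I (1 + f (a * c)).
  pose d i := projT1 (cid (pA i)); have dE i : p`_i = f (d i) by rewrite /d; case: cid.
  exists (\sum_(i < k) d i * a ^+ (k - i.+1)).
  have e0 : (b * f a) ^+ k + \sum_(i < k) p`_i * f a ^+ (k - i) * (b * f a) ^+ i = 0.
    have := rootP pb; rewrite horner_coef spk big_ord_recr /= pk mul1r => h.
    transitivity (f a ^+ k * (\sum_(i < k) p`_i * b ^+ i + b ^+ k)); last by rewrite h mulr0.
    rewrite mulrDr mulr_sumr addrC; congr (_ + _).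
      apply: eq_bigr => i _; have -> : f a ^+ k = f a ^+ (k - i) * f a ^+ i.
        by rewrite -exprD subnK // ltnW.
      by rewrite exprMn; ring.
    by rewrite exprMn mulrC.
  have -> : 1 + f (a * \sum_(i < k) d i * a ^+ (k - i.+1)) =
      (1 - (b * f a) ^+ k) + \sum_(i < k) p`_i * f a ^+ (k - i) * (1 - (b * f a) ^+ i).
    under [X in _ = _ + X]eq_bigr do rewrite mulrBr mulr1.
    rewrite sumrB addrACA -opprD e0 subr0; congr (_ + _).
    rewrite mulr_sumr rmorph_sum; apply: eq_bigr => i _.
    by rewrite !rmorphM rmorphXn dE mulrCA -exprS subnSK.
  apply: (ID) => //; apply: (big_ind I) => // i _.
  by apply: IM => //; rewrite dE -rmorphXn -rmorphM.
have Jc : J (1 + a * c) by apply: nJ; rewrite rmorphD rmorph1.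
by rewrite -(addrK (a * c) 1); apply: idealB => //; apply: idealMr.
Qed.

(** Dividing an integral equation of [x] by the largest power of ['X] leaves a nonzero constant term
    in [R], which is a multiple of [x]. *)
Lemma closure_divides_image x : Rbar x -> x != 0 ->
  exists a y, [/\ a != 0, Rbar y & f a = y * x].
Proof.
move=> Rx x0; have [p [pm [pA px]]] := Rx.
have exk : exists k, p`_k != 0.
  by exists (size p).-1; rewrite -lead_coefE (monicP pm) oner_neq0.
have [k pk kmin] := ex_minnP exk.
have [a ea] := pA k.
exists a, (- (drop_poly k.+1 p).[x]); split.
- by rewrite -(frac_neq0 f_inj) -ea.
- have sR := closure_subring.
  apply: subringN => //; rewrite horner_coef; apply: subring_sum => // i _.
  apply: subringM => //; last exact: subringX.
  by rewrite coef_drop_poly; have [c ->] := pA (i + k.+1)%N; apply: closure_image.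
have ep : p = drop_poly k p * 'X^k.
  rewrite -[LHS](poly_take_drop k p) [X in X + _](_ : _ = 0) ?add0r //.
  apply/polyP => i; rewrite coef_take_poly coef0; case: ltnP => // ik.
  by apply/eqP/negPn/negP => /kmin; rewrite leqNgt ik.
have : root (drop_poly k p) x.
  by move: px; rewrite {1}ep rootM => /orP[//|]; rewrite /root hornerXn expf_eq0 (negbTE x0) andbF.
move/rootP; have -> : drop_poly k p = (p`_k)%:P + drop_poly k.+1 p * 'X.
  apply/polyP => i; rewrite coefD coefC coefMX !coef_drop_poly.
  by case: i => [|i] /=; rewrite ?addr0 ?add0r // addSnnS.
rewrite hornerD hornerC hornerM hornerX => /eqP; rewrite addr_eq0 => /eqP.
by rewrite -ea => ->; rewrite mulNr.
Qed.

(** A maximal ideal containing [x] contracts to one of the finitely many over [a], and is determined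
    by its contraction. *)
Theorem closure_finite_character : sr_finite_character Rbar.
Proof.
move=> x Rx x0; have [a [y [a0 Ry e]]] := closure_divides_image Rx x0.
have [l hl] := finitely_many_maximal_over Rfc a0.
exists (map closure_maximal l) => I mI Ix.
have mn := contraction_maximal mI.
exists (closure_maximal (fun r => I (f r))); split.
  apply: List.in_map; apply/hl; split=> //.
  by rewrite e; have [[[_ [_ [_ IM]]] _] _] := mI; apply: IM.
exact: closure_maximal_unique.
Qed.

End Closure.

(** * At most one localization has an ideal that is not two-generated *)

Lemma ord3_third (V : zmodType) (c d : 'I_3) : c != d ->
  exists i, [/\ i != c, i != d, forall j, [\/ j = c, j = d | j = i] &
    forall F : 'I_3 -> V, \sum_j F j = F c + F d + F i].
Proof.
move=> cd.
have [i /andP[ic id]] : exists i, (i != c) && (i != d).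
  have : (0 < #|~: [set c; d]|)%N.
    have := cardsC [set c; d]; rewrite cards2 cd card_ord => e.
    by rewrite -(ltn_add2l 2) e.
  by case/card_gt0P => i; rewrite !inE negb_or => h; exists i.
have cov j : [\/ j = c, j = d | j = i].
  have : (#|~: [set c; d; i]| = 0)%N.
    have := cardsC [set c; d; i]; rewrite setUC cardsU1 cards2 !inE cd negb_or ic id card_ord.
    by move=> e; apply: (@addnI 3).
  move/eqP; rewrite cards_eq0 => /eqP/setP/(_ j); rewrite !inE => /negbFE /orP[/orP[]|] /eqP.
  - by constructor 1.
  - by constructor 2.
  - by constructor 3.
exists i; split=> // F.
rewrite (bigD1 c) //= (bigD1 d) 1?eq_sym //= (bigD1 i) /= ?ic ?id //.
rewrite big1 ?addr0 ?addrA // => j; case: (cov j) => ->; rewrite ?eqxx ?andbF //.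
Qed.

Section TwoGenerated.
Variables (Q : comNzRingType) (A : Q -> Prop).
Hypothesis sA : is_subring A.

Lemma span_mem (xs : seq Q) x : x \in xs -> sr_span A xs x.
Proof.
move=> xxs; exists [seq (i == index x xs)%:R | i <- iota 0 (size xs)]; split.
  by rewrite size_map size_iota.
split=> [c /mapP[i _ ->]|]; first by case: (_ == _); [apply: subring1 | apply: subring0].
have lt : (index x xs < size xs)%N by rewrite index_mem.
rewrite (bigD1 (Ordinal lt)) //= (nth_map 0%N) ?size_iota // nth_iota // eqxx mul1r nth_index //.
rewrite big1 ?addr0 // => i; rewrite -val_eqE /= => /negbTE ni.
by rewrite (nth_map 0%N) ?size_iota // nth_iota // add0n ni mul0r.
Qed.

Lemma span_min (J : Q -> Prop) (xs : seq Q) : J 0 -> (forall x y, J x -> J y -> J (x + y)) ->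
  (forall a x, A a -> J x -> J (a * x)) -> (forall x, x \in xs -> J x) ->
  forall z, sr_span A xs z -> J z.
Proof.
move=> J0 JD JM Jxs z [cs [scs [Acs ->]]]; elim/big_ind: _ => // i _.
by apply: JM; [apply: Acs; rewrite mem_nth // scs | apply: Jxs; rewrite mem_nth].
Qed.

Lemma span0 xs : sr_span A xs 0.
Proof.
exists (nseq (size xs) 0); split; first by rewrite size_nseq.
split=> [c /nseqP[-> _]|]; first exact: subring0.
by rewrite big1 // => i _; rewrite nth_nseq ltn_ord mul0r.
Qed.

Lemma spanD xs x y : sr_span A xs x -> sr_span A xs y -> sr_span A xs (x + y).
Proof.
move=> [cs [scs [Acs ->]]] [ds [sds [Ads ->]]].
exists [seq cs`_i + ds`_i | i <- iota 0 (size xs)]; split; first by rewrite size_map size_iota.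
split=> [c /mapP[i]|].
  rewrite mem_iota => /andP[_ ilt] ->.
  by apply: subringD => //; [apply: Acs | apply: Ads]; rewrite mem_nth ?scs ?sds.
rewrite -big_split; apply: eq_bigr => i _.
by rewrite (nth_map 0%N) ?size_iota // nth_iota // mulrDl.
Qed.

Lemma spanM xs a x : A a -> sr_span A xs x -> sr_span A xs (a * x).
Proof.
move=> Aa [cs [scs [Acs ->]]]; exists [seq a * c | c <- cs]; split; first by rewrite size_map.
split=> [c /mapP[d dcs ->]|]; first by apply: subringM => //; apply: Acs.
by rewrite mulr_sumr; apply: eq_bigr => i _; rewrite (nth_map 0) ?scs // mulrA.
Qed.

Lemma span_sub xs ys : (forall x, x \in xs -> sr_span A ys x) ->
  forall z, sr_span A xs z -> sr_span A ys z.
Proof.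
move=> h; apply: span_min => //; first exact: span0.
  by move=> x y; apply: spanD.
by move=> a x; apply: spanM.
Qed.

Lemma span_in (xs : seq Q) : (forall x, x \in xs -> A x) -> forall z, sr_span A xs z -> A z.
Proof.
move=> h; apply: span_min => //; first exact: subring0.
  by move=> x y; apply: subringD.
by move=> a x; apply: subringM.
Qed.

(** Induction on the generators meets only three elements at a time: two that span the tail, and the
    new one. *)
Lemma two_generated_span : (forall a b c, A a -> A b -> A c ->
    exists x y, [/\ x \in [:: a; b; c], y \in [:: a; b; c] &
      forall z, z \in [:: a; b; c] -> sr_span A [:: x; y] z]) ->
  sr_fg_ideals_2gen A.
Proof.
move=> three I [_ [xs [Axs Ixs]]].
suff [x [y [Ax [Ay h]]]] : exists x y, A x /\ A y /\
    forall z, sr_span A xs z <-> sr_span A [:: x; y] z.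
  by exists x, y; split=> //; split=> // z; rewrite Ixs.
elim: xs Axs {Ixs} => [|a xs IH] Axs.
  have A0 := subring0 sA; exists 0, 0; split=> //; split=> // z; split.
    by apply: span_sub.
  by apply: span_sub => x; rewrite !inE orbb => /eqP->; apply: span0.
have [x0 x0s|b [c [Ab [Ac h]]]] := IH; first by apply: Axs; rewrite inE x0s orbT.
have Aa : A a by apply: Axs; rewrite mem_head.
have [x [y [xm ym hz]]] := three a b c Aa Ab Ac.
have Am u : u \in [:: a; b; c] -> A u by rewrite !inE => /or3P[] /eqP->.
exists x, y; split; [exact: Am | split; [exact: Am|]].
have m1 u : u \in [:: a; b; c] -> sr_span A (a :: xs) u.
  rewrite !inE => /or3P[] /eqP->; first by apply: span_mem; rewrite mem_head.
    have /h : sr_span A [:: b; c] b by apply: span_mem; rewrite mem_head.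
    by apply: span_sub => v vs; apply: span_mem; rewrite inE vs orbT.
  have /h : sr_span A [:: b; c] c by apply: span_mem; rewrite !inE eqxx orbT.
  by apply: span_sub => v vs; apply: span_mem; rewrite inE vs orbT.
move=> z; split; apply: span_sub => u; last first.
  by rewrite !inE => /orP[] /eqP->; apply: m1.
rewrite inE => /orP[/eqP->|uxs]; first by apply: hz; rewrite mem_head.
have /h : sr_span A xs u by apply: span_mem.
apply: span_sub => v; rewrite !inE => /orP[] /eqP->; apply: hz; rewrite !inE eqxx ?orbT //.
Qed.

End TwoGenerated.

Section BadMaximal.
Variables (R : idomainType) (Q : fieldType) (f : {rmorphism R -> Q}).
Hypothesis f_inj : injective f.
Hypothesis f_frac : forall q : Q, exists a b : R, f b != 0 /\ q = f a / f b.
Hypothesis Rfc : sr_finite_character (fun _ : R => True).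
Hypothesis Rdim : sr_krull_dim (fun _ : R => True) 1.
Hypothesis Hadd : forall X : lmodType R, fg_module X -> torsion_free X ->
  forall N : lmodType R, in_Add X N -> dsum_of_fg N.

Notation Lbar m := (integral_over (loc f m)).

(* The fractional ideal (1, b, c) needs three generators at m. *)
Definition minimal_triple (m : R -> Prop) (b c : Q) : Prop :=
  forall x y z : R, f x + f y * b + f z * c = 0 -> [/\ m x, m y & m z].

Definition bad_maximal (m : R -> Prop) : Prop := exists b c, minimal_triple m b c.

Section AtMaximal.
Variable m : R -> Prop.
Hypothesis mm : maximal_ideal m.

Let sL := loc_subring f_inj mm.
Let locL := loc_local f_inj mm.

Lemma good_relation b c : ~ bad_maximal m ->
  exists x y z, f x + f y * b + f z * c = 0 /\ (~ m x \/ ~ m y \/ ~ m z).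
Proof.
move=> good; apply: contrapT => h; apply: good; exists b, c => x y z e.
have h' u : (~ m u -> ~ m x \/ ~ m y \/ ~ m z) -> m u.
  by move=> hu; apply: contrapT => /hu hn; apply: h; exists x, y, z.
by split; apply: h' => nu; [left | right; left | right; right].
Qed.

(** After division by [a], a relation among 1, [b / a], [c / a] with a coefficient outside [m]
    allows the generator with that coefficient to be dropped. *)
Lemma good_2gen : ~ bad_maximal m -> sr_fg_ideals_2gen (loc f m).
Proof.
move=> good; apply: two_generated_span => // a b c La Lb Lc.
have fst2 (x y : Q) : sr_span (loc f m) [:: x; y] x by apply: span_mem => //; rewrite mem_head.
have snd2 (x y : Q) : sr_span (loc f m) [:: x; y] y.
  by apply: span_mem => //; rewrite !inE eqxx orbT.
have comb x y p q u v : ~ m u -> f u * v + f x * p + f y * q = 0 ->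
    sr_span (loc f m) [:: p; q] v.
  move=> nmu e; have u0 := loc_neq0 f_inj mm nmu.
  have -> : v = - (f x / f u) * p + - (f y / f u) * q.
    apply: (mulfI u0); rewrite mulrDr; apply/eqP; rewrite -subr_eq0; apply/eqP.
    rewrite -[RHS]e; field; exact: u0.
  have Lxy w : loc f m (- (f w / f u)) by apply: subringN => //; exists w, u.
  by apply: spanD => //; apply: spanM.
have [a0|a0] := eqVneq a 0.
  exists b, c; split=> [||z]; rewrite ?inE ?eqxx ?orbT //.
  by case/or3P => /eqP->; rewrite ?a0; [apply: span0 | apply: fst2 | apply: snd2].
have [x [y [z [e nm]]]] := good_relation (b / a) (c / a) good.
have {}e : f x * a + f y * b + f z * c = 0.
  by rewrite -[RHS](mul0r a) -e; field; exact: a0.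
case: nm => [nx|[ny|nz]].
- exists b, c; split=> [||u]; rewrite ?inE ?eqxx ?orbT //.
  by case/or3P => /eqP->; [apply: comb e | apply: fst2 | apply: snd2].
- exists a, c; split=> [||u]; rewrite ?inE ?eqxx ?orbT //.
  case/or3P => /eqP->; [exact: fst2 | | exact: snd2].
  by apply: (comb x z _ _ y) => //; rewrite -e; ring.
- exists a, b; split=> [||u]; rewrite ?inE ?eqxx ?orbT //.
  case/or3P => /eqP->; [exact: fst2 | exact: snd2 |].
  by apply: (comb x y _ _ z) => //; rewrite -e; ring.
Qed.

Lemma quadratic_integral x p q : loc f m p -> loc f m q -> x ^+ 2 + p * x + q = 0 -> Lbar m x.
Proof.
move=> Lp Lq e; exists (Poly [:: q; p; 1]).
have es : Poly [:: q; p; 1] = [:: q; p; 1] :> seq Q.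
  by rewrite (@PolyK _ 0) //= oner_neq0.
split; first by rewrite monicE lead_coefE es.
split.
  move=> i; rewrite es; case: i => [|[|[|i]]] //=; first exact: subring1.
  by rewrite nth_nil; apply: subring0.
by apply/rootP; rewrite horner_Poly -[RHS]e /=; ring.
Qed.

(** Take a relation among 1, [x], [x ^+ 2]. A unit coefficient at either end is an integral equation
    for the inverse of [x] or for [x]. In the middle, [y], a multiple of [x], is integral, and [x]
    is settled by which of [y] and [1 - y] is a unit in the local closure. *)
Lemma good_valuation : ~ bad_maximal m -> valuation_in (Lbar m).
Proof.
move=> good x x0.
have [a [b [c [e nm]]]] := good_relation x (x ^+ 2) good.
have Ld u v : ~ m v -> loc f m (f u / f v) by move=> mv; exists u, v.
have sLb := loc_closure_subring f_inj mm.
have Lint q : loc f m q -> Lbar m q by apply: loc_integral.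
case: nm => [na|[nb|nc]].
- right; have a0 := loc_neq0 f_inj mm na.
  apply: (quadratic_integral (Ld b a na) (Ld c a na)).
  transitivity ((f a + f b * x + f c * x ^+ 2) / (f a * x ^+ 2)); last by rewrite e mul0r.
  by field; rewrite a0 x0.
- have b0 := loc_neq0 f_inj mm nb.
  pose y := - (f c / f b) * x; pose a' := - (f a / f b).
  have La' : loc f m a' by apply: subringN => //; apply: Ld.
  have Lc' : loc f m (- (f c / f b)) by apply: subringN => //; apply: Ld.
  have ex : x = a' + y * x.
    apply: (mulfI b0); apply/eqP; rewrite -subr_eq0; apply/eqP.
    by rewrite -[RHS]e /a' /y; field; exact: b0.
  have Ly : Lbar m y.
    apply: (quadratic_integral (p := -1) (q := a' * - (f c / f b))).
    - by apply: subringN => //; apply: subring1.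
    - exact: subringM.
    - transitivity (- (f c / f b) * (a' + y * x - x)); first by rewrite /y; ring.
      by rewrite -ex subrr mulr0.
  case: (integral_unit_dichotomy f_inj f_frac Rfc Rdim Hadd mm sLb Lint Ly Ly) => [[y0 Liy]|[y0 Liy]].
    right; have -> : x^-1 = - (f c / f b) * y^-1.
      by rewrite /y invfM mulrA mulfV ?mul1r //; move: y0; rewrite /y mulf_eq0 => /norP[].
    by apply: subringM => //; apply: Lint.
  left; have -> : x = a' * (1 - y)^-1.
    by apply: (mulIf y0); rewrite mulfVK // mulrBr mulr1 {1}ex mulrC addrK.
  by apply: subringM => //; apply: Lint.
- left; have c0 := loc_neq0 f_inj mm nc.
  apply: (quadratic_integral (Ld b c nc) (Ld a c nc)).
  transitivity ((f a + f b * x + f c * x ^+ 2) / f c); last by rewrite e mul0r.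
  by field; exact: c0.
Qed.

End AtMaximal.
End BadMaximal.

(** * Indecomposability of the lattice of a minimal triple *)

Section Minors.
Variables (Q : fieldType) (L : Q -> Prop).
Hypothesis sL : is_subring L.
Hypothesis locL : local_subring L.

Definition minor2 (M : 'M[Q]_3) (p q c d : 'I_3) : Q := M p c * M q d - M p d * M q c.

(** Cramer's rule: the unknowns in columns [c] and [d] are multiples of the third, so one entry of
    [G] divides all of them. *)
Lemma minor_kernel (M : 'M[Q]_3) (G : 'cV[Q]_3) p q c d : mx_over L M -> M *m G = 0 ->
  unit_in L (minor2 M p q c d) -> exists i, forall j, exists a, L a /\ G j 0 = a * G i 0.
Proof.
move=> LM MG [u0 Lu]; have cd : c != d.
  by apply/eqP => cd; move: u0; rewrite /minor2 cd subrr eqxx.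
have [i [ic id cov sum]] := ord3_third Q cd.
have eq k : M k c * G c 0 + M k d * G d 0 + M k i * G i 0 = 0.
  by move/matrixP: MG => /(_ k 0); rewrite !mxE sum.
exists i => j; case: (cov j) => ->.
- exists (- (M p i * M q d - M p d * M q i) * (minor2 M p q c d)^-1); split.
    by apply: subringM => //; apply: subringN => //; apply: subringB => //; apply: subringM.
  apply: (mulfI u0); rewrite [RHS]mulrA [X in _ = X * _]mulrCA divff // mulr1.
  have e1 := eq p; have e2 := eq q; rewrite /minor2.
  transitivity (M q d * (M p c * G c 0 + M p d * G d 0 + M p i * G i 0)
     - M p d * (M q c * G c 0 + M q d * G d 0 + M q i * G i 0)
     - (M p i * M q d - M p d * M q i) * G i 0); first by ring.
  by rewrite e1 e2; ring.
- exists (- (M p c * M q i - M p i * M q c) * (minor2 M p q c d)^-1); split.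
    by apply: subringM => //; apply: subringN => //; apply: subringB => //; apply: subringM.
  apply: (mulfI u0); rewrite [RHS]mulrA [X in _ = X * _]mulrCA divff // mulr1.
  have e1 := eq p; have e2 := eq q; rewrite /minor2.
  transitivity (M p c * (M q c * G c 0 + M q d * G d 0 + M q i * G i 0)
     - M q c * (M p c * G c 0 + M p d * G d 0 + M p i * G i 0)
     - (M p c * M q i - M p i * M q c) * G i 0); first by ring.
  by rewrite e1 e2; ring.
- by exists 1; rewrite mul1r; split=> //; apply: subring1.
Qed.

(* Modulo the maximal ideal, an idempotent 3 x 3 matrix V of rank at most one
   has V^2 = tr(V) V, so that tr(V) = 1 and 1 - V has rank two. *)
Lemma complementary_minor (V : 'M[Q]_3) : mx_over L V -> mx_over (nonunit L) (V *m V - V) ->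
  (forall p q c d, ~ unit_in L (minor2 V p q c d)) ->
  (exists i j, unit_in L (V i j)) ->
  exists p q c d, unit_in L (minor2 (1%:M - V) p q c d).
Proof.
move=> LV VV small [i [j [uij Lij]]].
have nmin p q c d : nonunit L (minor2 V p q c d).
  by split; [apply: subringB => //; apply: subringM | apply: small].
have ntr : nonunit L (1 - \sum_k V k k).
  (* The identity behind [V * V = tr(V) * V] in rank one: its error terms are 2 x 2 minors of
     [V]. *)
  have h : nonunit L (V i j * (1 - \sum_k V k k)).
    have -> : V i j * (1 - \sum_k V k k) = - (V *m V - V) i j + \sum_k minor2 V i k k j.
      rewrite /minor2 sumrB !mxE mulrBr mulr1 mulr_sumr; ring.
    apply: nonunitD => //; first exact: nonunitN.
    by apply: nonunit_sum.
  by have := nonunitMl sL Lij h; rewrite mulKf.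
have [k uk] : exists k, unit_in L (V k k).
  apply: contrapT => no; apply: (nonunit1 sL).
  rewrite -(subrK (\sum_k V k k) 1); apply: nonunitD => //.
  apply: nonunit_sum => // k _; split=> // u; apply: no; by exists k.
have [p pk] : exists p : 'I_3, k != p.
  by case: (eqVneq k 0) => [->|k0]; [exists (inord 1); rewrite -val_eqE /= inordK | exists 0].
have [q [qk qp cov sum]] := ord3_third Q pk.
exists p, q, p, q.
(* Modulo nonunits, the principal minor of [1 - V] away from [k] is [1 - V p p - V q q], which is
   [V k k] because the trace is 1. *)
have -> : minor2 (1%:M - V) p q p q = V k k * (1 - - ((1 - \sum_k V k k + minor2 V p q p q) / V k k)).
  have pq : (p == q) = false by rewrite eq_sym (negbTE qp).
  rewrite sum /minor2 !mxE !eqxx (negbTE qp) pq /= !mulr1n !mulr0n.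
  by case: uk => uk _; field; exact: uk.
have [v0 Lv] : unit_in L (1 - - ((1 - \sum_k V k k + minor2 V p q p q) / V k k)).
  apply: unit_in1B => //; apply: nonunitN => //; apply: nonunitMr => //; last exact: nonunitD.
  by case: uk.
case: uk => u0 Lu; split; first by rewrite mulf_neq0.
by rewrite invfM; apply: subringM.
Qed.

End Minors.

Section MinimalTriple.
Variables (R : idomainType) (Q : fieldType) (f : {rmorphism R -> Q}).
Hypothesis f_inj : injective f.
Variables (m : R -> Prop) (b c : Q).
Hypothesis mm : maximal_ideal m.
Hypothesis mt : minimal_triple f m b c.

Let sL := loc_subring f_inj mm.
Let locL := loc_local f_inj mm.

Definition triple_row : 'rV[Q]_2 := \row_j (if j == 0 then b else c).
(** The module R^2 + R(b, c). A functional (g0, g1) takes the values g0, g1 and b g0 + c g1 on its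
    generators; up to a sign these are the coefficients of a relation among b, c, 1, so a minimal
    triple rules out unit values. *)
Definition triple_lattice : 'M[Q]_(2 + 1, 2) := col_mx 1%:M triple_row.

Lemma triple_row_full : row_full triple_lattice.
Proof.
apply/row_fullP; exists (row_mx 1%:M 0).
by rewrite mul_row_col mul1mx mul0mx addr0.
Qed.

Lemma triple_mulr p (g : 'M[Q]_(2, p)) j : (triple_lattice *m g) ord_max j = b * g 0 j + c * g 1 j.
Proof.
rewrite mul_col_mx; have -> : ord_max = rshift 2 (0 : 'I_1) by apply: val_inj.
rewrite col_mxEd mxE big_ord_recl big_ord_recl big_ord0 addr0 !mxE /=.
by congr (_ + _ * g _ _); apply: val_inj.
Qed.

Lemma triple_mull p (g : 'M[Q]_(2, p)) (i : 'I_2) j :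
  (triple_lattice *m g) (lshift 1 i) j = g i j.
Proof. by rewrite mul_col_mx col_mxEu mul1mx. Qed.

Lemma triple_ord (i : 'I_3) : (exists k : 'I_2, i = lshift 1 k) \/ i = ord_max.
Proof.
rewrite -[i](@splitK 2 1); case: (fintype.split _) => k /=; first by left; exists k.
by right; apply: val_inj; rewrite /= ord1.
Qed.

Lemma minimal_triple_loc x y z : loc f m x -> loc f m y -> loc f m z ->
  x + y * b + z * c = 0 -> [/\ nonunit (loc f m) x, nonunit (loc f m) y & nonunit (loc f m) z].
Proof.
move=> Lx Ly Lz e.
have [q|s [ms hs]] := @loc_denominator _ _ f f_inj m mm Q [:: x; y; z] id.
  by rewrite !inE => /or3P[] /eqP->.
have [[x1 ex] [[y1 ey] [z1 ez]]] : image f (f s * x) /\ image f (f s * y) /\ image f (f s * z).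
  by split; [|split]; apply: hs; rewrite !inE eqxx ?orbT.
have [mx my mz] : [/\ m x1, m y1 & m z1].
  apply: mt; rewrite -ex -ey -ez -[RHS](mulr0 (f s)) -e; ring.
have s0 := loc_neq0 f_inj mm ms.
have key u u1 : loc f m u -> m u1 -> f s * u = f u1 -> nonunit (loc f m) u.
  move=> Lu mu eu; rewrite -(mulKf s0 u) eu.
  apply: nonunitMl => //; first exact: loc_inv.
  split; first exact: loc_image.
  case=> fu0 h; apply: (maximal_nonunit f_inj mm mu); first by rewrite -(frac_neq0 f_inj).
  exact: integral_over_mem.
by split; [apply: key ex | apply: key ey | apply: key ez].
Qed.

Lemma triple_functional (g : 'M[Q]_(2, 1)) :
  mx_over (loc f m) (triple_lattice *m g) -> mx_over (nonunit (loc f m)) (triple_lattice *m g).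
Proof.
move=> hg.
have L0 : loc f m (g 0 0) by rewrite -triple_mull.
have L1 : loc f m (g 1 0) by rewrite -triple_mull.
have L2 := hg ord_max 0.
have [n2 n0 n1] : [/\ nonunit (loc f m) (- (triple_lattice *m g) ord_max 0),
    nonunit (loc f m) (g 0 0) & nonunit (loc f m) (g 1 0)].
  apply: minimal_triple_loc => //; first exact: subringN.
  by rewrite triple_mulr; ring.
move=> i j; rewrite ord1; case: (triple_ord i) => [[k ->]|->]; last first.
  by rewrite -[_ ord_max 0]opprK; apply: nonunitN.
rewrite triple_mull; case: (eqVneq k 0) => [->//|k0].
by have -> : k = 1 by case: k k0 => [[|[|]]] // ? ?; apply: val_inj.
Qed.

(** A relation among the three rows is a pair of relations among 1, b, c. Hence the matrix of an
    endomorphism on the generators is unique modulo nonunits. *)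
Lemma triple_relation (x : 'rV[Q]_3) : mx_over (loc f m) x -> x *m triple_lattice = 0 ->
  mx_over (nonunit (loc f m)) x.
Proof.
move=> Lx ex.
have eq (j : 'I_2) : x 0 (lshift 1 j) + x 0 ord_max * triple_row 0 j = 0.
  have : row_mx (lsubmx (x : 'rV_(2 + 1))) (rsubmx (x : 'rV_(2 + 1))) *m triple_lattice = 0.
    by rewrite hsubmxK.
  rewrite mul_row_col mulmx1 => /matrixP/(_ 0 j); rewrite !mxE.
  rewrite big_ord_recl big_ord0 addr0 !mxE => <-.
  by congr (_ + x _ _ * _); apply: val_inj.
have e0 := eq 0; have e1 := eq 1; rewrite !mxE /= in e0 e1.
have L00 := subring0 sL.
have [n0 n2 _] : [/\ nonunit (loc f m) (x 0 (lshift 1 (0 : 'I_2))), nonunit (loc f m) (x 0 ord_max) & nonunit (loc f m) 0].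
  by apply: minimal_triple_loc; rewrite // mul0r addr0.
have [n1 _ _] : [/\ nonunit (loc f m) (x 0 (lshift 1 (1 : 'I_2))), nonunit (loc f m) 0 & nonunit (loc f m) (x 0 ord_max)].
  by apply: minimal_triple_loc; rewrite // mul0r addr0.
move=> i j; rewrite ord1; case: (triple_ord j) => [[k ->]|->] //.
case: (eqVneq k 0) => [->//|k0].
by have -> : k = 1 by case: k k0 => [[|[|]]] // ? ?; apply: val_inj.
Qed.

Lemma idempotent_rank1_factor (E : 'M[Q]_2) : E *m E = E -> E <> 0 -> E <> 1%:M ->
  exists (g : 'M[Q]_(2, 1)) (y : 'M[Q]_(1, 2)), E = g *m y /\ y *m g = 1%:M.
Proof.
move=> EE E0 E1.
have [i yi] : exists i, row i E != 0.
  apply/existsP; rewrite -negb_forall; apply/negP => /forallP h; apply: E0.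
  by apply/row_matrixP => i; rewrite row0; apply/eqP/h.
have rE : (\rank E < 2)%N.
  rewrite ltn_neqAle rank_leq_row andbT; apply/negP => r2; apply: E1.
  have uE : E \in unitmx by rewrite -row_free_unit.
  by rewrite -[LHS]mul1mx -(mulVmx uE) -mulmxA EE mulVmx.
have /submxP[g eg] : (E <= row i E)%MS.
  have := mxrank_leqif_sup (row_sub i E) => -[_ <-].
  rewrite eqn_leq mxrankS ?row_sub //= (leq_trans _ (_ : 1 <= _)%N) //.
  by rewrite lt0n mxrank_eq0.
exists g, (row i E); split=> //.
have yE : row i E *m E = row i E by rewrite -row_mul EE.
have : (row i E *m g - 1%:M) *m row i E = 0.
  by rewrite mulmxBl -mulmxA -eg yE mul1mx subrr.
have [e|e] := eqVneq ((row i E *m g - 1%:M) 0 0) 0.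
  move=> _; apply/matrixP => x y; rewrite !ord1.
  by move/eqP: e; rewrite !mxE subr_eq0 => /eqP.
rewrite [X in X *m _](_ : _ = ((row i E *m g - 1%:M) 0 0)%:M); last first.
  by apply/matrixP => x y; rewrite !ord1 [in RHS]mxE eqxx mulr1n.
by rewrite mul_scalar_mx => /eqP; rewrite scaler_eq0 (negbTE e) (negbTE yi).
Qed.

(** A nontrivial idempotent and its complement both have rank one over [Q]. Lifted to the generators
    both would have rank at most one over the residue field, where their ranks add up to three. *)
Lemma triple_trivial_idempotents (E : 'M[Q]_2) : E *m E = E ->
  lattice_hom (loc f m) triple_lattice triple_lattice E -> E = 0 \/ E = 1%:M.
Proof.
move=> EE hE; apply: contrapT => /not_orP[E0 E1].
(* A unit minor of [M] makes one entry of the kernel vector [triple_lattice *m g] divide all the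
   others. Divided by that entry, [g] becomes an integral functional with value 1, which minimality
   forbids. *)
have unit0 (F : 'M[Q]_2) (g : 'M[Q]_(2, 1)) (y : 'M[Q]_(1, 2)) (M : 'M[Q]_3) p q r s :
    mx_over (loc f m) M -> triple_lattice *m F = M *m triple_lattice -> F *m g = 0 ->
    y *m g = 1%:M -> ~ unit_in (loc f m) (minor2 M p q r s).
  move=> LM eM Fg yg u.
  have MG : M *m (triple_lattice *m g) = 0 by rewrite mulmxA -eM -mulmxA Fg mulmx0.
  have [i hi] := minor_kernel sL LM MG u.
  set G := triple_lattice *m g in hi.
  have Gi0 : G i 0 != 0.
    apply/eqP => Gi; have G0 : G = 0.
      by apply/matrixP => j k; rewrite ord1; have [a [_ ->]] := hi j; rewrite Gi mulr0 mxE.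
    have g0 : g = 0.
      apply/matrixP => j k; rewrite -(triple_mull g) -/G G0 !mxE //.
    move/matrixP: yg => /(_ 0 0); rewrite g0 mulmx0 !mxE => /eqP.
    by rewrite eq_sym oner_eq0.
  pose h := (G i 0)^-1 *: g.
  have eh j : (triple_lattice *m h) j 0 = (G i 0)^-1 * G j 0 by rewrite /h -scalemxAr mxE.
  have Lh : mx_over (loc f m) (triple_lattice *m h).
    move=> j k; rewrite ord1 eh; have [a [La ->]] := hi j.
    by rewrite mulrCA mulVf // mulr1.
  have := triple_functional Lh i 0; rewrite eh mulVf //.
  exact: nonunit1.
have [T [LT eT]] := (lattice_homP sL _ _ _).1 hE.
have E10 : 1%:M - E <> 0 by move/eqP; rewrite subr_eq0 => /eqP /esym.
have E11 : 1%:M - E <> 1%:M.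
  by move=> e; apply: E0; rewrite -[LHS](subKr 1%:M) e subrr.
have idC : (1%:M - E) *m (1%:M - E) = 1%:M - E.
  by rewrite mulmxBl mul1mx mulmxBr mulmx1 EE subrr subr0.
have [g [y [eE yg]]] := idempotent_rank1_factor EE E0 E1.
have [g' [y' [eE' yg']]] := idempotent_rank1_factor idC E10 E11.
pose V := 1%:M - T.
have LV : mx_over (loc f m) V by apply: mx_overB => //; apply: mx_over_scalar => //; apply: subring1.
have eV : triple_lattice *m (1%:M - E) = V *m triple_lattice.
  by rewrite mulmxBr mulmxBl mulmx1 mul1mx eT.
have Eg' : E *m g' = 0.
  have : E *m (1%:M - E) = 0 by rewrite mulmxBr mulmx1 EE subrr.
  by rewrite eE' mulmxA => /(congr1 (mulmx^~ g')) /=; rewrite mul0mx -mulmxA yg' mulmx1.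
have Eg : (1%:M - E) *m g = 0.
  by rewrite mulmxBl mul1mx eE -mulmxA yg mulmx1 subrr.
have [|||p [q [r [s u]]]] := complementary_minor sL locL LV.
- move=> i j.
  have : mx_over (nonunit (loc f m)) (row i (V *m V - V)).
    apply: triple_relation; first by move=> x z; rewrite mxE; apply: mx_overB => //; apply: mx_overM.
    rewrite -row_mul mulmxBl -mulmxA -eV mulmxA -eV -mulmxA idC subrr; apply: row0.
  by move=> /(_ 0 j); rewrite mxE.
- by move=> p q r s; apply: unit0 eV Eg yg.
- apply: contrapT => no; apply: E0.
  have rad : radical_endo (loc f m) triple_lattice (1%:M - E).
    exists V; split=> // i j; split=> // u; apply: no; by exists i, j.
  have [G [_ _ GE]] := radical_endo_unit sL locL triple_row_full rad.
  move: GE; rewrite subKr => GE.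
  case: E1; by rewrite -[LHS]mul1mx -GE -mulmxA EE.
- move: u; rewrite /V subKr; exact: (unit0 E g' y' T p q r s LT eT Eg' yg').
Qed.

End MinimalTriple.

(** * Uniqueness of the exceptional maximal ideal *)

Section BadUnique.
Variables (R : idomainType) (Q : fieldType) (f : {rmorphism R -> Q}).
Hypothesis f_inj : injective f.
Hypothesis f_frac : forall q : Q, exists a b : R, f b != 0 /\ q = f a / f b.
Hypothesis Rfc : sr_finite_character (fun _ : R => True).
Hypothesis Rdim : sr_krull_dim (fun _ : R => True) 1.
Hypothesis Hadd : forall X : lmodType R, fg_module X -> torsion_free X ->
  forall N : lmodType R, in_Add X N -> dsum_of_fg N.

(** Multiplied by [w], a relation among 1 and the glued entries has its [b2] and [c2] terms in [R],
    as [w * (1 - w)] is divisible by [r]. What remains is a relation among 1, [b1], [c1], with the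
    coefficients [y * w ^+ 2] and [z * w ^+ 2]. *)
Lemma minimal_triple_glue m w r b1 c1 b2 c2 : maximal_ideal m -> ~ m w ->
  principal r (w * (1 - w)) -> image f (f r * b2) -> image f (f r * c2) ->
  minimal_triple f m b1 c1 ->
  minimal_triple f m (f w * b1 + f (1 - w) * b2) (f w * c1 + f (1 - w) * c2).
Proof.
move=> mm mw [h hh] [b3 eb] [c3 ec] mt x y z e.
have pm := maximal_prime mm; have im := maximal_is_ideal mm.
have fh : f w * f (1 - w) = f r * f h by rewrite -!rmorphM hh.
have [mx my mz] : [/\ m (w * x + y * h * b3 + z * h * c3), m (y * w ^+ 2) & m (z * w ^+ 2)].
  apply: mt; rewrite !rmorphD !rmorphM -eb -ec.
  transitivity (f w * (f x + f y * (f w * b1 + f (1 - w) * b2) + f z * (f w * c1 + f (1 - w) * c2))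
    + (f r * f h - f w * f (1 - w)) * (f y * b2 + f z * c2)); first by ring.
  by rewrite e fh subrr mulr0 mul0r addr0.
have key u : m (u * w ^+ 2) -> m u.
  by move=> mu; apply: contrapT => nu; apply: (primeNM pm nu (primeNX (n := 2) pm mw)).
have {}my := key y my; have {}mz := key z mz; split=> //.
apply: contrapT => nx; apply: (primeNM pm mw nx).
have -> : w * x = (w * x + y * h * b3 + z * h * c3) - y * (h * b3) - z * (h * c3) by ring.
by apply: idealB => //; [apply: idealB => // |]; apply: idealMr.
Qed.

(* The corner entry w forces an image of odd rank at m, of even rank at a maximal ideal containing w. *)
Lemma idempotent_rank_parity m b c w k (eps : 'M[Q]_(tower_dim 1 2 k)) :
  maximal_ideal m -> minimal_triple f m b c -> eps *m eps = eps ->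
  lattice_hom (image f) (tower 1%:M (triple_lattice b c) k) (tower 1%:M (triple_lattice b c) k) eps ->
  tower_corner eps = (f w)%:M ->
  (~ m w -> odd (\rank eps)) /\ (m w -> ~~ odd (\rank eps)).
Proof.
move=> mm mt idem heps cor.
have sL := loc_subring f_inj mm; have locL := loc_local f_inj mm.
have locZ : local_lattice (loc f m) (triple_lattice b c).
  apply: (trivial_idempotents_local f_inj f_frac Rfc Rdim Hadd mm sL) => //.
  - by move=> q; apply: loc_integral.
  - exact: triple_row_full.
  - by move=> E; apply: triple_trivial_idempotents.
have sI := image_subring f.
have hL := lattice_hom_subring sI sL (@image_loc _ _ f _ mm) heps.
have [e [j [ee he tr rk]]] := peel sL locZ idem hL.
rewrite cor in tr.
(* A map from R_m to itself through [Z] is a value of functionals on [Z], hence a nonunit. *)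
have ntr : nonunit (loc f m) (e 0 0 - f w).
  have [s [hs es]] := tr.
  have -> : e 0 0 - f w = (\sum_(p <- s) p.1 *m p.2) 0 0.
    by rewrite -es !mxE eqxx mulr1n.
  rewrite summxE; elim: s hs {es} => [|p s IH] hs.
    by rewrite big_nil; apply: nonunit0.
  rewrite big_cons; apply: nonunitD => //; last first.
    by apply: IH => q qs; apply: hs; rewrite inE qs orbT.
  have [h1 h2] := hs p (mem_head _ _).
  have [T1 [LT1 e1]] := (lattice_homP sL _ _ _).1 h1.
  have [T2 [LT2 e2]] := (lattice_homP sL _ _ _).1 h2.
  have n2 : mx_over (nonunit (loc f m)) (triple_lattice b c *m p.2).
    by apply: triple_functional => //; rewrite e2 mulmx1.
  rewrite -[p.1]mul1mx e1 -mulmxA.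
  exact: (mx_over_nonunitMl sL locL LT1 n2).
have e01 : e = 0 \/ e = 1%:M.
  have ed : e = (e 0 0)%:M by apply/matrixP => x y; rewrite !mxE !ord1.
  have /eqP : e 0 0 * (e 0 0 - 1) = 0.
    by move/matrixP: ee => /(_ 0 0); rewrite mxE big_ord_recl big_ord0 addr0 mulrBr mulr1 => ->; rewrite subrr.
  rewrite mulf_eq0 subr_eq0 => /orP[]/eqP z; [left | right]; rewrite ed z //.
  by apply/matrixP => x y; rewrite !mxE mul0rn.
(* Each copy of [Z] has rank 2, so the parity is the rank of [e], which is 1 exactly when [w] is a
   unit at [m]. *)
split=> mw; rewrite rk oddD oddM andbF addbF.
- case: e01 => ez; last by rewrite ez mxrank1.
  have [_] := nonunitN sL ntr; case.
  by rewrite ez mxE sub0r opprK; apply: (L_unit f_inj mm).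
- case: e01 => ez; first by rewrite ez mxrank0.
  exfalso; apply: (nonunit1 sL).
  have -> : 1 = (e 0 0 - f w) + f w by rewrite ez mxE eqxx mulr1n subrK.
  apply: nonunitD => //; apply: (nonunit_f f_inj mm) => // q.
  exact: loc_integral.
Qed.

Theorem bad_unique m n : maximal_ideal m -> maximal_ideal n ->
  bad_maximal f m -> bad_maximal f n -> m = n.
Proof.
move=> mm mn [b1 [c1 t1]] [b2 [c2 t2]]; apply: contrapT => mDn.
(* [s] clears the denominators of both triples, and [r1] puts [n] among the maximal ideals over [r],
   which forces [w] into [n]. *)
have [s [s0 hs]] := mx_denominator f_inj f_frac (\row_(i < 4) [:: b1; c1; b2; c2]`_i).
have [r1 [mr1 r10]] := maximal_nonzero Rdim mn.
pose r := r1 * s.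
have r0 : r != 0 by rewrite mulf_neq0.
have hr (i : 'I_4) : image f (f r * [:: b1; c1; b2; c2]`_i).
  by have [x ex] := hs 0 i; exists (r1 * x); rewrite !rmorphM -ex !mxE mulrA.
have [w [mw rw nw _]] := local_factor_idempotent Rfc (proj2 Rdim) mm r0.
have nrw : n w.
  by apply: nw => //; [apply: idealMr (maximal_is_ideal mn) mr1 | apply/nesym].
have n1w : ~ n (1 - w).
  move=> n1; apply: (maximal_proper mn); rewrite -(subrK w 1).
  exact: idealD (maximal_is_ideal mn) n1 nrw.
pose b := f w * b1 + f (1 - w) * b2; pose c := f w * c1 + f (1 - w) * c2.
have tm : minimal_triple f m b c.
  apply: (minimal_triple_glue mm mw rw _ _ t1).
    exact: (hr (Ordinal (isT : (2 < 4)%N))).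
  exact: (hr (Ordinal (isT : (3 < 4)%N))).
have tn : minimal_triple f n b c.
  have := @minimal_triple_glue n (1 - w) r b2 c2 b1 c1 mn n1w.
  rewrite (_ : 1 - (1 - w) = w); last by rewrite opprB addrCA subrr addr0.
  rewrite [f (1 - w) * b2 + _]addrC [f (1 - w) * c2 + _]addrC; apply => //.
  - by rewrite mulrC.
  - exact: (hr (Ordinal (isT : (0 < 4)%N))).
  - exact: (hr (Ordinal (isT : (1 < 4)%N))).
have [h hh] := rw.
pose Z := triple_lattice b c.
(* [w - w * w = r * h] factors as R -> Z -> R: [y] sends 1 to [h] times the first generator, and [g]
   is [r] times the first coordinate, integral on [Z] because [r * b] is. *)
pose g : 'M[Q]_(2, 1) := \col_i (if i == 0 then f r else 0).
pose y : 'M[Q]_(1, 2) := f h *: delta_mx 0 0.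
have sI := image_subring f.
have If x : image f (f x) by exists x.
have rb : image f (f r * b).
  have -> : f r * b = f w * (f r * b1) + f (1 - w) * (f r * b2) by rewrite /b; ring.
  have h1 := hr (Ordinal (isT : (0 < 4)%N)); have h2 := hr (Ordinal (isT : (2 < 4)%N)).
  by apply: subringD => //; apply: subringM.
have [k [eps [idem heps cor]]] : exists k (eps : 'M[Q]_(tower_dim 1 2 k)),
  [/\ eps *m eps = eps, lattice_hom (image f) (tower 1%:M Z k) (tower 1%:M Z k) eps &
      tower_corner eps = (f w)%:M].
  apply: (@lift_idempotent_mx _ _ f f_inj f_frac Hadd _ _ _ _ _ _ (1%:M : 'M_1) Z Z (f w)%:M y g).
  - by rewrite row_full_unit unitmx1.
  - exact: triple_row_full.
  - by move=> v [d [Id ->]]; exists (d *m (f w)%:M); rewrite !mulmx1; split=> //;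
      apply: mx_overM => //; apply: mx_over_scalar.
  - move=> v [d [Id ->]]; exists (d *m (f h *: row_mx (delta_mx 0 0 : 'M_(1, 2)) (0 : 'M_(1, 1)))).
    split.
      apply: mx_overM => //; apply: mx_overZ => //; apply: mx_over_row_mx.
        exact: mx_over_delta.
      exact: mx_over0.
    by rewrite mulmx1 -[in RHS]mulmxA -scalemxAl mul_row_col mulmx1 mul0mx addr0.
  - move=> v [d [Id ->]]; exists (d *m (Z *m g)); split; last by rewrite mulmx1 mulmxA.
    apply: mx_overM => // i j; rewrite ord1; case: (triple_ord i) => [[l ->]|->].
      by rewrite triple_mull mxE; case: ifP => _ //; apply: subring0.
    by rewrite triple_mulr !mxE /= mulr0 addr0 mulrC.
  - have fh : f w - f w * f w = f r * f h by rewrite -!rmorphM -hh mulrBr mulr1 rmorphB.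
    rewrite -scalar_mxM -scalemxAl; apply/matrixP => i j; rewrite !ord1 !mxE !mulr1n fh.
    by rewrite !big_ord_recl big_ord0 !mxE /= mulr0 !addr0 mul1r mulrC.
  - exact: (@factors_on1 _ _ _ _ _ id id).
have [om _] := idempotent_rank_parity mm tm idem heps cor.
have [_ on] := idempotent_rank_parity mn tn idem heps cor.
by move: (on nrw); rewrite (om mw).
Qed.

End BadUnique.

(** * The integral closure is a Pruefer domain and ideals are two-generated *)

Section Furthermore.
Variables (R : idomainType) (Q : fieldType) (f : {rmorphism R -> Q}).
Hypothesis f_inj : injective f.
Hypothesis f_frac : forall q : Q, exists a b : R, f b != 0 /\ q = f a / f b.
Hypothesis Rfc : sr_finite_character (fun _ : R => True).
Hypothesis Rdim : sr_krull_dim (fun _ : R => True) 1.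
Hypothesis Hadd : forall X : lmodType R, fg_module X -> torsion_free X ->
  forall N : lmodType R, in_Add X N -> dsum_of_fg N.

Notation Rbar := (integral_over (image f)).
Notation Lbar m := (integral_over (loc f m)).

Let sR := closure_subring f_inj.

Lemma span2P (T : comNzRingType) (A : T -> Prop) x y z : is_subring A ->
  sr_span A [:: x; y] z <-> exists p q, [/\ A p, A q & z = p * x + q * y].
Proof.
move=> sA; split=> [[cs [scs [Acs ->]]]|[p [q [Ap Aq ->]]]].
  exists cs`_0, cs`_1; rewrite !big_ord_recl big_ord0 addr0 /=.
  by split=> //; apply: Acs; rewrite mem_nth // scs.
exists [:: p; q]; split=> //; split; last by rewrite !big_ord_recl big_ord0 addr0.
by move=> c; rewrite !inE => /orP[] /eqP->.
Qed.

Lemma span_ideal (A : Q -> Prop) xs : is_subring A -> (forall x, x \in xs -> A x) ->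
  sr_fg_ideal A (sr_span A xs).
Proof.
move=> sA Axs; split; last by exists xs.
split; first exact: span_in.
split; first exact: span0.
split=> [x y hx hy|a x]; last exact: spanM.
have -> : x - y = x + (- 1) * y by rewrite mulN1r.
by apply: spanD => //; apply: spanM => //; apply: subringN => //; apply: subring1.
Qed.

(** Expressing [s, s b, s c] through two generators and back gives a 3 x 3 product [M *m N] that is
    1 modulo nonunits, since the rows of [1 - M *m N] are relations of a minimal triple. Its
    determinant is a unit although its rank is at most 2. *)
Lemma two_generated_good m : maximal_ideal m -> sr_fg_ideals_2gen (loc f m) ->
  ~ bad_maximal f m.
Proof.
move=> mm two [b [c mt]].
have sL := loc_subring f_inj mm; have locL := loc_local f_inj mm.
have [s [s0 hs]] := common_denominator f_inj f_frac (fun i : 'I_2 => [:: b; c]`_i).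
have fs0 : f s != 0 by rewrite frac_neq0.
have Lf r : loc f m (f r) by apply: loc_image.
have [b1 eb] := hs 0; have [c1 ec] := hs 1; rewrite /= in eb ec.
pose a (i : 'I_3) : Q := [:: f s; f s * b; f s * c]`_i.
pose xs := [:: f s; f s * b; f s * c].
have axs i : a i \in xs by rewrite mem_nth.
have Lxs x : x \in xs -> loc f m x.
  by rewrite !inE => /or3P[] /eqP->; rewrite ?eb ?ec.
have [x [y [Lx [Ly hxy]]]] := two _ (span_ideal sL Lxs).
have exM i : exists p q, [/\ loc f m p, loc f m q & a i = p * x + q * y].
  by apply/(span2P _ _ _ sL)/hxy/span_mem.
have exN z : sr_span (loc f m) [:: x; y] z ->
    exists p : 'I_3 -> Q, (forall i, loc f m (p i)) /\ z = \sum_i p i * a i.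
  move/hxy => [cs [scs [Lcs ->]]]; exists (fun i => cs`_i); split=> // i.
  by apply: Lcs; rewrite mem_nth // scs.
have [nx [Lnx ex]] : exists p : 'I_3 -> Q, (forall i, loc f m (p i)) /\ x = \sum_i p i * a i.
  by apply: exN; apply: span_mem => //; rewrite mem_head.
have [ny [Lny ey]] : exists p : 'I_3 -> Q, (forall i, loc f m (p i)) /\ y = \sum_i p i * a i.
  by apply: exN; apply: span_mem => //; rewrite !inE eqxx orbT.
have /choice[mx /choice[my mP]] := exM.
pose M : 'M[Q]_(3, 1 + 1) := row_mx (\col_i mx i) (\col_i my i).
pose N : 'M[Q]_(1 + 1, 3) := col_mx (\row_i nx i) (\row_i ny i).
have MNE i j : (M *m N) i j = mx i * nx j + my i * ny j.
  by rewrite mul_row_col !mxE !big_ord_recl !big_ord0 !addr0 !mxE.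
have LMN : mx_over (loc f m) (M *m N).
  move=> i j; rewrite MNE; have [h1 h2 _] := mP i.
  by apply: subringD => //; apply: subringM.
pose V := 1%:M - M *m N.
have LV : mx_over (loc f m) V.
  by apply: mx_overB => //; apply: mx_over_scalar => //; apply: subring1.
have rel i : \sum_j V i j * a j = 0.
  under eq_bigr do rewrite !mxE mulrBl -/M -/N.
  have -> : \sum_j ((i == j)%:R * a j - (\sum_k M i k * N k j) * a j) =
      \sum_j (i == j)%:R * a j - \sum_j (M *m N) i j * a j.
    by rewrite -sumrB; apply: eq_bigr => j _; rewrite [(M *m N) i j]mxE.
  rewrite (bigD1 i) //= eqxx mul1r big1 ?addr0; last first.
    by move=> j; rewrite eq_sym => /negbTE->; rewrite mul0r.
  under eq_bigr do rewrite MNE mulrDl -!mulrA.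
  rewrite big_split /= -!mulr_sumr -ex -ey.
  by have [_ _ <-] := mP i; rewrite subrr.
have nV : mx_over (nonunit (loc f m)) V.
  move=> i j; have e := rel i.
  rewrite !big_ord_recl big_ord0 addr0 /a /= in e.
  have [n0 n1 n2] : [/\ nonunit (loc f m) (V i 0), nonunit (loc f m) (V i (lift ord0 ord0)) &
      nonunit (loc f m) (V i (lift ord0 (lift ord0 ord0)))].
    apply: (minimal_triple_loc f_inj mm mt) => //.
    by apply: (mulfI fs0); rewrite mulr0 -[RHS]e; ring.
  case: j => [[|[|[|//]]] lt].
  - by rewrite (_ : Ordinal lt = 0) //; apply: val_inj.
  - by rewrite (_ : Ordinal lt = lift ord0 ord0) //; apply: val_inj.
  - by rewrite (_ : Ordinal lt = lift ord0 (lift ord0 ord0)) //; apply: val_inj.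
have [+ _] := unit_det1B sL locL nV.
rewrite /V subKr -unitfE -unitmxE -row_free_unit => /eqP rk.
have := mxrankM_maxl M N; rewrite rk => h.
by have := leq_trans h (rank_leq_col M).
Qed.

Lemma ideal_prodD (I J : Q -> Prop) x y :
  ideal_prod I J x -> ideal_prod I J y -> ideal_prod I J (x + y).
Proof.
move=> [us [vs [s1 [Iu [Jv ->]]]]] [us' [vs' [s2 [Iu' [Jv' ->]]]]].
exists (us ++ us'), (vs ++ vs'); rewrite !size_cat s1 s2; split=> //.
split; first by move=> u; rewrite mem_cat => /orP[/Iu|/Iu'].
split; first by move=> v; rewrite mem_cat => /orP[/Jv|/Jv'].
rewrite big_split_ord /=; congr (_ + _); apply: eq_bigr => i _.
  by rewrite !nth_cat s1 ltn_ord.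
by rewrite !nth_cat s1 ltnNge leq_addr /= addKn.
Qed.

Lemma ideal_prod1 (I J : Q -> Prop) x y : I x -> J y -> ideal_prod I J (x * y).
Proof.
move=> Ix Jy; exists [:: x], [:: y]; split=> //.
split; first by move=> u; rewrite inE => /eqP->.
split; first by move=> u; rewrite inE => /eqP->.
by rewrite big_ord_recl big_ord0 addr0.
Qed.

Lemma ideal_prodM (A I J : Q -> Prop) a x : (forall a u, A a -> I u -> I (a * u)) -> A a ->
  ideal_prod I J x -> ideal_prod I J (a * x).
Proof.
move=> IM Aa [us [vs [s1 [Iu [Jv ->]]]]].
exists [seq a * u | u <- us], vs; rewrite size_map; split=> //.
split; first by move=> u /mapP[v /Iu Iv ->]; apply: IM.
split=> //; rewrite mulr_sumr; apply: eq_bigr => i _.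
by rewrite (nth_map 0) // mulrA.
Qed.

Lemma valuation_pivot (L : Q -> Prop) (xs : seq Q) : is_subring L -> valuation_in L ->
  (exists x, x \in xs /\ x != 0) ->
  exists x, [/\ x \in xs, x != 0 & forall u, u \in xs -> L (u / x)].
Proof.
move=> sL val; elim: xs => [|v xs IH]; first by case=> x [].
have L1 w : w != 0 -> L (w / w) by move=> w0; rewrite divff //; apply: subring1.
have L0 w : L (0 / w) by rewrite mul0r; apply: subring0.
case: (pselect (exists x, x \in xs /\ x != 0)) => [/IH[x [xxs x0 hx]] _|no [x [xvs x0]]].
  have [v0|v0] := eqVneq v 0.
    exists x; split=> // [|u]; first by rewrite inE xxs orbT.
    by rewrite inE v0 => /orP[/eqP->|/hx //]; apply: L0.
  have [] := val (v / x); first by rewrite mulf_neq0 ?invr_eq0.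
    move=> Lvx; exists x; split=> // [|u]; first by rewrite inE xxs orbT.
    by rewrite inE => /orP[/eqP->|/hx].
  rewrite invfM invrK => Lxv; exists v; split=> // [|u]; first by rewrite mem_head.
  rewrite inE => /orP[/eqP->|/hx Lux]; first exact: L1.
  have -> : u / v = (u / x) * (v^-1 * x) by rewrite mulrCA mulfVK // mulrC.
  exact: subringM.
have z u : u \in xs -> u = 0.
  by move=> uxs; apply/eqP; apply: contrapT => /negP u0; apply: no; exists u.
move: xvs; rewrite inE => /orP[/eqP ex|/z ex]; last by rewrite ex eqxx in x0.
exists v; rewrite -ex; split=> // [|u]; first by rewrite ex mem_head.
by rewrite inE ex => /orP[/eqP->|/z ->]; [apply: L1; rewrite -ex | apply: L0].
Qed.

Lemma loc_closure_denominator m (T : eqType) (l : seq T) (q : T -> Q) : maximal_ideal m ->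
  (forall i, i \in l -> Lbar m (q i)) ->
  exists s, ~ m s /\ forall i, i \in l -> Rbar (f s * q i).
Proof.
move=> mm; have pm := maximal_prime mm; have Rf := closure_image f.
elim: l => [|i l IH] h; first by exists 1; split=> //; apply: maximal_proper.
have [j jl|s [ms hs]] := IH; first by apply: h; rewrite inE jl orbT.
have [t [mt ht]] := (loc_closureP f_inj mm _).1 (h i (mem_head _ _)).
exists (s * t); split=> [|j]; first exact: primeNM.
rewrite inE rmorphM => /orP[/eqP->|/hs hj]; first by rewrite -mulrA; apply: subringM.
by rewrite mulrAC mulrC; apply: subringM.
Qed.

(** With [J] the inverse fractional ideal, the elements of [R] sent into I J form an ideal. At [m],
    a pivot generator [x] together with [f s / x], where [s] clears denominators, puts some [s]
    outside [m] into it. *)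
Lemma closure_pruefer : (forall m, maximal_ideal m -> valuation_in (Lbar m)) -> sr_pruefer Rbar.
Proof.
move=> val I [iI [xs [Rxs hI]]] [x0 [Ix0 x00]].
have [IR [I0 [IB IM]]] := iI.
pose J q := forall x, I x -> Rbar (q * x).
have sJ : sr_submodule Rbar J.
  split; first by move=> x _; rewrite mul0r; apply: subring0.
  split=> [p q hp hq x Ix|a p Ra hp x Ix].
    by rewrite mulrBl; apply: subringB => //; [apply: hp | apply: hq].
  by rewrite -mulrA; apply: subringM => //; apply: hp.
have P0 : ideal_prod I J 0.
  by rewrite -[0](mulr0 0); apply: ideal_prod1 => //; case: sJ.
exists J; split=> // z; split=> [Rz|[us [vs [s1 [Iu [Jv ->]]]]]]; last first.
  apply: subring_sum => // i _; rewrite mulrC; apply: (Jv vs`_i).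
    by rewrite mem_nth // -s1.
  by apply: Iu; rewrite mem_nth.
suff one : ideal_prod I J (f 1).
  by rewrite -[z]mulr1 -(rmorph1 f); apply: (ideal_prodM IM).
pose K r := ideal_prod I J (f r).
have iK : ideal K.
  split=> //; split; first by rewrite /K rmorph0.
  split=> [x y Kx Ky|a x _ Kx]; last first.
    by rewrite /K rmorphM; apply: (ideal_prodM IM) => //; apply: closure_image.
  rewrite /K rmorphB -mulN1r; apply: ideal_prodD => //.
  by apply: (ideal_prodM IM) => //; apply: subringN => //; apply: subring1.
apply: (ideal_unit iK) => m mm.
have [|x [xxs xn0 hx]] := valuation_pivot (xs := xs) (loc_closure_subring f_inj mm) (val m mm).
  apply: contrapT => no; case/eqP: x00.
  have [cs [_ [_ ->]]] := (hI x0).1 Ix0; apply: big1 => i _.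
  rewrite [xs`_i](_ : _ = 0) ?mulr0 //; apply/eqP; apply: contrapT => /negP nz.
  by apply: no; exists xs`_i; rewrite mem_nth.
have [s [ms hs]] := loc_closure_denominator mm hx.
exists s; split=> //; rewrite /K -[f s](mulfVK xn0) mulrC; apply: ideal_prod1.
  by apply/hI/span_mem.
move=> z' /hI; apply: (span_min (J := fun z => Rbar (f s / x * z))) => [|u v|a u Ra|u uxs].
- by rewrite mulr0; apply: subring0.
- by rewrite mulrDr; apply: subringD.
- by rewrite mulrCA; apply: subringM.
- by rewrite mulrAC -mulrA; apply: hs.
Qed.

Lemma contraction_prime P : sr_prime_ideal Rbar P -> prime_ideal (fun r => P (f r)).
Proof.
have Rf := closure_image f.
move=> [[[PR [P0 [PB PM]]] P1] PP]; split.
  split; last by rewrite rmorph1.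
  split=> //; split; first by rewrite rmorph0.
  split=> [x y|a x _]; first by rewrite rmorphB; apply: PB.
  by rewrite rmorphM; apply: PM.
by move=> x y _ _; rewrite rmorphM; apply: PP.
Qed.

(* Incomparability: the constant term of a polynomial of minimal degree with value in P works. *)
Lemma contraction_strict P P' x : sr_prime_ideal Rbar P -> sr_prime_ideal Rbar P' ->
  (forall y, P y -> P' y) -> P' x -> ~ P x -> exists r, P' (f r) /\ ~ P (f r).
Proof.
move=> pP [[[P'R [P'0 [P'B P'M]]] _] _] PP' P'x Px.
have [[[PR [P0 [PB PM]]] P1] PP] := pP.
have Rx := P'R x P'x; have [p [pm [pA /rootP px]]] := Rx.
have : P p.[x] by rewrite px.
elim/poly_ind: p pm pA {px} => [|p c IH] pm pA.
  by move: pm; rewrite monicE lead_coef0 eq_sym oner_eq0.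
have [p0|p0] := eqVneq p 0.
  move: pm; rewrite p0 mul0r add0r monicE lead_coefC => /eqP ->.
  by rewrite hornerC => /P1.
have {}pm : p \is monic.
  move: pm; rewrite !monicE lead_coefDl ?lead_coefMX // size_polyC size_mulX //.
  by case: (c == 0); rewrite // ltnS size_poly_gt0.
have pA' i : image f p`_i.
  by have := pA i.+1; rewrite coefD coefMX coefC addr0.
have [r er] : image f c by have := pA 0%N; rewrite coefD coefMX coefC add0r.
have Rp : Rbar p.[x].
  rewrite horner_coef; apply: subring_sum => // i _; apply: subringM => //; last exact: subringX.
  by have [a ->] := pA' i; apply: closure_image.
rewrite hornerD hornerC hornerM hornerX => hP.
case: (pselect (P (f r))) => Pr; last first.
  exists r; split=> //; rewrite -er -[c](addKr (p.[x] * x)) addrC.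
  by apply: P'B; [apply: PP' | apply: P'M].
have : P (p.[x] * x) by rewrite -(addrK c (_ * _)); apply: PB => //; rewrite er.
by case/(PP _ _ Rp Rx) => // hp; apply: IH.
Qed.

(** A chain of primes stays strict under contraction, which bounds the dimension; 0 and the maximal
    ideal over some [m] form a chain of length one. *)
Lemma closure_krull_dim : sr_krull_dim Rbar 1.
Proof.
split; last first.
  move=> [c [pc hc]]; case: Rdim => _; apply; exists (fun i r => c i (f r)); split.
    by move=> i /pc; apply: contraction_prime.
  move=> i ilt; have [sub [x [c1 c0]]] := hc i ilt; split; first by move=> r; apply: sub.
  by apply: contraction_strict sub c1 c0; apply: pc => //; apply: ltnW.
have [[c0 [pc _]] _] := Rdim.
have [m [mm _]] : exists m, maximal_ideal m /\ forall x, c0 0%N x -> m x.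
  by have [[i0 n1] _] := pc 0%N isT; apply: exists_maximal_ideal.
have mP := closure_maximalP f_inj f_frac Rfc Rdim Hadd mm.
exists (fun i x => if i is 0%N then x = 0 else closure_maximal f m x); split.
  case=> [|i] _.
    split; last by move=> x y _ _ /eqP; rewrite mulf_eq0 => /orP[]/eqP; [left | right].
    split; last by apply/eqP; rewrite oner_eq0.
    split; first by move=> x ->; apply: subring0.
    split=> //; split=> [x y -> ->|a x _ ->]; first by rewrite subrr.
    by rewrite mulr0.
  split; first by case: mP.
  move=> x y Rx Ry [_ nu]; apply: contrapT => /not_orP[nx ny]; apply: nu.
  have u z : Rbar z -> ~ closure_maximal f m z -> unit_in (Lbar m) z.
    by move=> Rz nz; apply: contrapT => nu; apply: nz.
  have [[x0 Lx] [y0 Ly]] := (u x Rx nx, u y Ry ny); split; first by rewrite mulf_neq0.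
  by rewrite invfM; apply: subringM => //; apply: loc_closure_subring.
case=> // _; split.
  by move=> x ->; have [[[_ [? _]] _] _] := mP.
have [r [mr r0]] := maximal_nonzero Rdim mm.
exists (f r); split; last by apply/eqP; rewrite frac_neq0.
by apply/(closure_maximal_over f_inj mm).
Qed.

End Furthermore.

(** * Gluing local generators *)

Section IdealTimes.
Variable R : comNzRingType.
Implicit Types (m I : R -> Prop).

(** The product ideal as an intersection: a property of its elements follows by choosing a suitable
    [J], without handling finite sums. *)
Definition ideal_times m I : R -> Prop := fun z =>
  forall J, ideal J -> (forall a y, m a -> I y -> J (a * y)) -> J z.

Lemma ideal_times_mul m I a y : m a -> I y -> ideal_times m I (a * y).
Proof. by move=> ma Iy J _; apply. Qed.

Lemma ideal_times_ideal m I : ideal (ideal_times m I).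
Proof.
split=> //; split; first by move=> J iJ _; apply: ideal0.
split=> [x y hx hy J iJ hJ|a x _ hx J iJ hJ].
  by apply: idealB => //; [apply: hx | apply: hy].
by apply: idealMl => //; apply: hx.
Qed.

Lemma chinese_remainder_ideal I (t : (R -> Prop) -> R) l : ideal I -> (forall m, I (t m)) ->
  (forall m, List.In m l -> maximal_ideal m) ->
  exists x, I x /\ forall m, List.In m l -> ideal_times m I (x - t m).
Proof.
move=> iI It; elim: l => [|m l IH] hl; first by exists 0; split=> //; apply: ideal0.
have [k kl|x [Ix hx]] := IH; first by apply: hl; right.
case: (pselect (List.In m l)) => [ml|nml].
  by exists x; split=> // k /= [<-|]; apply: hx.
have [k kl|u [mu lu]] := maximal_comaximal_list (l := l) (hl m (or_introl (erefl m))).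
  by split=> [|e]; [apply: hl; right | apply: nml; rewrite -e].
exists (x + u * (t m - x)); split.
  by apply: idealD => //; apply: idealMl => //; apply: idealB.
move=> k /= [<-|kl].
  have -> : x + u * (t m - x) - t m = (1 - u) * (x - t m) by ring.
  by apply: ideal_times_mul => //; apply: idealB.
rewrite addrAC; apply: (idealD (@ideal_times_ideal k I)); first exact: hx.
by apply: ideal_times_mul; [apply: lu | apply: idealB].
Qed.

Definition local_generators m I (a b : R) : Prop :=
  forall z, I z -> exists s p q, ~ m s /\ s * z = p * a + q * b.

(** Multiples of [x] and [y] by elements outside [m] are combinations of [a] and [b] whose matrix is
    diagonal modulo [m]. Its determinant [D] lies outside [m], and Cramer's rule expresses [a] and
    [b] back. *)
Lemma local_nakayama m I a b x y : maximal_ideal m -> ideal I ->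
  local_generators m I a b -> ideal_times m I (x - a) -> ideal_times m I (y - b) ->
  local_generators m I x y.
Proof.
move=> mm iI gen hx hy z Iz.
have pm := maximal_prime mm; have im := maximal_is_ideal mm; have n1 := maximal_proper mm.
have key w : ideal_times m I w -> exists s p q, [/\ ~ m s, m p, m q & s * w = p * a + q * b].
  move=> hw; apply: (hw (fun w => exists s p q, [/\ ~ m s, m p, m q & s * w = p * a + q * b])); last first.
    move=> c v mc /gen[s [p [q [ms e]]]]; exists s, (c * p), (c * q).
    by split=> //; [apply: idealMr | apply: idealMr | rewrite mulrCA e; ring].
  split=> //; split.
    by exists 1, 0, 0; split=> //; [apply: ideal0 | apply: ideal0 | ring].
  split=> [u v [s [p [q [ms mp mq e]]]] [s' [p' [q' [ms' mp' mq' e']]]]|c u _ [s [p [q [ms mp mq e]]]]].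
    exists (s * s'), (s' * p - s * p'), (s' * q - s * q'); split.
    - exact: primeNM.
    - by apply: idealB => //; apply: idealMl.
    - by apply: idealB => //; apply: idealMl.
    - have -> : s * s' * (u - v) = s' * (s * u) - s * (s' * v) by ring.
      by rewrite e e'; ring.
  exists s, (c * p), (c * q); split=> //; try exact: idealMl.
  by rewrite mulrCA e; ring.
have [s1 [p1 [q1 [ms1 mp1 mq1 e1]]]] := key _ hx.
have [s2 [p2 [q2 [ms2 mp2 mq2 e2]]]] := key _ hy.
have [s [p [q [ms e]]]] := gen z Iz.
pose D := (s1 + p1) * (s2 + q2) - q1 * p2.
have mD : ~ m D.
  move=> mD; apply: (primeNM pm ms1 ms2).
  have -> : s1 * s2 = D - (p1 * (s2 + q2) + q2 * s1 - q1 * p2) by rewrite /D; ring.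
  apply: idealB => //; apply: idealB => //; last exact: idealMr.
  by apply: idealD => //; apply: idealMr.
have ex : s1 * x = (s1 + p1) * a + q1 * b.
  by rewrite -[x in LHS](subrK a) mulrDr e1; ring.
have ey : s2 * y = p2 * a + (s2 + q2) * b.
  by rewrite -[y in LHS](subrK b) mulrDr e2; ring.
exists (D * s), (p * (s2 + q2) * s1 - q * p2 * s1), (q * (s1 + p1) * s2 - p * q1 * s2).
split; first exact: primeNM.
have -> : (p * (s2 + q2) * s1 - q * p2 * s1) * x + (q * (s1 + p1) * s2 - p * q1 * s2) * y =
  (p * (s2 + q2) - q * p2) * (s1 * x) + (q * (s1 + p1) - p * q1) * (s2 * y) by ring.
by rewrite -mulrA e ex ey /D; ring.
Qed.

End IdealTimes.

Section TwoGeneratedGlobally.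
Variables (R : idomainType) (Q : fieldType) (f : {rmorphism R -> Q}).
Hypothesis f_inj : injective f.
Hypothesis Rfc : sr_finite_character (fun _ : R => True).

Lemma exists_local_generators m (I : R -> Prop) : maximal_ideal m -> sr_fg_ideals_2gen (loc f m) ->
  sr_fg_ideal (fun _ => True) I -> exists a b, [/\ I a, I b & local_generators m I a b].
Proof.
move=> mm two [iI [xs [_ hI]]].
have sL := loc_subring f_inj mm; have pm := maximal_prime mm.
have Lf := loc_image f mm; have n1 := maximal_proper mm.
have nz := loc_neq0 f_inj mm.
have sT : is_subring (fun _ : R => True) by [].
have Lxs x : x \in [seq f z | z <- xs] -> loc f m x by case/mapP=> z _ ->.
have [x [y [_ [_ hxy]]]] := two (sr_span (loc f m) [seq f x | x <- xs])
  (span_ideal sL Lxs).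
have clear w : sr_span (loc f m) [seq f x | x <- xs] w ->
    exists s a, [/\ ~ m s, I a & f s * w = f a].
  apply: (span_min (J := fun w => exists s a, [/\ ~ m s, I a & f s * w = f a])).
  - by exists 1, 0; split=> //; [apply: ideal0 | rewrite mulr0 rmorph0].
  - move=> u v [s [a [ms Ia e]]] [t [b [mt Ib e']]].
    exists (s * t), (t * a + s * b); split; first exact: primeNM.
      by apply: idealD => //; apply: idealMl.
    by rewrite !rmorphD !rmorphM -e -e'; ring.
  - move=> _ u [c [d [md ->]]] [s [a [ms Ia e]]].
    exists (d * s), (c * a); split; [exact: primeNM | exact: idealMl|].
    by rewrite !rmorphM -e; field; apply: nz.
  - move=> _ /mapP[z zxs ->]; exists 1, z; split=> //; last by rewrite rmorph1 mul1r.
    by apply/hI/span_mem.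
have mem w : w \in [:: x; y] -> sr_span (loc f m) [seq f x | x <- xs] w.
  by move=> hw; apply/hxy/span_mem.
have [s [a [ms Ia ea]]] := clear x (mem x (mem_head _ _)).
have [t [b [mt Ib eb]]] : exists s a, [/\ ~ m s, I a & f s * y = f a].
  by apply/clear/mem; rewrite !inE eqxx orbT.
exists a, b; split=> // z /hI[cs [scs [_ ez]]].
have /hxy : sr_span (loc f m) [seq f x | x <- xs] (f z).
  exists [seq f c | c <- cs]; rewrite !size_map; split=> //.
  split=> [_ /mapP[c _ ->] //|]; rewrite ez rmorph_sum; apply: eq_bigr => i _.
  by rewrite rmorphM !(nth_map 0) // scs.
case/(span2P _ _ _ sL) => _ [_ [[p1 [p2 [mp ->]]] [q1 [q2 [mq ->]]] e]].
exists (p2 * q2 * s * t), (p1 * q2 * t), (q1 * p2 * s); split.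
  by do 3![apply: primeNM => //].
apply: f_inj; rewrite rmorphD !rmorphM e -ea -eb.
by field; rewrite !nz.
Qed.

(** [x] is prescribed at the finitely many maximal ideals over a nonzero [z0] of [I], then [y] at
    those over [x]. Outside [m], [x] generates locally by itself; if [x] lies in [m] and [z0] does
    not, [y] does so. *)
Theorem ideals_2gen_local_global :
  (forall m, maximal_ideal m -> sr_fg_ideals_2gen (loc f m)) ->
  sr_fg_ideals_2gen (fun _ : R => True).
Proof.
move=> two I fgI; have iI := fgI.1.
have sT : is_subring (fun _ : R => True) by [].
suff [x [y [Ix Iy h]]] : exists x y, [/\ I x, I y &
    forall z, I z -> exists p q, z = p * x + q * y].
  exists x, y; split=> //; split=> // z; split=> [/h[p [q e]]|].
    by apply/(span2P _ _ _ sT); exists p, q.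
  case/(span2P _ _ _ sT) => p [q [_ _ ->]].
  by apply: idealD => //; apply: idealMl.
suff [x [y [Ix Iy h]]] : exists x y, [/\ I x, I y &
    forall m, maximal_ideal m -> local_generators m I x y].
  exists x, y; split=> // z Iz.
  have [|m mm|p [q]] := @ideal_unit R (fun s => exists p q, s * z = p * x + q * y).
  - split=> //; split; first by exists 0, 0; ring.
    split=> [u v [p [q e]] [p' [q' e']]|c u _ [p [q e]]].
      by exists (p - p'), (q - q'); rewrite mulrBl e e'; ring.
    by exists (c * p), (c * q); rewrite -mulrA e; ring.
  - by have [s [p [q [ms e]]]] := h m mm z Iz; exists s; split=> //; exists p, q.
  - by rewrite mul1r; exists p, q.
case: (pselect (exists z0, I z0 /\ z0 != 0)) => [[z0 [Iz0 z00]]|no]; last first.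
  exists 0, 0; split=> [||m mm z Iz]; [exact: ideal0 | exact: ideal0|].
  exists 1, 0, 0; split; first exact: maximal_proper.
  rewrite mul1r !mul0r addr0; apply/eqP; apply: contrapT => /negP z0.
  by apply: no; exists z.
have gens m : exists a b, [/\ I a, I b & maximal_ideal m -> local_generators m I a b].
  case: (pselect (maximal_ideal m)) => [mm|nm].
    by have [a [b [Ia Ib h]]] := exists_local_generators mm (two m mm) fgI; exists a, b.
  by exists 0, 0; split=> //; apply: ideal0.
have /choice[a /choice[b ab]] := gens.
have Ia m : I (a m) by case: (ab m).
have Ib m : I (b m) by case: (ab m).
have [l1 hl1] := finitely_many_maximal_over Rfc z00.
have [x [Ix x0 hx]] : exists x, [/\ I x, x != 0 &
    forall m, List.In m l1 -> ideal_times m I (x - a m)].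
  have [|x [Ix hx]] := @chinese_remainder_ideal R I a l1 iI Ia; first by move=> m /hl1[].
  (* The second choice needs a nonzero [x]. If it is 0, it is replaced by [z0 * z0], which lies in m
     I at every [m] over [z0] and so satisfies the same congruences. *)
  have [x0|x0] := eqVneq x 0; last by exists x.
  exists (z0 * z0); split; [exact: idealMl | by rewrite mulf_neq0|].
  move=> m ml; have [_ mz0] := (hl1 m).1 ml.
  have := hx m ml; rewrite x0 sub0r => h; apply: (idealD (@ideal_times_ideal R m I)) => //.
  exact: ideal_times_mul.
have [l2 hl2] := finitely_many_maximal_over Rfc x0.
(* The target for [y] is the second local generator where [x] approximates the first, and elsewhere
   [z0], which is outside [m]. *)
pose t m := if pselect (m z0) then b m else z0.
have [||y [Iy hy]] := @chinese_remainder_ideal R I t l2 iI.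
- by move=> m; rewrite /t; case: (pselect (m z0)) => _ /=.
- by move=> m /hl2[].
exists x, y; split=> // m mm; have im := maximal_is_ideal mm.
have one u v z : ~ m u -> exists s p q, ~ m s /\ s * z = p * u + q * v.
  by move=> mu; exists u, z, 0; split=> //; ring.
case: (pselect (m x)) => mx; last by move=> z _; apply: one.
have /hy : List.In m l2 by apply/hl2.
rewrite /t; case: pselect => mz0 hyt.
  have [_ _ /(_ mm) g] := ab m.
  exact: (local_nakayama mm iI g (hx m ((hl1 m).2 (conj mm mz0))) hyt).
have my : ~ m y.
  move=> my; apply: (mz0); rewrite -[z0](subKr y); apply: idealB => //.
  by apply: (hyt m im) => c d mc _; apply: idealMr.
by move=> z _; have [s [p [q [ms e]]]] := one y x z my; exists s, q, p; rewrite addrC.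
Qed.

End TwoGeneratedGlobally.

(** * Torsion-free modules as lattices *)

Section TorsionFree.
Variables (S : idomainType) (Q : fieldType) (g : {rmorphism S -> Q}).
Hypothesis g_inj : injective g.
Hypothesis g_frac : forall q : Q, exists a b : S, g b != 0 /\ q = g a / g b.
Variable M : lmodType S.
Hypothesis M_tf : torsion_free M.

Notation L := (image g).

Let sL := image_subring g.

Lemma mx_over_imageP n k (T : 'M[Q]_(n, k)) : mx_over L T -> exists U, T = map_mx g U.
Proof.
move=> h; exists (\matrix_(i, j) projT1 (cid (h i j))).
by apply/matrixP => i j; rewrite !mxE; case: (cid _).
Qed.

Definition lincomb n (x : 'I_n -> M) (c : 'rV[S]_n) : M := \sum_i c 0 i *: x i.

Lemma lincombP n (x : 'I_n -> M) a (c d : 'rV[S]_n) :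
  lincomb x (a *: c + d) = a *: lincomb x c + lincomb x d.
Proof.
rewrite scaler_sumr -big_split; apply: eq_bigr => i _.
by rewrite !mxE scalerDl scalerA.
Qed.

Lemma lincomb0 n (x : 'I_n -> M) : lincomb x 0 = 0.
Proof. by apply: big1 => i _; rewrite mxE scale0r. Qed.

Lemma lincombB n (x : 'I_n -> M) (c d : 'rV[S]_n) :
  lincomb x (c - d) = lincomb x c - lincomb x d.
Proof. by rewrite [c - d]addrC -[- d]scaleN1r lincombP scaleN1r addrC. Qed.

Lemma lincomb_mul n (x : 'I_n -> M) p (c : 'rV[S]_p) (A : 'M[S]_(p, n)) :
  lincomb x (c *m A) = \sum_j c 0 j *: lincomb x (row j A).
Proof.
rewrite mulmx_sum_row; elim/big_rec2: _ => [|j u v _ <-]; first exact: lincomb0.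
exact: lincombP.
Qed.

(* The relations among the x i are cut out by a matrix of relations of maximal rank. *)
Lemma relation_matrix n (x : 'I_n -> M) : exists k (B : 'M[Q]_(n, k)), row_full B /\
  forall c, lincomb x c = 0 <-> map_mx g c *m B = 0.
Proof.
pose rel p (A : 'M[S]_(p, n)) := forall i, lincomb x (row i A) = 0.
pose P r := `[< exists p (A : 'M[S]_(p, n)), rel p A /\ \rank (map_mx g A) = r >].
have [|r|r /asboolP[p [A [relA rA]]] rmax] := @ex_maxnP P n.
- exists 0%N; apply/asboolP; exists 0%N, 0; split; first by case.
  by rewrite map_mx0 mxrank0.
- by case/asboolP => p [A [_ <-]]; apply: rank_leq_col.
exists _, (col_base (cokermx (map_mx g A))); split; first exact: col_base_full.
move=> c.
have -> : (map_mx g c *m col_base (cokermx (map_mx g A)) = 0) <-> (map_mx g c <= map_mx g A)%MS.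
  rewrite submxE -[in X in _ <-> is_true (X == _)](mulmx_base (cokermx _)) mulmxA.
  by rewrite mulmx_free_eq0 ?row_base_free //; split=> [->|/eqP].
(* A further relation cannot raise the maximal rank. Conversely, a row in the span becomes a
   combination over [S] after scaling by [s], and torsion-freeness removes [s]. *)
split=> [c0|/submxP[C eC]].
  have sub : (map_mx g A <= col_mx (map_mx g c) (map_mx g A))%MS.
    by rewrite -addsmxE addsmxSr.
  have := mxrank_leqif_sup sub; rewrite -map_col_mx => -[_ h].
  suff : (map_mx g (col_mx c A) <= map_mx g A)%MS.
    by apply: submx_trans; rewrite map_col_mx -addsmxE addsmxSl.
  rewrite -h eqn_leq {1}mxrankS ?map_col_mx //= rA; apply: rmax; apply/asboolP.
  exists (1 + p)%N, (col_mx c A); rewrite map_col_mx; split=> // i.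
  rewrite /rel; case: (fintype.splitP i) => j ej.
    have -> : i = lshift p j by apply: val_inj.
    by rewrite rowKu [row j c](_ : _ = c) //; apply/rowP => l; rewrite mxE ord1.
  have -> : i = rshift 1 j by apply: val_inj.
  by rewrite rowKd.
have [s [s0 /mx_over_imageP[C' eC']]] := mx_denominator g_inj g_frac C.
have esc : s *: c = C' *m A.
  have : map_mx g (s *: c) = map_mx g (C' *m A) by rewrite map_mxZ map_mxM eC -eC' scalemxAl.
  by move/matrixP => e; apply/matrixP => i j; apply: g_inj; have := e i j; rewrite ![map_mx g _ i j]mxE.
have : lincomb x (s *: c + 0) = 0.
  by rewrite addr0 esc lincomb_mul big1 // => j _; rewrite relA scaler0.
by rewrite lincombP lincomb0 addr0 => /M_tf[e|//]; rewrite e eqxx in s0.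
Qed.

Definition lattice_iso n k (B : 'M[Q]_(n, k)) (theta : M -> 'rV[Q]_k) : Prop :=
  [/\ row_full B, injective theta,
      forall a y z, theta (a *: y + z) = g a *: theta y + theta z &
      forall v, lattice L B v <-> exists y, v = theta y].

Lemma exists_lattice_iso : fg_module M ->
  exists n k (B : 'M[Q]_(n, k)) theta, lattice_iso B theta.
Proof.
case=> _ [xs [_ hxs]]; pose n := size xs; pose x (i : 'I_n) := xs`_i.
have /choice[sec secK] : forall y, exists c, lincomb x c = y.
  move=> y; have [cs [_ ->]] := (hxs y).1 I; exists (\row_i cs`_i).
  by apply: eq_bigr => i _; rewrite mxE.
have [k [B [fB hB]]] := relation_matrix x.
exists n, k, B, (fun y => map_mx g (sec y) *m B).
have well c d : lincomb x c = lincomb x d -> map_mx g c *m B = map_mx g d *m B.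
  move=> e; apply/eqP; rewrite -subr_eq0 -mulmxBl -map_mxB; apply/eqP/hB.
  by rewrite lincombB e subrr.
split=> // [y z e|a y z|v].
- rewrite -[y]secK -[z]secK; apply/eqP; rewrite -subr_eq0 -lincombB; apply/eqP/hB.
  by rewrite map_mxB mulmxBl e subrr.
- rewrite scalemxAl -mulmxDl -map_mxZ -map_mxD; apply: well.
  by rewrite lincombP !secK.
- split=> [[c [/mx_over_imageP[d ->] ->]]|[y ->]].
    by exists (lincomb x d); apply: well; rewrite secK.
  by exists (map_mx g (sec y)); split=> // i j; rewrite mxE; exists (sec y i j).
Qed.

Section LatticeIso.
Variables (n k : nat) (B : 'M[Q]_(n, k)) (theta : M -> 'rV[Q]_k).
Hypothesis iso : lattice_iso B theta.

Let fB : row_full B. Proof. by case: iso. Qed.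
Let theta_inj : injective theta. Proof. by case: iso. Qed.
Let thetaP a y z : theta (a *: y + z) = g a *: theta y + theta z.
Proof. by case: iso. Qed.
Let latticeE v : lattice L B v <-> exists y, v = theta y. Proof. by case: iso. Qed.

Lemma theta_linear0 : theta 0 = 0.
Proof.
have := thetaP (-1) 0 0; rewrite scaleN1r oppr0 addr0 rmorphN rmorph1 scaleN1r.
by rewrite addNr.
Qed.

Lemma theta_linearD y z : theta (y + z) = theta y + theta z.
Proof. by rewrite -[y]scale1r thetaP rmorph1 !scale1r. Qed.

Lemma theta_linearZ a y : theta (a *: y) = g a *: theta y.
Proof. by rewrite -[a *: y]addr0 thetaP theta_linear0 addr0. Qed.

Lemma theta_linearN y : theta (- y) = - theta y.
Proof. by rewrite -scaleN1r theta_linearZ rmorphN rmorph1 scaleN1r. Qed.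

Lemma theta_lattice y : lattice L B (theta y).
Proof. by apply/latticeE; exists y. Qed.

Lemma theta_mx_ext (F G : 'M[Q]_k) : (forall y, theta y *m F = theta y *m G) -> F = G.
Proof.
move=> h; apply: (row_full_inj fB); apply/row_matrixP => i; rewrite !row_mul.
by have /latticeE[y ->] := lattice_row sL B i.
Qed.

Lemma endo_matrix phi : endo phi ->
  exists F, lattice_hom L B B F /\ forall y, theta (phi y) = theta y *m F.
Proof.
move=> lphi.
have phi0 : phi 0 = 0 by have := lphi (-1) 0 0; rewrite scaleN1r oppr0 addr0 scaleN1r addNr.
have phiD u v : phi (u + v) = phi u + phi v by rewrite -[u]scale1r lphi !scale1r.
have phiZ a u : phi (a *: u) = a *: phi u by rewrite -[a *: u]addr0 lphi phi0 addr0.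
have /choice[x hx] : forall i, exists y, row i B = theta y.
  by move=> i; apply/latticeE/lattice_row.
pose Y := \matrix_i theta (phi (x i)).
have comb (c : 'rV[S]_n) : theta (\sum_i c 0 i *: x i) = map_mx g c *m B /\
    theta (phi (\sum_i c 0 i *: x i)) = map_mx g c *m Y.
  rewrite (big_morph phi phiD phi0) !(big_morph theta theta_linearD theta_linear0).
  rewrite !mulmx_sum_row; split; apply: eq_bigr => i _; rewrite mxE.
    by rewrite theta_linearZ hx.
  by rewrite phiZ theta_linearZ rowK.
have [c /mx_over_imageP[d ->] e|F eF] := @mx_factor _ _ g g_inj g_frac _ _ _ B Y.
  have [e1 <-] := comb d; rewrite (_ : \sum_i _ = 0) ?phi0 ?theta_linear0 //.
  by apply: theta_inj; rewrite e1 e theta_linear0.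
have eFy y : theta (phi y) = theta y *m F.
  have [c [/mx_over_imageP[d ->] ey]] := theta_lattice y.
  have [e1 e2] := comb d; have -> : y = \sum_i d 0 i *: x i by apply: theta_inj; rewrite e1 ey.
  by rewrite e2 e1 eF mulmxA.
exists F; split=> // v /latticeE[y ->]; rewrite -eFy.
exact: theta_lattice.
Qed.

Lemma matrix_endo F : lattice_hom L B B F ->
  exists phi, endo phi /\ forall y, theta (phi y) = theta y *m F.
Proof.
move=> hF; have /choice[phi hphi] : forall y, exists z, theta z = theta y *m F.
  by move=> y; have /latticeE[z ->] := hF _ (theta_lattice y); exists z.
exists phi; split=> // a y z; apply: theta_inj.
by rewrite hphi !thetaP !hphi mulmxDl scalemxAl.
Qed.

(** A one-sided inverse suffices on the matrix side, as square matrices over a field have two-sided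
    inverses. *)
Lemma endo_invertibleP phi (F : 'M[Q]_k) : endo phi -> (forall y, theta (phi y) = theta y *m F) ->
  endo_invertible phi <-> exists G, lattice_hom L B B G /\ F *m G = 1%:M.
Proof.
move=> ephi hF; split=> [[psi [epsi [psiK _]]]|[G [hG FG]]].
  have [G [hG eG]] := endo_matrix epsi; exists G; split=> //.
  by apply: theta_mx_ext => y; rewrite mulmxA -hF -eG psiK mulmx1.
have [psi [epsi eG]] := matrix_endo hG.
exists psi; split=> //; split=> y; apply: theta_inj.
  by rewrite eG hF -mulmxA FG mulmx1.
by rewrite hF eG -mulmxA (mulmx1C FG) mulmx1.
Qed.

Lemma indecomposable_idempotent E : indecomposable M -> E *m E = E ->
  lattice_hom L B B E -> E = 0 \/ E = 1%:M.
Proof.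
move=> [_ ind] EE /matrix_endo[eps [_ heps]].
have [|h|h] := ind (fun y => theta y *m E = theta y) (fun y => theta y *m E = 0).
- split; first split; rewrite ?theta_linear0 ?mul0mx //.
    split=> [y z hy hz|a y hy].
      by rewrite theta_linearD theta_linearN mulmxDl mulNmx hy hz.
    by rewrite theta_linearZ -scalemxAl hy.
  split; first split; rewrite ?theta_linear0 ?mul0mx //.
    split=> [y z hy hz|a y hy].
      by rewrite theta_linearD theta_linearN mulmxDl mulNmx hy hz subrr.
    by rewrite theta_linearZ -scalemxAl hy scaler0.
  split=> [y hy|y]; first by rewrite hy -theta_linear0 => /theta_inj.
  split=> // _; exists (eps y), (y - eps y).
  by rewrite heps -mulmxA EE theta_linearD theta_linearN heps mulmxBl -mulmxA EE subrr addrC subrK.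
- left; apply: theta_mx_ext => y; rewrite mulmx0 -heps.
  by rewrite (h (eps y)) ?theta_linear0 // heps -mulmxA EE.
- right; apply: theta_mx_ext => y; rewrite mulmx1 -heps; congr theta.
  apply/eqP; rewrite eq_sym -subr_eq0; apply/eqP/h.
  by rewrite theta_linearD theta_linearN heps mulmxBl -mulmxA EE subrr.
Qed.

Lemma local_lattice_End : (exists y : M, y != 0) -> local_lattice L B -> local_End M.
Proof.
move=> [y0 y00] locB; split.
  case=> psi [_ [psiK _]]; case/eqP: y00.
  by rewrite -(psiK y0) (psiK 0).
split=> [phi psi ephi epsi nphi npsi|phi psi ephi epsi nphi].
  have [F [hF eF]] := endo_matrix ephi; have [G [hG eG]] := endo_matrix epsi.
  have esum : endo (fun y => phi y + psi y).
    by move=> a y z; rewrite ephi epsi scalerDr addrACA.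
  have eFG y : theta (phi y + psi y) = theta y *m (F + G).
    by rewrite theta_linearD eF eG mulmxDr.
  case/(endo_invertibleP esum eFG) => W [hW FGW].
  (* [F *m W] and [G *m W] add up to 1, so locality makes one of them invertible, and with it [F] or
     [G]. *)
  have [[U [hU e _]]|[U [hU e _]]] := locB _ (lattice_homM hF hW).
    by apply: nphi; apply/(endo_invertibleP ephi eF); exists (W *m U);
      split; [apply: lattice_homM hW hU | rewrite mulmxA].
  apply: npsi; apply/(endo_invertibleP epsi eG); exists (W *m U).
  split; first exact: lattice_homM hW hU.
  by rewrite mulmxA -e; congr (_ *m _); rewrite -FGW mulmxDl addrC addKr.
have [F [hF eF]] := endo_matrix ephi; have [G [hG eG]] := endo_matrix epsi.
split=> inv; apply: nphi; apply/(endo_invertibleP ephi eF).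
  have eFG y : theta ((phi \o psi) y) = theta y *m (G *m F) by rewrite /= eF eG mulmxA.
  have e : endo (phi \o psi) by move=> a y z; rewrite /= epsi ephi.
  have [V [hV h]] := (endo_invertibleP e eFG).1 inv.
  exists (V *m G); split; first exact: lattice_homM hV hG.
  by apply: mulmx1C; rewrite -mulmxA; apply: mulmx1C.
have eFG y : theta ((psi \o phi) y) = theta y *m (F *m G) by rewrite /= eG eF mulmxA.
have e : endo (psi \o phi) by move=> a y z; rewrite /= ephi epsi.
have [V [hV h]] := (endo_invertibleP e eFG).1 inv.
by exists (G *m V); split; [apply: lattice_homM hG hV | rewrite mulmxA].
Qed.

End LatticeIso.
End TorsionFree.

Theorem mainTheorem8 (R : idomainType) (Q : fieldType) (f : {rmorphism R -> Q})
  (f_inj : injective f)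
  (f_frac : forall q : Q, exists a b : R, f b != 0 /\ q = f a / f b)
  (Rfc : sr_finite_character (fun _ : R => True))
  (Rdim : sr_krull_dim (fun _ : R => True) 1)
  (Hadd : forall X : lmodType R, fg_module X -> torsion_free X ->
            forall N : lmodType R, in_Add X N -> dsum_of_fg N) :
  let Rimg : Q -> Prop := fun q => exists r, q = f r in
  let Rbar : Q -> Prop := integral_over Rimg in
  (* (1) *)
  (forall m : R -> Prop, sr_maximal_ideal (fun _ => True) m ->
     forall (S : idomainType) (g : {rmorphism S -> Q}), injective g ->
       (forall q, loc f m q -> exists s, q = g s) ->
       (forall s, integral_over (loc f m) (g s)) ->
       forall M : lmodType S, fg_module M -> indecomposable M -> torsion_free M ->
         local_End M) /\
  (* (2) *)
  (exists m0 : R -> Prop, forall m : R -> Prop,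
     sr_maximal_ideal (fun _ => True) m -> ~ (forall r, m r <-> m0 r) ->
       sr_fg_ideals_2gen (loc f m) /\ valuation_in (integral_over (loc f m))) /\
  (* (3) *)
  (forall m : R -> Prop, sr_maximal_ideal (fun _ => True) m ->
     exists P : Q -> Prop, (sr_maximal_ideal Rbar P /\ forall r, P (f r) <-> m r) /\
       forall P' : Q -> Prop, sr_maximal_ideal Rbar P' -> (forall r, P' (f r) <-> m r) ->
         forall x, P' x <-> P x) /\
  sr_finite_character Rbar /\
  (* furthermore *)
  ((forall m : R -> Prop, sr_maximal_ideal (fun _ => True) m ->
      sr_fg_ideals_2gen (loc f m)) ->
   sr_pruefer Rbar /\ sr_krull_dim Rbar 1 /\ sr_fg_ideals_2gen (fun _ : R => True)).
Proof.
move=> Rimg Rbar; split.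
  move=> m mm S g g_inj locS intS M fgM indM tfM.
  have frac q : exists a b : S, g b != 0 /\ q = g a / g b.
    have [a [b [b0 ->]]] := f_frac q.
    have [a' ea] := locS _ (loc_image f mm a).
    have [b' eb] := locS _ (loc_image f mm b).
    by exists a', b'; rewrite -ea -eb.
  have [n [k [B [theta iso]]]] := exists_lattice_iso g_inj frac tfM fgM.
  apply: (local_lattice_End g_inj frac iso) => //; first by case: indM.
  (* The criterion is stated in positive dimension; in dimension 0 every endomorphism is
     invertible. *)
  case: k B theta iso => [|k] B theta iso.
    by move=> F hF; left; exists F; split=> //; rewrite flatmx0 [RHS]flatmx0.
  have intL q : image g q -> integral_over (loc f m) q by case=> s ->.
  apply: (trivial_idempotents_local f_inj f_frac Rfc Rdim Hadd mm (image_subring g) locS intL) => //.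
  - exact: (subring_local f_inj f_frac Rfc Rdim Hadd mm (image_subring g) locS intL).
  - by case: iso.
  - move=> E; exact: (indecomposable_idempotent iso indM).
split.
  case: (pselect (exists m0, maximal_ideal m0 /\ bad_maximal f m0)) => [[m0 [mm0 bad0]]|no].
    exists m0 => m mm ne.
    have good : ~ bad_maximal f m.
      by move=> bad; apply: ne => r; rewrite (bad_unique f_inj f_frac Rfc Rdim Hadd mm mm0 bad bad0).
    by split; [apply: good_2gen | apply: (good_valuation f_inj f_frac Rfc Rdim Hadd mm)].
  (* With no exception to exclude, the empty predicate, which is no ideal, stands for [m0]. *)
  exists (fun _ => False) => m mm _.
  have good : ~ bad_maximal f m by move=> bad; apply: no; exists m.
  by split; [apply: good_2gen | apply: (good_valuation f_inj f_frac Rfc Rdim Hadd mm)].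
split.
  move=> m mm; exists (closure_maximal f m); split.
    split; first exact: closure_maximalP.
    by move=> r; apply: closure_maximal_over.
  by move=> P'; apply: (closure_maximal_unique f_inj f_frac Rfc Rdim Hadd mm).
split; first exact: (closure_finite_character f_inj f_frac Rfc Rdim Hadd).
move=> two; split; last split.
- apply: (closure_pruefer f_inj) => m mm; apply: (good_valuation f_inj f_frac Rfc Rdim Hadd mm).
  exact: (two_generated_good f_inj f_frac mm (two m mm)).
- exact: (closure_krull_dim f_inj f_frac Rfc Rdim Hadd).
- exact: (ideals_2gen_local_global f_inj Rfc two).
Qed.
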